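(* Let $N\ge3$, $m\in\{2,\dots,N-1\}$, $R>0$, $A=\{x\in\mathbb{R}^N:|x|>R\}$, and let $a$ be a radial function on $A$ with $a\in W^{1,1}_{\mathrm{loc}}(A)\cap L^\infty(A)$, $a\ge0$, $|\nabla a|\in L^2(A)$ and $a\not\equiv0$. Let $p$ satisfy $$2+\frac{2N}{\left(\frac{N-2}{2}\right)^2+R^2}\le p<2^*_{N-m+1}.$$ Then every $\mathcal K$-ground state solution of $$-\Delta u+u=a(|x|)u^{p-1}\ \text{ in }A,\qquad u>0\ \text{ in }A,\qquad u\in H^1_0(A),$$ is nonradial.
   Context: For $x\in\mathbb{R}^N=\mathbb{R}^m\times\mathbb{R}^{N-m}$ write $r=|x|$ and $\theta=\arcsin\big(\tfrac1r\sqrt{x_{m+1}^2+\dots+x_N^2}\big)\in[0,\pi/2]$. Writing $u=\mathfrak u(r,\theta)$ means that $u(x)$ depends (a.e.) only on $(r,\theta)$; $\mathfrak u_\theta$ is the weak partial derivative with respect to $\theta$. Define $$\mathcal K=\{u\in W^{1,1}_{\mathrm{loc}}(A): u=\mathfrak u(r,\theta),\ u\ge0,\ \mathfrak u_\theta\le0 \text{ a.e. in }A\}\cap H^1_0(A).$$ For an integer $n\ge2$, $2^*_n=\frac{2n}{n-2}$ if $n\ge3$ and $2^*_2=\infty$. For $p\in(2,2^*_{N-m+1})$ one has $\mathcal K\subset L^p(A)$. Let $I(u)=\frac12\int_A(|\nabla u|^2+u^2)\,dx-\frac1p\int_A a|u|^p\,dx$ on $H^1_0(A)\cap L^p(A)$,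 $\mathcal N_{\mathcal K}=\{u\in\mathcal K: u\not\equiv0,\ I'(u)u=0\}$, where $I'(u)u=\int_A(|\nabla u|^2+u^2)\,dx-\int_A a|u|^p\,dx$, and $c_I=\inf_{u\in\mathcal N_{\mathcal K}}I(u)$. A $\mathcal K$-ground state solution is a (weak) solution $u$ of the problem with $u\in\mathcal N_{\mathcal K}$ and $I(u)=c_I>0$. Weak solution means $\int_A(\nabla u\cdot\nabla\varphi+u\varphi)\,dx=\int_A a u^{p-1}\varphi\,dx$ for all $\varphi\in C_c^\infty(A)$. *)

(* Defs.v *)
From HB Require Import structures.
From mathcomp Require Import all_boot all_order all_algebra.
From mathcomp Require Import all_classical all_reals all_analysis.
Set Implicit Arguments.
Unset Strict Implicit.
Unset Printing Implicit Defensive.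
Import Order.TTheory GRing.Theory Num.Theory.
Import numFieldNormedType.Exports.
Local Open Scope classical_set_scope.
Local Open Scope ring_scope.

Definition measure_rV_display : measure_display -> measure_display.
Proof. exact. Qed.

Section measurable_rV.
Context {d} {T : sigmaRingType d} (n : nat).

Let coord (i : 'I_n) (x : 'rV[T]_n) : T := x ord0 i.

Let rV_set0 : g_sigma_preimage coord set0.
Proof. exact: sigma_algebra0. Qed.

Let rV_setC A : g_sigma_preimage coord A -> g_sigma_preimage coord (~` A).
Proof. exact: sigma_algebraC. Qed.

Let rV_bigcup (F : (set 'rV[T]_n)^nat) : (forall i, g_sigma_preimage coord (F i)) ->
  g_sigma_preimage coord (\bigcup_i (F i)).
Proof. exact: sigma_algebra_bigcup. Qed.

(* The sigma-algebra generated by the coordinates; over the reals it is the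
   Borel sigma-algebra. *)
HB.instance Definition _ := @isMeasurable.Build (measure_rV_display d)
  'rV[T]_n (g_sigma_preimage coord) rV_set0 rV_setC rV_bigcup.

End measurable_rV.

Section lebesgue_measure_rV.
Context {R : realType}.

Definition rVcons n (vt : 'rV[R]_n * measurableTypeR R) : 'rV[R]_n.+1 :=
  \row_i (if unlift ord0 i is Some j then vt.1 ord0 j else vt.2).

Lemma rVcons_ord0 n (vt : 'rV[R]_n * measurableTypeR R) : rVcons vt ord0 ord0 = vt.2.
Proof. by rewrite mxE unlift_none. Qed.

Lemma rVcons_lift n (vt : 'rV[R]_n * measurableTypeR R) (i : 'I_n) :
  rVcons vt ord0 (lift ord0 i) = vt.1 ord0 i.
Proof. by rewrite mxE liftK. Qed.

Lemma measurable_coord n (i : 'I_n) :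
  measurable_fun setT (fun x : 'rV[R]_n => x ord0 i).
Proof.
move=> _ Y mY; rewrite setTI; apply: sub_sigma_algebra => /=.
rewrite -bigcup_seq/=; exists i => /=; first by rewrite mem_index_enum.
by exists Y => //; rewrite setTI.
Qed.

Lemma measurable_rVcons n : measurable_fun setT (@rVcons n).
Proof.
suff h : g_sigma_preimage (fun (i : 'I_n.+1) (x : 'rV[R]_n.+1) => x ord0 i)
    `<=` [set B | measurable ((@rVcons n) @^-1` B)].
  by move=> _ B mB; rewrite setTI; exact: h.
apply: smallest_sub.
  split => /=.
  - by rewrite preimage_set0.
  - by move=> B mB; rewrite setTD preimage_setC; exact: measurableC.
  - by move=> F mF; rewrite preimage_bigcup; exact: bigcup_measurable.
rewrite -bigcup_seq => B [i _] [C mC <-] /=; rewrite setTI -comp_preimage.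
have mi : measurable_fun setT ((fun x : 'rV[R]_n.+1 => x ord0 i) \o @rVcons n).
  case: (unliftP ord0 i) => [j|] ->.
    rewrite (_ : _ \o _ = (fun x : 'rV[R]_n => x ord0 j) \o fst).
      by apply: measurableT_comp => //; exact: measurable_coord.
    by apply/funext => vt /=; rewrite rVcons_lift.
  rewrite (_ : _ \o _ = snd); first exact: measurable_snd.
  by apply/funext => vt /=; rewrite rVcons_ord0.
by rewrite -[X in measurable X]setTI; exact: mi.
Qed.

Section lebesgue_rVS.
Context n (mu : {measure set 'rV[R]_n -> \bar R}).

Definition lebesgue_rVS : set 'rV[R]_n.+1 -> \bar R :=
  pushforward (mu \x @lebesgue_measure R)%E (@rVcons n).

Let lebesgue_rVS0 : lebesgue_rVS set0 = 0%E.
Proof. by rewrite /lebesgue_rVS /pushforward preimage_set0 measure0. Qed.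

Let lebesgue_rVS_ge0 A : (0 <= lebesgue_rVS A)%E.
Proof. exact: integral_ge0. Qed.

Let lebesgue_rVS_sigma_additive : semi_sigma_additive lebesgue_rVS.
Proof.
have mP B : measurable B -> measurable ((@rVcons n) @^-1` B).
  by move=> mB; rewrite -[X in measurable X]setTI; exact: measurable_rVcons.
move=> F mF tF mUF; rewrite /lebesgue_rVS /pushforward preimage_bigcup.
apply: measure_semi_sigma_additive.
- by move=> k; exact: mP.
- apply/trivIsetP => /= i j _ _ ij; rewrite -preimage_setI.
  by move/trivIsetP : tF => /(_ _ _ _ _ ij) ->//; rewrite preimage_set0.
- by rewrite -preimage_bigcup; exact: mP.
Qed.

HB.instance Definition _ := isMeasure.Build _ _ _ lebesgue_rVS
  lebesgue_rVS0 lebesgue_rVS_ge0 lebesgue_rVS_sigma_additive.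

End lebesgue_rVS.

Fixpoint lebesgue_rV n : {measure set 'rV[R]_n -> \bar R} :=
  if n is n'.+1 then lebesgue_rVS (lebesgue_rV n') else dirac (0 : 'rV[R]_0).

(* The usual characterization: the volume of a box is the product of the
   lengths of its sides. *)
Lemma lebesgue_rV_box n (B : 'I_n -> set R) : (forall i, measurable (B i)) ->
  lebesgue_rV n [set x : 'rV[R]_n | forall i, B i (x ord0 i)] =
  (\prod_(i < n) lebesgue_measure (B i))%E.
Proof.
elim: n B => [B _|n IH B mB].
  rewrite big_ord0 /= diracE mem_set//= => -[].
  by [].
rewrite big_ord_recl.
have EB : @rVcons n @^-1` [set x | forall i, B i (x ord0 i)] =
    [set x : 'rV[R]_n | forall i, B (lift ord0 i) (x ord0 i)] `*` B ord0.
  apply/seteqP; split => -[v t] /=.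
    move=> h; split.
      by move=> i; move: (h (lift ord0 i)); rewrite rVcons_lift.
    by move: (h ord0); rewrite rVcons_ord0.
  move=> [hv ht] i; case: (unliftP ord0 i) => [j|] ->.
    by rewrite rVcons_lift; exact: hv.
  by rewrite rVcons_ord0.
rewrite [LHS](_ : _ = (lebesgue_rV n \x @lebesgue_measure R)%E
    ([set x : 'rV[R]_n | forall i, B (lift ord0 i) (x ord0 i)] `*` B ord0)); last first.
  by rewrite -EB.
rewrite product_measure1E; last exact: (mB ord0).
  by rewrite -(IH (fun i => B (lift ord0 i)))// muleC.
rewrite (_ : [set x | _] = \bigcap_i
    ((fun x : 'rV[R]_n => x ord0 i) @^-1` B (lift ord0 i))).
  apply: fin_bigcap_measurable; first exact: finite_finset.
  by move=> i _; rewrite -[X in measurable X]setTI; exact: measurable_coord.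
by apply/seteqP; split => x /= h; [move=> i _|move=> i]; exact: h.
Qed.

End lebesgue_measure_rV.

Arguments lebesgue_rV {R} n.

Section sobolev.
Context {R : realType} {n : nat}.
Implicit Types (Omega : set 'rV[R]_n) (u v phi : 'rV[R]_n -> R)
  (g : 'rV[R]_n -> 'rV[R]_n).

Let mu := @lebesgue_rV R n.

Definition ae_in Omega (P : 'rV[R]_n -> Prop) : Prop :=
  {ae mu, forall x, Omega x -> P x}.

(* The norm of the normed module ['rV[R]_n] is the sup norm. *)
Definition enorm (x : 'rV[R]_n) : R := Num.sqrt (\sum_(i < n) x ord0 i ^+ 2).

Definition dotp (x y : 'rV[R]_n) : R := \sum_(i < n) x ord0 i * y ord0 i.

Definition pderiv (i : 'I_n) u : 'rV[R]_n -> R := 'D_(delta_mx ord0 i) u.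

Definition grad u (x : 'rV[R]_n) : 'rV[R]_n := \row_i pderiv i u x.

Fixpoint of_class_C (k : nat) u : Prop :=
  if k is k'.+1 then
    continuous u /\
    forall i, (forall x, derivable u x (delta_mx ord0 i)) /\
              of_class_C k' (pderiv i u)
  else continuous u.

Definition smooth u : Prop := forall k, of_class_C k u.

(* The space C_c^oo(Omega), each element being extended by 0. *)
Definition test_fun Omega phi : Prop :=
  smooth phi /\
  exists K, [/\ compact K, K `<=` Omega & forall x, ~ K x -> phi x = 0].

Definition Lp Omega (q : \bar R) u : Prop :=
  measurable_fun Omega u /\ finite_norm mu q (u \_ Omega).

Definition L1loc Omega u : Prop :=
  measurable_fun Omega u /\
  forall K, compact K -> K `<=` Omega -> mu.-integrable K (EFin \o u).

Definition weak_pderiv Omega (i : 'I_n) u v : Prop :=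
  [/\ L1loc Omega u, L1loc Omega v &
      forall phi, test_fun Omega phi ->
        (\int[mu]_(x in Omega) (u x * pderiv i phi x)%:E =
         - \int[mu]_(x in Omega) (v x * phi x)%:E)%E].

Definition has_wgrad Omega u g : Prop :=
  forall i, weak_pderiv Omega i u (fun x => g x ord0 i).

(* The weak gradient, which is determined up to a null subset of Omega; it is
   only meaningful when u is in W^{1,1}_loc(Omega). *)
Definition wgrad Omega u : 'rV[R]_n -> 'rV[R]_n :=
  xget (fun=> 0) [set g | has_wgrad Omega u g].

Definition W11loc Omega u : Prop :=
  L1loc Omega u /\ exists g, has_wgrad Omega u g.

Definition H1 Omega u : Prop :=
  [/\ W11loc Omega u, Lp Omega 2%:E u &
      forall i, Lp Omega 2%:E (fun x => wgrad Omega u x ord0 i)].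

Definition H1norm2 Omega u : \bar R :=
  (\int[mu]_(x in Omega) (enorm (wgrad Omega u x) ^+ 2 + u x ^+ 2)%:E)%E.

Definition H10 Omega u : Prop :=
  H1 Omega u /\
  forall e : R, 0 < e ->
    exists2 phi, test_fun Omega phi & (H1norm2 Omega (u \- phi)%R < e%:E)%E.

Definition radial Omega u : Prop :=
  exists g : R -> R, ae_in Omega (fun x => u x = g (enorm x)).

End sobolev.

(* Meaningful for n >= 2 only. *)
Definition crit_exp {R : realType} (n : nat) : \bar R :=
  if (n <= 2)%N then +oo%E else ((2 * n)%:R / (n - 2)%:R)%:E.

Section ground_states.
Context {R : realType} (N m : nat) (r0 : R).
Implicit Types (u a : 'rV[R]_N -> R) (p : R).

Let mu := @lebesgue_rV R N.

Definition ext_domain : set 'rV[R]_N := [set x | r0 < enorm x].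

Let A := ext_domain.

Definition polar_angle (x : 'rV[R]_N) : R :=
  asin ((enorm x)^-1 * Num.sqrt (\sum_(i < N | (m <= i)%N) x ord0 i ^+ 2)).

Definition polar (x : 'rV[R]_N) : 'rV[R]_2 :=
  \row_(i < 2) if i == ord0 then enorm x else polar_angle x.

Definition polar_domain : set 'rV[R]_2 :=
  [set y | r0 < y ord0 ord0 /\ 0 < y ord0 ord_max < pi / 2].

(* The weak derivative with respect to theta is taken on [polar_domain], whose
   complement in the image of A under [polar] corresponds to a null set. *)
Definition coneK u : Prop :=
  [/\ W11loc A u,
      exists U Utheta : 'rV[R]_2 -> R,
        [/\ ae_in A (fun x => u x = U (polar x)),
            weak_pderiv polar_domain ord_max U Utheta &
            ae_in A (fun x => Utheta (polar x) <= 0)],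
      ae_in A (fun x => 0 <= u x) &
      H10 A u].

Definition nonlin_term a p u : \bar R :=
  (\int[mu]_(x in A) (a x * `|u x| `^ p)%:E)%E.

(* The functionals below take extended real values so that no convention is
   needed for functions which are not in L^p(A); on the set [nehariK] the
   value of [energy] is finite. *)
Definition energy a p u : \bar R :=
  ((2^-1)%:E * H1norm2 A u - (p^-1)%:E * nonlin_term a p u)%E.

(* I'(u)u *)
Definition denergy a p u : \bar R := (H1norm2 A u - nonlin_term a p u)%E.

Definition nehariK a p u : Prop :=
  [/\ coneK u, ~ ae_in A (fun x => u x = 0) & denergy a p u = 0%E].

Definition c_I a p : \bar R := ereal_inf [set energy a p u | u in nehariK a p].

Definition weak_solution a p u : Prop :=
  [/\ H10 A u, ae_in A (fun x => 0 < u x) &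
      forall phi, test_fun A phi ->
        (\int[mu]_(x in A) (dotp (wgrad A u x) (grad phi x) + u x * phi x)%:E =
         \int[mu]_(x in A) (a x * u x `^ (p - 1) * phi x)%:E)%E].

Definition K_ground_state a p u : Prop :=
  [/\ weak_solution a p u, nehariK a p u,
      energy a p u = c_I a p & (0 < c_I a p)%E].

End ground_states.

(* Main.v *)
(* Suppose that the ground state u is radial.  Perturb it to v = t (1 + s phi) u, where
   phi = sum_i c_i x_i^2 / |x|^2 with sum_i c_i = 0 is a spherical harmonic of degree 2
   which is a decreasing function of theta; v stays in the cone for 0 < s < 1.  As u and a
   are rotation invariant, integrating against phi gives 0 and against phi^2 gives a
   constant kappa > 0 times the integral of the radial factor.  Writing E = |u|_{H^1}^2
   and H = int u^2 / |x|^2, integration by parts gives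
     |(1 + s phi) u|_{H^1}^2 = E + s^2 kappa (E + 2 N H),
   whereas int a |(1 + s phi) u|^p >= E (1 + c s^2 kappa) for every c < p (p - 1) / 2 and
   small s.  Hardy's inequality and |x| > r0 give (((N - 2) / 2)^2 + r0^2) H < E, so the
   assumption on p yields 2 N H < (p - 2) E, and after choosing t with v in the Nehari set
   the energy of v is strictly smaller than that of u. *)

From HB Require Import structures.
Require Import Defs.
From mathcomp Require Import all_boot all_order all_algebra.
From mathcomp Require Import ring lra.
From mathcomp Require Import all_classical all_reals all_analysis.
From mathcomp Require Import measurable_realfun.
Set Implicit Arguments.
Unset Strict Implicit.
Unset Printing Implicit Defensive.
Import Order.TTheory GRing.Theory Num.Theory.
Import numFieldNormedType.Exports.
Local Open Scope classical_set_scope.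
Local Open Scope ring_scope.

(** * Lebesgue measure on row vectors *)

(** Where the threshold comes from: on the Nehari set the energy is (1/2 - 1/p) times the squared
    norm, and t^(p-2) is the ratio of squared norm to nonlinear term. To order s^2 the energy drops
    when (p/2) (1 + 2 N H / E) < p (p - 1) / 2, that is when 2 N H < (p - 2) E. Here 2 N = k (k + N
    - 2) at k = 2 is the eigenvalue of the spherical Laplacian. Degree 1 would have a smaller
    eigenvalue, but no nonzero linear form divided by |x| is a function of theta alone. No spherical
    coordinates are used: averages over directions come from invariance under plane rotations,
    applied to the squared direction cosines x_i^2 / |x|^2, and rotations preserve the iterated
    product measure because they are products of shears. The weak gradient is a choice among
    functions equal almost everywhere, so the invariance of |grad u| rests on uniqueness of weak
    derivatives and holds almost everywhere only. Since phi is singular at the origin and has no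
    compact support, multiplication by it is controlled through the notion [multiplier]. *)

Section lebesgue_rV_invariance.
Context {R : realType}.

Lemma rV_eq (T : Type) n (x y : 'rV[T]_n) :
  (forall i, x ord0 i = y ord0 i) -> x = y.
Proof. by move=> h; apply/rowP => i; exact: h. Qed.

Lemma measurable_fun_rV d (T : measurableType d) n (D : set T) (f : T -> 'rV[R]_n) :
  measurable D ->
  (forall i, measurable_fun D (fun x => f x ord0 i)) -> measurable_fun D f.
Proof.
move=> mD mf.
suff h : g_sigma_preimage (fun (i : 'I_n) (x : 'rV[R]_n) => x ord0 i)
    `<=` [set B | measurable (D `&` f @^-1` B)].
  by move=> _ B mB; exact: h.
apply: smallest_sub.
  split => /=.
  - by rewrite preimage_set0 setI0.
  - move=> B mB; rewrite setTD preimage_setC.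
    rewrite (_ : D `&` _ = D `\` (D `&` f @^-1` B)); first exact: measurableD.
    by rewrite setDE setCI setIUr setICr set0U.
  - move=> F mF; rewrite preimage_bigcup setI_bigcupr; exact: bigcup_measurable.
rewrite -bigcup_seq => B [i _] [C mC <-] /=; rewrite setTI -comp_preimage.
exact: mf.
Qed.

Lemma measurable_rV_coord n (D : set 'rV[R]_n) (i : 'I_n) :
  measurable_fun D (fun x : 'rV[R]_n => x ord0 i).
Proof. exact: measurable_funS (measurable_coord i). Qed.

Lemma lebesgue_rV_box_fin n (k : R) :
  (lebesgue_rV n [set x : 'rV[R]_n | forall i, `[(- k)%R, k]%classic (x ord0 i)]
    < +oo)%E.
Proof.
rewrite (lebesgue_rV_box (B := fun=> `[- k, k]%classic))//.
suff : (0 <= \prod_(i < n) (@lebesgue_measure R `[(- k)%R, k]%classic) < +oo)%E by move=> /andP[].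
elim/big_ind: _ => //[|x y /andP[x0 xy] /andP[y0 yy]|i _].
- by rewrite lee01 ltry.
- by rewrite mule_ge0//= lte_mul_pinfty// ge0_fin_numE.
- rewrite measure_ge0/= lebesgue_measure_itv/=; case: ifP => // _.
  by rewrite -EFinB ltry.
Qed.

Lemma measurable_rV_box n (B : 'I_n -> set R) : (forall i, measurable (B i)) ->
  measurable [set x : 'rV[R]_n | forall i, B i (x ord0 i)].
Proof.
move=> mB.
rewrite (_ : [set x | _] = \bigcap_i
    ((fun x : 'rV[R]_n => x ord0 i) @^-1` B i)).
  apply: fin_bigcap_measurable; first exact: finite_finset.
  by move=> i _; rewrite -[X in measurable X]setTI; exact: measurable_coord.
by apply/seteqP; split => x /= h; [move=> i _|move=> i]; exact: h.
Qed.

(** Needed to exchange the order of integration in [mpreserving_skew2]; the cubes of half-side k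
    exhaust the space. *)
Lemma lebesgue_rV_sigma_finite n : sigma_finite [set: 'rV[R]_n] (lebesgue_rV n).
Proof.
exists (fun k => [set x : 'rV[R]_n | forall i, `[- k%:R, k%:R]%classic (x ord0 i)]).
  apply/esym; rewrite -subTset => x _.
  have [k hk] : exists k : nat, forall i, `|x ord0 i| <= k%:R.
    exists (Num.truncn (\sum_i `|x ord0 i|)).+1 => i.
    apply: le_trans (ltW (truncnS_gt _)).
    rewrite (bigD1 i)//= lerDl; exact: sumr_ge0.
  exists k => // i /=; rewrite in_itv/= -ler_norml; exact: hk.
move=> k; split; last exact: lebesgue_rV_box_fin.
exact: (measurable_rV_box (B := fun=> `[- k%:R, k%:R]%classic)).
Qed.

(* An alias, so that the sigma-finite structure has a constant to be attached to. *)
Definition lebesgue_rVf n : set 'rV[R]_n -> \bar R := lebesgue_rV n.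

HB.instance Definition _ n := isMeasure.Build _ _ _ (@lebesgue_rVf n)
  (measure0 (lebesgue_rV n)) (measure_ge0 (lebesgue_rV n))
  (@measure_semi_sigma_additive _ _ _ (lebesgue_rV n)).
HB.instance Definition _ n := Measure_isSigmaFinite.Build _ _ _ (@lebesgue_rVf n)
  (@lebesgue_rV_sigma_finite n).

Definition mpreserving d (T : measurableType d) (m : set T -> \bar R)
    (f : T -> T) :=
  measurable_fun setT f /\ forall B, measurable B -> m (f @^-1` B) = m B.

Lemma mpreserving_comp d (T : measurableType d) (m : set T -> \bar R) f g :
  mpreserving m f -> mpreserving m g -> mpreserving m (f \o g).
Proof.
move=> [mf hf] [mg hg]; split; first exact: measurableT_comp.
move=> B mB; rewrite comp_preimage hg ?hf//.
by rewrite -[X in measurable X]setTI; exact: mf.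
Qed.

Lemma mpreserving_eq d (T : measurableType d) (m : set T -> \bar R) f g :
  f =1 g -> mpreserving m f -> mpreserving m g.
Proof. by move=> /funext ->. Qed.

Lemma ge0_integral_mpreserving d (T : measurableType d)
    (m : {measure set T -> \bar R}) f D (F : T -> \bar R) :
  mpreserving m f -> measurable D -> measurable_fun D F ->
  (forall x, D x -> (0 <= F x)%E) ->
  (\int[m]_(x in f @^-1` D) F (f x) = \int[m]_(x in D) F x)%E.
Proof.
move=> [mf hf] mD mF F0.
rewrite -(ge0_integral_pushforward mf m mD mF)//; last first.
  by move=> y /set_mem; exact: F0.
by apply: eq_measure_integral => //= B mB BD; rewrite /pushforward hf.
Qed.

(** Tonelli with the first variable fixed: the slice over x of the preimage of [B] is the
    [g x]-preimage of the slice of [B] over [f x], so slice lengths agree after the change of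
    variable [f]. *)
Lemma mpreserving_skew1 d (T : measurableType d) (m1 : {measure set T -> \bar R})
    (f : T -> T) (g : T -> R -> R) (h : T * measurableTypeR R -> T * measurableTypeR R) :
  (forall z, h z = (f z.1, g z.1 z.2)) -> measurable_fun setT h ->
  mpreserving m1 f ->
  (forall v, mpreserving (@lebesgue_measure R) (g v)) ->
  mpreserving (m1 \x @lebesgue_measure R)%E h.
Proof.
move=> hE mh mpf mpg; split=> // B mB.
rewrite /product_measure1/=.
have xs x : xsection (h @^-1` B) x = g x @^-1` xsection B (f x).
  by apply/seteqP; split => t /=; rewrite /xsection/= !inE/= hE.
under eq_integral.
  move=> x _; rewrite xs (mpg x).2; last exact: measurable_xsection.
  over.
have := @ge0_integral_mpreserving _ T m1 f setT
  (fun x => @lebesgue_measure R (xsection B x)) mpf measurableT.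
rewrite preimage_setT; apply => //.
exact: measurable_fun_xsection.
Qed.

(** The mirror case: the map on the first factor depends on the second variable, so the slices are
    taken at fixed second variable, which calls for the other iterated integral. *)
Lemma mpreserving_skew2 d (T : measurableType d)
    (m1 : {sigma_finite_measure set T -> \bar R}) (f : R -> T -> T)
    (h : T * measurableTypeR R -> T * measurableTypeR R) :
  (forall z, h z = (f z.2 z.1, z.2)) -> measurable_fun setT h ->
  (forall t, mpreserving m1 (f t)) ->
  mpreserving (m1 \x @lebesgue_measure R)%E h.
Proof.
move=> hE mh mpf; split=> // B mB.
have mB' : measurable (h @^-1` B).
  by rewrite -[X in measurable X]setTI; exact: mh.
(* Both orders of integration agree on rectangles, hence coincide by uniqueness of the product
   measure. *)
have E (C : set (T * measurableTypeR R)) : measurable C ->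
    (m1 \x @lebesgue_measure R)%E C = (m1 \x^ @lebesgue_measure R)%E C.
  move=> mC; apply: product_measure_unique => // A1 A2 m1' m2'.
  exact: product_measure2E.
rewrite !E//= /product_measure2/=.
apply: eq_integral => t _ /=.
rewrite -[RHS](mpf t).2; last exact: measurable_ysection.
by apply: congr1; apply/seteqP; split => x /=; rewrite /ysection/= !inE/= hE.
Qed.

(** * Invariance of Lebesgue measure under translations, shears and rotations *)

Lemma lebesgue_measure_shift (c : R) :
  mpreserving (@lebesgue_measure R) (fun t => t + c).
Proof.
have mf : measurable_fun setT (fun t : measurableTypeR R => t + c : measurableTypeR R).
  exact: measurable_funD.
split => // B mB; apply/esym.
rewrite -[RHS]/(pushforward (@lebesgue_measure R)
  (fun t : measurableTypeR R => t + c : measurableTypeR R) B).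
apply: lebesgue_measure_unique => //= _ [[a b]] _ <-.
rewrite /pushforward.
have -> : (fun t : measurableTypeR R => t + c : measurableTypeR R) @^-1` [set` `]a, b]] =
      `](a - c), (b - c)]%classic.
  by apply/seteqP; split => t /=; rewrite !in_itv/= ltrBlDr lerBrDr.
by rewrite !lebesgue_measure_itv/= !lte_fin ltrD2r -!EFinB opprB addrA subrK.
Qed.

Definition rVuncons n (x : 'rV[R]_n.+1) : 'rV[R]_n * measurableTypeR R :=
  (\row_i x ord0 (lift ord0 i), x ord0 ord0).

Lemma rVconsK n : cancel (@rVcons R n) (@rVuncons n).
Proof.
move=> [v t]; rewrite /rVuncons rVcons_ord0; congr pair.
by apply: rV_eq => i; rewrite mxE rVcons_lift.
Qed.

Lemma rVunconsK n : cancel (@rVuncons n) (@rVcons R n).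
Proof.
move=> x; apply: rV_eq => i; case: (unliftP ord0 i) => [j|] ->.
  by rewrite rVcons_lift mxE.
by rewrite rVcons_ord0.
Qed.

Lemma measurable_rVuncons n : measurable_fun setT (@rVuncons n).
Proof.
apply/measurable_fun_pairP; split; last exact: measurable_rV_coord.
apply: measurable_fun_rV => // i.
rewrite (_ : (fun _ => _) = (fun x : 'rV[R]_n.+1 => x ord0 (lift ord0 i))).
  exact: measurable_rV_coord.
by apply/funext => x /=; rewrite mxE.
Qed.

Lemma mpreserving_rVcons n (f : 'rV[R]_n.+1 -> 'rV[R]_n.+1) :
  measurable_fun setT f ->
  mpreserving (lebesgue_rV n \x @lebesgue_measure R)%E
    (@rVuncons n \o f \o @rVcons R n) ->
  mpreserving (lebesgue_rV n.+1) f.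
Proof.
move=> mf [_ hf]; split => // B mB.
rewrite /= /lebesgue_rVS /pushforward -[RHS]hf; last first.
  by rewrite -[X in measurable X]setTI; exact: measurable_rVcons.
by apply: congr1; apply/seteqP; split => z /=; rewrite rVunconsK.
Qed.

Lemma measurable_rVuncons_comp n (f : 'rV[R]_n.+1 -> 'rV[R]_n.+1) :
  measurable_fun setT f -> measurable_fun setT (@rVuncons n \o f \o @rVcons R n).
Proof.
move=> mf; apply: measurableT_comp; last exact: measurable_rVcons.
by apply: measurableT_comp => //; exact: measurable_rVuncons.
Qed.

(** Triangular maps in which the last n coordinates move among themselves and the first one moves
    with them as parameters; [mpreserving_rVcons2] is the opposite triangular shape. Every shear has
    one of the two shapes. *)
Lemma mpreserving_rVcons1 n (f : 'rV[R]_n.+1 -> 'rV[R]_n.+1)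
    (f' : 'rV[R]_n -> 'rV[R]_n) (g : 'rV[R]_n -> R -> R) :
  measurable_fun setT f ->
  (forall x i, f x ord0 (lift ord0 i) = f' (rVuncons x).1 ord0 i) ->
  (forall x, f x ord0 ord0 = g (rVuncons x).1 (x ord0 ord0)) ->
  mpreserving (lebesgue_rV n) f' ->
  (forall v, mpreserving (@lebesgue_measure R) (g v)) ->
  mpreserving (lebesgue_rV n.+1) f.
Proof.
move=> mf hl h0 mf' mg; apply: mpreserving_rVcons => //.
apply: (mpreserving_skew1 (f := f') (g := g)) => //; last first.
  exact: measurable_rVuncons_comp.
move=> [v t] /=; rewrite -[RHS]rVconsK; congr rVuncons.
apply: rV_eq => i; case: (unliftP ord0 i) => [j|] ->.
  by rewrite hl rVconsK !mxE !liftK.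
by rewrite h0 rVconsK !mxE !unlift_none.
Qed.

Lemma mpreserving_rVcons2 n (f : 'rV[R]_n.+1 -> 'rV[R]_n.+1)
    (f' : R -> 'rV[R]_n -> 'rV[R]_n) :
  measurable_fun setT f ->
  (forall x i, f x ord0 (lift ord0 i) = f' (x ord0 ord0) (rVuncons x).1 ord0 i) ->
  (forall x, f x ord0 ord0 = x ord0 ord0) ->
  (forall t, mpreserving (lebesgue_rV n) (f' t)) ->
  mpreserving (lebesgue_rV n.+1) f.
Proof.
move=> mf hl h0 mf'; apply: mpreserving_rVcons => //.
apply: (mpreserving_skew2 (m1 := @lebesgue_rVf n) (f := f')) => //; last first.
  exact: measurable_rVuncons_comp.
move=> [v t] /=; rewrite -[RHS]rVconsK; congr rVuncons.
apply: rV_eq => i; case: (unliftP ord0 i) => [j|] ->.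
  by rewrite hl rVconsK !mxE !liftK unlift_none.
by rewrite h0 !mxE !unlift_none.
Qed.

Lemma lebesgue_rV_shift n (y : 'rV[R]_n) :
  mpreserving (lebesgue_rV n) (fun x => x + y).
Proof.
elim: n y => [|n IH] y.
  split; first by apply: measurable_fun_rV => // -[].
  move=> B mB; apply: congr1; apply/seteqP.
  by split => x /=; rewrite (_ : x + y = x)//; apply: rV_eq => -[].
apply: (mpreserving_rVcons1 (f' := fun v => v + (rVuncons y).1)
    (g := fun _ t => t + (rVuncons y).2)) => //.
- apply: measurable_fun_rV => // i; under eq_fun do rewrite mxE.
  by apply: measurable_funD => //; exact: measurable_rV_coord.
- by move=> x i; rewrite !mxE.
- by move=> x; rewrite !mxE.
- by move=> _; exact: lebesgue_measure_shift.
Qed.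

(** Elementary transvections: they preserve volume by slicing alone, and rotations are products of
    them. *)
Definition rV_shear n (i j : 'I_n) (c : R) (x : 'rV[R]_n) : 'rV[R]_n :=
  x + (c * x ord0 j) *: delta_mx ord0 i.

Lemma rV_shearE n (i j : 'I_n) c x k :
  rV_shear i j c x ord0 k = x ord0 k + (if k == i then c * x ord0 j else 0).
Proof. by rewrite !mxE eqxx/=; case: eqP => _; rewrite ?mulr1 ?mulr0. Qed.

Lemma measurable_rV_shear n (i j : 'I_n) c : measurable_fun setT (rV_shear i j c).
Proof.
apply: measurable_fun_rV => // k; under eq_fun do rewrite rV_shearE.
apply: measurable_funD; first exact: measurable_rV_coord.
case: (k == i) => //; apply: measurable_funM => //; exact: measurable_rV_coord.
Qed.

Lemma lebesgue_rV_shear n (i j : 'I_n) c : i != j ->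
  mpreserving (lebesgue_rV n) (rV_shear i j c).
Proof.
elim: n i j => [|n IH] i j; first by case: i.
move=> ij; have mf := measurable_rV_shear i j c.
case: (unliftP ord0 i) => [i'|] ei; case: (unliftP ord0 j) => [j'|] ej; subst.
- apply: (mpreserving_rVcons1 (f' := rV_shear i' j' c) (g := fun _ t => t)) => //.
  + by move=> x k; rewrite !rV_shearE !mxE (inj_eq (@lift_inj _ ord0)).
  + by move=> x; rewrite rV_shearE addr0.
  + by apply: IH; rewrite (inj_eq (@lift_inj _ ord0)) in ij.
(* The source is the first coordinate: once it is frozen at t, the remaining coordinates undergo a
   translation. *)
- apply: (mpreserving_rVcons2
    (f' := fun t v => v + t *: (c *: delta_mx ord0 i'))) => //.
  + move=> x k; rewrite rV_shearE !mxE eqxx/= (inj_eq (@lift_inj _ ord0)).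
    by case: eqP; rewrite ?mulr1 ?mulr0// mulrC.
  + by move=> x; rewrite rV_shearE addr0.
  + by move=> t; exact: lebesgue_rV_shift.
- apply: (mpreserving_rVcons1 (f' := id) (g := fun v t => t + c * v ord0 j')) => //.
  + by move=> x k; rewrite rV_shearE addr0 mxE.
  + by move=> x; rewrite rV_shearE mxE.
  + by move=> v; exact: lebesgue_measure_shift.
- by rewrite eqxx in ij.
Qed.

Definition rV_rot n (i j : 'I_n) (c s : R) (x : 'rV[R]_n) : 'rV[R]_n :=
  \row_k (if k == i then c * x ord0 i - s * x ord0 j
          else if k == j then s * x ord0 i + c * x ord0 j else x ord0 k).

(* A rotation of angle different from 0 and pi is a product of three shears. *)
Lemma lebesgue_rV_rot n (i j : 'I_n) c s : i != j -> s != 0 -> c ^+ 2 + s ^+ 2 = 1 ->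
  mpreserving (lebesgue_rV n) (rV_rot i j c s).
Proof.
(* For a rotation of angle w this is t = - tan (w / 2); the outer two shears have coefficient t and
   the middle one sin w. *)
move=> ij s0 cs; pose t := (c - 1) / s.
apply: (@mpreserving_eq _ _ _
  (rV_shear i j t \o rV_shear j i s \o rV_shear i j t)); last first.
  apply: mpreserving_comp; last exact: lebesgue_rV_shear.
  apply: mpreserving_comp; first exact: lebesgue_rV_shear.
  by apply: lebesgue_rV_shear; rewrite eq_sym.
have e0 : s * t = c - 1 by rewrite /t mulrC divfK.
have e1 : 1 + s * t = c by rewrite e0; ring.
have e2 : t * (1 + c) = - s.
  apply: (mulfI s0); rewrite mulrA e0; apply/eqP; rewrite -subr_eq0; apply/eqP.
  by transitivity (c ^+ 2 + s ^+ 2 - 1); [ring | rewrite cs subrr].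
move=> x; apply: rV_eq => k; rewrite [RHS]mxE /= !rV_shearE.
have ji : (j == i) = false by apply/negbTE; rewrite eq_sym.
rewrite !eqxx ji !addr0.
have [->|ki] := eqVneq k i.
  rewrite (negbTE ij) addr0.
  transitivity ((1 + s * t) * x ord0 i + (t * (1 + (1 + s * t))) * x ord0 j); first by ring.
  by rewrite e1 e2; ring.
rewrite !addr0; case: eqVneq => [->|_]; last by rewrite addr0.
transitivity (s * x ord0 i + (1 + s * t) * x ord0 j); first by ring.
by rewrite e1.
Qed.

Lemma rV_rotK n (i j : 'I_n) c s : i != j -> c ^+ 2 + s ^+ 2 = 1 ->
  cancel (rV_rot i j c s) (rV_rot i j c (- s)).
Proof.
move=> ij cs x; apply: rV_eq => k; rewrite !mxE eqxx (eq_sym j) (negbTE ij) eqxx.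
have [->|ki] := eqVneq k i; last have [->|//] := eqVneq k j.
  by transitivity ((c ^+ 2 + s ^+ 2) * x ord0 i); [ring | rewrite cs mul1r].
by transitivity ((c ^+ 2 + s ^+ 2) * x ord0 j); [ring | rewrite cs mul1r].
Qed.

Lemma enorm_rV_rot n (i j : 'I_n) c s x : i != j -> c ^+ 2 + s ^+ 2 = 1 ->
  enorm (rV_rot i j c s x) = enorm x.
Proof.
move=> ij cs; rewrite /enorm; congr Num.sqrt.
rewrite (bigD1 i)// (bigD1 j) 1?eq_sym//= [RHS](bigD1 i)// [in RHS](bigD1 j) 1?eq_sym//=.
rewrite !addrA; congr (_ + _); last first.
  by apply: eq_bigr => k /andP[ki kj]; rewrite mxE (negbTE ki) (negbTE kj).
rewrite !mxE eqxx (eq_sym j) (negbTE ij) eqxx.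
transitivity ((c ^+ 2 + s ^+ 2) * (x ord0 i ^+ 2 + x ord0 j ^+ 2)); first by ring.
by rewrite cs mul1r.
Qed.

(** * Boxes and Borel measurability *)

Definition obox n (a b : 'I_n -> R) : set 'rV[R]_n :=
  [set x | forall i, `]a i, b i[%classic (x ord0 i)].

Definition cbox n (a b : 'I_n -> R) : set 'rV[R]_n :=
  [set x | forall i, `[a i, b i]%classic (x ord0 i)].

Lemma measurable_obox n (a b : 'I_n -> R) : measurable (obox a b).
Proof. exact: (measurable_rV_box (B := fun i => `]a i, b i[%classic)). Qed.

Lemma measurable_cbox n (a b : 'I_n -> R) : measurable (cbox a b).
Proof. exact: (measurable_rV_box (B := fun i => `[a i, b i]%classic)). Qed.

Definition rat_lo n (q : 'rV[rat]_n * nat) i : R := ratr (q.1 ord0 i) - q.2.+1%:R^-1.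
Definition rat_hi n (q : 'rV[rat]_n * nat) i : R := ratr (q.1 ord0 i) + q.2.+1%:R^-1.

(** Balls of the sup norm are cubes, so rational centres and radii 1 / (k + 1) suffice. Having the
    closed box inside [U] matters in [flcv], where bump functions on the box must be test
    functions. *)
Lemma open_rV_rat_box n (U : set 'rV[R]_n) x : open U -> U x ->
  exists q, obox (rat_lo q) (rat_hi q) x /\ cbox (rat_lo q) (rat_hi q) `<=` U.
Proof.
move=> oU Ux.
have /nbhs_ballP[e /= e0 eU] : nbhs x U by exact: open_nbhs_nbhs.
have [k ke] : exists k : nat, (k.+1%:R^-1 : R) < e / 2.
  exists (Num.truncn (e / 2)^-1).
  rewrite invf_plt ?posrE ?divr_gt0//; exact: truncnS_gt.
have k0 : (0 : R) < k.+1%:R^-1 by rewrite invr_gt0.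
have hq i : exists q : rat, ratr q \in `](x ord0 i - k.+1%:R^-1), (x ord0 i + k.+1%:R^-1)[.
  by apply: rat_in_itvoo; rewrite ltrBlDr -addrA ltrDl addr_gt0.
pose q := \row_i xchoose (hq i).
have hqi i : `|x ord0 i - ratr (q ord0 i)| < k.+1%:R^-1.
  rewrite mxE; have := xchooseP (hq i).
  by rewrite in_itv/= -ltr_distl distrC.
exists (q, k); split.
  by move=> i /=; rewrite in_itv/= -ltr_distl.
move=> y /= By; apply: eU; rewrite /ball/=; split => // i j.
rewrite (ord1 i).
have h2 : `|ratr (q ord0 j) - y ord0 j| <= k.+1%:R^-1.
  by rewrite distrC ler_distl; have := By j; rewrite /= in_itv.
rewrite /ball/= -(subrKA (ratr (q ord0 j))).
apply: le_lt_trans (ler_normD _ _) _; rewrite [e]splitr.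
by apply: ltrD; [exact: lt_trans ke | exact: le_lt_trans ke].
Qed.

Lemma open_measurable_rV n (U : set 'rV[R]_n) : open U -> measurable U.
Proof.
move=> oU; pose B q := obox (@rat_lo n q) (rat_hi q).
have -> : U = \bigcup_q [set x | B q x /\ B q `<=` U].
  apply/seteqP; split => [x Ux|x [q _ [Bqx]]]; last exact.
  have [q [Bx qU]] := open_rV_rat_box oU Ux; exists q => //; split => // y By.
  by apply: qU => i; have := By i; rewrite /= !in_itv/= => /andP[h1 h2]; rewrite !ltW.
apply: countable_bigcupT_measurable => [|q]; first exact: countableP.
have [BU|BU] := pselect (B q `<=` U).
  rewrite (_ : [set _ | _] = B q); last by apply/seteqP; split => // x [].
  exact: measurable_obox.
by rewrite (_ : [set _ | _] = set0)//; apply/seteqP; split => // x [].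
Qed.

Lemma continuous_measurable_rV n (f : 'rV[R]_n -> R) (D : set 'rV[R]_n) :
  measurable D -> continuous f -> measurable_fun D f.
Proof.
move=> mD cf; apply: (measurable_funS measurableT) => //.
apply: (measurability _ (RGenOpens.measurableE R)).
move=> _ [_ [a [b ->]] <-]; rewrite setTI; apply: open_measurable_rV.
by apply: open_comp => // x _; exact: cf.
Qed.

End lebesgue_rV_invariance.

(** * Smooth functions *)

Section smooth_calculus.
Context {R : realType}.

Lemma is_deriveE (V : normedModType R) (f : V -> R) a v d :
  is_derive a v f d <->
  (fun h : R => h^-1 * (f (h *: v + a) - f a)) @ 0^' --> d.
Proof.
split=> [[df <-]|h]; first exact: df.
by split; [apply/cvg_ex; exists d | exact: cvg_lim].
Qed.

Lemma is_derive_line (V : normedModType R) (f : V -> R) x v t d :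
  is_derive (x + t *: v) v f d ->
  is_derive t (1 : R) (fun s => f (x + s *: v)) d.
Proof.
move=> /is_deriveE h; apply/is_deriveE; move: h; apply: cvg_trans.
apply: near_eq_cvg; near=> h; congr (_ * (f _ - _)).
by rewrite scalerDl -scalerA scale1r addrCA.
Unshelve. all: by end_near. Qed.

(** Bounding the intermediate point only by [|t| <= |s|] treats both signs of s at once and is
    enough for passing to limits. *)
Lemma mvt_line (V : normedModType R) (f df : V -> R) v x s :
  (forall y, is_derive y v f (df y)) ->
  exists2 t, `|t| <= `|s| & f (x + s *: v) - f x = s * df (x + t *: v).
Proof.
move=> fd; pose g t := f (x + t *: v).
have gd (t : R) : is_derive t 1 g (df (x + t *: v)) by exact: is_derive_line.
have cg (a b : R) : {within `[a, b], continuous g}.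
  apply: derivable_within_continuous => t _; exact: (@ex_derive _ _ _ _ _ _ _ (gd t)).
have g0 : g 0 = f x by rewrite /g scale0r addr0.
have [s0|s0] := leP 0 s.
  have [t] := MVT_segment s0 (fun t _ => gd t) (cg _ _).
  rewrite in_itv/= => /andP[t0 ts] e; exists t; first by rewrite !ger0_norm.
  by rewrite -/(g s) -g0 e subr0 mulrC.
have [t] := MVT_segment (ltW s0) (fun t _ => gd t) (cg _ _).
rewrite in_itv/= => /andP[t0 ts] e; exists t.
  by rewrite !ler0_norm ?lerN2 // ltW.
by rewrite -/(g s) -g0 -[LHS]opprB e sub0r mulrN opprK mulrC.
Qed.

Section of_class.
Context {n : nat}.
Local Notation e_ i := (delta_mx ord0 i : 'rV[R]_n).
Implicit Types (u v f : 'rV[R]_n -> R).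

Lemma of_class_continuous k u : of_class_C k u -> continuous u.
Proof. by case: k => [//|k] []. Qed.

Lemma of_class_is_derive k u i x : of_class_C k.+1 u ->
  is_derive x (e_ i) u (pderiv i u x).
Proof. by move=> [_ /(_ i)[/(_ x) du _]]; split. Qed.

Lemma of_class_pderiv k u i : of_class_C k.+1 u -> of_class_C k (pderiv i u).
Proof. by move=> [_ /(_ i)[]]. Qed.

Lemma of_classW k u : of_class_C k.+1 u -> of_class_C k u.
Proof.
elim: k u => [|k IH] u [cu hu]//=; split => // i; split; first exact: (hu i).1.
by apply: IH; exact: (hu i).2.
Qed.

(** Lets regularity be proved from explicit candidates [d] for the partial derivatives. *)
Lemma of_classS k u (d : 'I_n -> 'rV[R]_n -> R) :
  (forall i x, is_derive x (e_ i) u (d i x)) -> continuous u ->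
  (forall i, of_class_C k (d i)) -> of_class_C k.+1 u.
Proof.
move=> hd cu hk; split => // i; split; first by move=> x; case: (hd i x).
suff -> : pderiv i u = d i by [].
by apply/funext => x; case: (hd i x).
Qed.

Lemma is_derive_mul u v x w (du dv : R) :
  is_derive x w u du -> is_derive x w v dv ->
  is_derive x w (fun y => u y * v y) (u x * dv + v x * du).
Proof. by move=> hu hv; exact: (is_deriveM hu hv). Qed.

Lemma is_derive_add u v x w (du dv : R) :
  is_derive x w u du -> is_derive x w v dv ->
  is_derive x w (fun y => u y + v y) (du + dv).
Proof. by move=> hu hv; exact: (is_deriveD hu hv). Qed.

Lemma of_class_cst k c : of_class_C k (fun _ : 'rV[R]_n => c).
Proof.
elim: k c => [|k IH] c; first by move=> x; exact: cst_continuous.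
apply: (of_classS (d := fun _ _ => 0)) => //; last by move=> x; exact: cst_continuous.
Qed.

Lemma of_classD k u v : of_class_C k u -> of_class_C k v ->
  of_class_C k (fun x => u x + v x).
Proof.
elim: k u v => [|k IH] u v hu hv.
  by move=> x; apply: continuousD; [exact: hu | exact: hv].
apply: (of_classS (d := fun i x => pderiv i u x + pderiv i v x)).
- move=> i x; apply: is_derive_add; apply: of_class_is_derive; eassumption.
- by move=> x; apply: continuousD; [exact: hu.1 | exact: hv.1].
- by move=> i; apply: IH; apply: of_class_pderiv; eassumption.
Qed.

Lemma of_classM k u v : of_class_C k u -> of_class_C k v ->
  of_class_C k (fun x => u x * v x).
Proof.
elim: k u v => [|k IH] u v hu hv.
  by move=> x; apply: continuousM; [exact: hu | exact: hv].
apply: (of_classS (d := fun i x => u x * pderiv i v x + v x * pderiv i u x)).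
- move=> i x; apply: is_derive_mul; apply: of_class_is_derive; eassumption.
- by move=> x; apply: continuousM; [exact: hu.1 | exact: hv.1].
- move=> i; apply: of_classD; apply: IH; (try exact: of_class_pderiv);
    exact: of_classW.
Qed.

Lemma of_class_sum k (I : Type) (s : seq I) (F : I -> 'rV[R]_n -> R) :
  (forall i, of_class_C k (F i)) -> of_class_C k (fun x => \sum_(i <- s) F i x).
Proof.
move=> hF; elim: s => [|i s IH].
  by under eq_fun do rewrite big_nil; exact: of_class_cst.
by under eq_fun do rewrite big_cons; exact: of_classD.
Qed.

Lemma of_class_prod k (I : Type) (s : seq I) (F : I -> 'rV[R]_n -> R) :
  (forall i, of_class_C k (F i)) -> of_class_C k (fun x => \prod_(i <- s) F i x).
Proof.
move=> hF; elim: s => [|i s IH].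
  by under eq_fun do rewrite big_nil; exact: of_class_cst.
by under eq_fun do rewrite big_cons; exact: of_classM.
Qed.

Lemma is_derive_coord i j (F : R -> R) d (x : 'rV[R]_n) :
  is_derive (x ord0 i) (1 : R) F d ->
  is_derive x (e_ j) (fun y => F (y ord0 i)) ((i == j)%:R * d).
Proof.
move=> /is_deriveE h; apply/is_deriveE; have [ij|ij] := eqVneq i j.
  rewrite mul1r; apply: (cvg_trans _ h); apply: near_eq_cvg.
  by near=> z; rewrite !mxE ij !eqxx.
rewrite mul0r.
have : (fun _ : R => 0 : R) @ 0^' --> (0 : R) by exact: cvg_cst.
apply: cvg_trans; apply: near_eq_cvg; near=> z.
by rewrite !mxE eqxx/= (negbTE ij) mulr0 add0r subrr mulr0.
Unshelve. all: by end_near. Qed.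

Lemma continuous_coord (i : 'I_n) : continuous (fun x : 'rV[R]_n => x ord0 i).
Proof. by move=> x; exact: coord_continuous. Qed.

(** Gains one order of regularity from F' = G; it drives the inductions for sin, cos and [flat],
    each over a family closed under differentiation. *)
Lemma of_class_comp_coord k (F G : R -> R) i :
  (forall t, is_derive t (1 : R) F (G t)) ->
  of_class_C k (fun x : 'rV[R]_n => G (x ord0 i)) ->
  of_class_C k.+1 (fun x : 'rV[R]_n => F (x ord0 i)).
Proof.
move=> FG hG; apply: (of_classS (d := fun j x => (i == j)%:R * G (x ord0 i))).
- by move=> j x; exact: is_derive_coord.
- move=> x; apply: continuous_comp; first exact: continuous_coord.
  apply/differentiable_continuous/derivable1_diffP.
  by case: (FG (x ord0 i)).
- by move=> j; apply: of_classM => //; exact: of_class_cst.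
Qed.

Lemma of_class_coord k i : of_class_C k (fun x : 'rV[R]_n => x ord0 i).
Proof.
case: k => [|k]; first exact: continuous_coord.
apply: (@of_class_comp_coord _ id (fun=> 1)); exact: of_class_cst.
Qed.

(** Coordinates are added to the direction one at a time. Each new increment is evaluated by the
    mean value theorem, and continuity of the partial derivative absorbs the displacement already
    made. *)
Lemma is_derive_C1 f x w : of_class_C 1 f ->
  is_derive x w f (\sum_i w ord0 i * pderiv i f x).
Proof.
move=> hf.
suff key s : is_derive x (\sum_(i <- s) w ord0 i *: e_ i) f
    (\sum_(i <- s) w ord0 i * pderiv i f x).
  have -> : w = \sum_i w ord0 i *: e_ i by exact: row_sum_delta.
  have -> : \sum_i (\sum_i w ord0 i *: e_ i) ord0 i * pderiv i f x =
      \sum_i w ord0 i * pderiv i f x.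
    by apply: eq_bigr => i _; rewrite -row_sum_delta.
  exact: key.
elim: s => [|i s IH]; first by rewrite !big_nil; exact: is_derive0.
rewrite !big_cons; set v := \sum_(j <- s) _ in IH *; set d := \sum_(j <- s) _ in IH *.
set c := w ord0 i; move/is_deriveE : IH => IH; apply/is_deriveE.
rewrite (_ : c * _ + d = d + c * pderiv i f x); last exact: addrC.
have key : (fun h : R => h^-1 * (f (h *: (c *: e_ i + v) + x) - f (h *: v + x)))
    @ 0^' --> c * pderiv i f x.
  have hd y : is_derive y (e_ i) f (pderiv i f y) by exact: of_class_is_derive hf.
  (* [th h] is the intermediate point of the mean value theorem; it tends to 0 because |th h| <= |h
     c|. *)
  pose th h := projT1 (cid2 (mvt_line (h *: v + x) (h * c) hd)).
  have [thle thE] : (forall h, `|th h| <= `|h * c|) /\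
      forall h, f (h *: (c *: e_ i + v) + x) - f (h *: v + x) =
                h * c * pderiv i f (h *: v + x + th h *: e_ i).
    split=> h; rewrite /th; case: cid2 => //= t _ <-; congr (f _ - _).
    by rewrite scalerDr scalerA -addrA addrC.
  have th0 : th @ 0^' --> (0 : R).
    apply/cvgrPdist_le => e e0.
    have c1 : 0 < `|c| + 1 by rewrite ltr_wpDl.
    near=> h; rewrite sub0r normrN (le_trans (thle h))// normrM.
    apply: (@le_trans _ _ (`|h| * (`|c| + 1))); first by rewrite ler_wpM2l// lerDl.
    rewrite -ler_pdivlMr//; near: h; apply: dnbhs0_le; exact: divr_gt0.
  have cid : (id : R -> R) @ 0^' --> (0 : R) by exact: cvg_within.
  have arg : (fun h : R => h *: v + x + th h *: e_ i) @ 0^' --> x.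
    suff : (fun h : R => h *: v + x + th h *: e_ i) @ 0^' -->
        (0 : R) *: v + x + (0 : R) *: e_ i by rewrite !scale0r add0r addr0.
    apply: cvgD; last exact: cvgZr_tmp.
    by apply: cvgD; [exact: cvgZr_tmp | exact: cvg_cst].
  have : (fun h : R => c * pderiv i f (h *: v + x + th h *: e_ i)) @ 0^' -->
      c * pderiv i f x.
    apply: cvgM; first exact: cvg_cst.
    apply: continuous_cvg => //; exact: (hf.2 i).2.
  apply: cvg_trans; apply: near_eq_cvg; near=> h.
  rewrite thE -mulrA mulKf//; near: h; exact: nbhs_dnbhs_neq.
apply: (cvg_trans _ (cvgD IH key)); apply: near_eq_cvg; near=> h.
by rewrite /= -mulrDr addrC addrA subrK.
Unshelve. all: by end_near.
Qed.

Lemma of_class_le k l u : (l <= k)%N -> of_class_C k u -> of_class_C l u.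
Proof.
move=> /subnK <-; elim: (k - l)%N => [//|j IH] /of_classW; exact: IH.
Qed.

Lemma continuous_rV (T : topologicalType) (f : T -> 'rV[R]_n) :
  (forall i, continuous (fun x => f x ord0 i)) -> continuous f.
Proof.
move=> cf x; apply/cvg_ballP => e e0.
have : \forall y \near x, forall i, ball (f x ord0 i) e (f y ord0 i).
  apply: filter_forall => i; apply: (cf i x); exact: nbhsx_ballx.
apply: filterS => y hy; split => // i j; rewrite (ord1 i); exact: hy.
Qed.

Definition rV_linear (T : 'rV[R]_n -> 'rV[R]_n) :=
  (forall (h : R) (y x : 'rV[R]_n), T (h *: y + x) = h *: T y + T x) /\ continuous T.

Lemma is_derive_comp_linear (T : 'rV[R]_n -> 'rV[R]_n) f x w (d : R) : rV_linear T ->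
  is_derive (T x) (T w) f d -> is_derive x w (f \o T) d.
Proof.
move=> [lT _] /is_deriveE h; apply/is_deriveE; apply: (cvg_trans _ h).
by apply: near_eq_cvg; near=> z; rewrite /= lT.
Unshelve. all: by end_near. Qed.

Lemma is_derive_comp_rV_linear T f i x : rV_linear T -> of_class_C 1 f ->
  is_derive x (e_ i) (f \o T) (\sum_j T (e_ i) ord0 j * pderiv j f (T x)).
Proof.
by move=> lT hf; apply: is_derive_comp_linear => //; exact: is_derive_C1.
Qed.

Lemma of_class_comp_linear k T f : rV_linear T ->
  of_class_C k f -> of_class_C k (f \o T).
Proof.
move=> lT; elim: k f => [|k IH] f hf.
  by move=> x; apply: continuous_comp; [exact: lT.2 | exact: hf].
apply: (of_classS (d := fun i x => \sum_j T (e_ i) ord0 j * pderiv j f (T x))).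
- move=> i x; apply: is_derive_comp_rV_linear => //; exact: of_class_le hf.
- by move=> x; apply: continuous_comp; [exact: lT.2 | exact: hf.1].
- move=> i; apply: of_class_sum => j; apply: of_classM; first exact: of_class_cst.
  by apply: (IH (pderiv j f)); exact: of_class_pderiv.
Qed.

Lemma smoothM u v : smooth u -> smooth v -> smooth (fun x => u x * v x).
Proof. by move=> hu hv k; exact: of_classM. Qed.

Lemma smooth_pderiv u i : smooth u -> smooth (pderiv i u).
Proof. by move=> hu k; exact/of_class_pderiv/hu. Qed.

Lemma smooth_continuous u : smooth u -> continuous u.
Proof. by move=> hu; exact: (hu 0%N). Qed.

Lemma smooth_is_derive u i x : smooth u -> is_derive x (e_ i) u (pderiv i u x).
Proof. by move=> hu; exact: of_class_is_derive (hu 1%N). Qed.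

Lemma pderivE u i x (d : R) : is_derive x (e_ i) u d -> pderiv i u x = d.
Proof. by case. Qed.

(** The induction runs over the whole span of sin and cos, which is stable under differentiation. *)
Lemma smooth_sin i : smooth (fun x : 'rV[R]_n => sin (x ord0 i)).
Proof.
suff h a b k : of_class_C k (fun x : 'rV[R]_n => a * sin (x ord0 i) + b * cos (x ord0 i)).
  by move=> k; move: (h 1 0 k); under eq_fun do rewrite mul0r addr0 mul1r.
elim: k a b => [|k IH] a b.
  apply: of_classD; apply: of_classM; try exact: of_class_cst.
    move=> x; apply: (@continuous_comp _ _ _ _ sin); first exact: continuous_coord.
    exact: continuous_sin.
  move=> x; apply: (@continuous_comp _ _ _ _ cos); first exact: continuous_coord.
  exact: continuous_cos.
apply: (@of_class_comp_coord k (fun t => a * sin t + b * cos t)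
   (fun t => (- b) * sin t + a * cos t)) => // t.
apply: is_derive_eq; rewrite /GRing.scale/=; ring.
Qed.

Lemma smooth_cos i : smooth (fun x : 'rV[R]_n => cos (x ord0 i)).
Proof.
move=> k.
suff -> : (fun x : 'rV[R]_n => cos (x ord0 i)) =
          (fun x : 'rV[R]_n => pderiv i (fun x => sin (x ord0 i)) x).
  exact/of_class_pderiv/smooth_sin.
apply/funext => x; rewrite (pderivE (is_derive_coord i (is_derive_sin (x ord0 i)))).
by rewrite eqxx mul1r.
Qed.

(* The whole family is needed because exp (-1/t) alone is not stable under
   differentiation: flat_j' = flat_(j+2) - j flat_(j+1). *)
Definition flat (j : nat) (t : R) : R := if 0 < t then t^-1 ^+ j * expR (- t^-1) else 0.

Lemma flat_ge0 j t : 0 <= flat j t.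
Proof.
rewrite /flat; case: ltP => // t0; rewrite mulr_ge0 ?expR_ge0 ?exprn_ge0//.
by rewrite invr_ge0 ltW.
Qed.

(** With y = 1 / t, the bound exp y >= y^(j+1) / (j+1)! leaves one spare factor t, which makes the
    difference quotient at 0 vanish in [is_derive_flat]. *)
Lemma flat_le j t : flat j t <= j.+1`!%:R * `|t|.
Proof.
rewrite /flat; case: ltP => t0; last by rewrite mulr_ge0.
have y0 : 0 < t^-1 by rewrite invr_gt0.
rewrite gtr0_norm// expRN ler_pdivrMr ?expR_gt0//.
have := expR_ge1Dxn j (ltW y0) => h.
have {}h : t^-1 ^+ j.+1 / j.+1`!%:R <= expR t^-1 by apply: le_trans h; rewrite lerDr.
rewrite ler_pdivrMr ?ltr0n ?fact_gt0// in h.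
have := ler_wpM2l (ltW t0) h; rewrite exprS mulrA divff ?gt_eqF// mul1r => /le_trans; apply.
by rewrite le_eqVlt; apply/orP; left; apply/eqP; ring.
Qed.

Lemma is_derive_flat j t :
  is_derive t (1 : R) (flat j) (flat j.+2 t - j%:R * flat j.+1 t).
Proof.
have [t0|t0|->] := ltgtP t 0.
- have -> : flat j.+2 t - j%:R * flat j.+1 t = 0.
    by rewrite /flat !ltNge !(ltW t0)/= mulr0 subr0.
  apply: (near_eq_is_derive (f := fun=> (0:R))).
    by near=> s; rewrite /flat ltNge ltW//; near: s; exact: lt_nbhsl.
- apply: (near_eq_is_derive (f := fun s : R => s^-1 ^+ j * expR (- s^-1))).
    by near=> s; rewrite /flat ifT//; near: s; exact: lt_nbhsr.
  rewrite /flat !t0.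
  have t1 : t != 0 by rewrite gt_eqF.
  have dV : is_derive t (1 : R) (fun s : R => s^-1) (- t ^- 2).
    have := @is_deriveV _ id t (1:R) 1 t1 (is_derive_id _ _).
    by move=> h; apply: (is_derive_eq h); rewrite /GRing.scale/= mulr1.
  have dX := is_deriveX j dV; rewrite exprfctE in dX.
  have dE : is_derive t (1 : R) (fun s : R => expR (- s^-1)) (expR (- t^-1) * t ^- 2).
    have dN := is_deriveN dV; rewrite opprK in dN.
    exact: (is_derive1_comp (is_derive_expR _) dN).
  have := is_deriveM dX dE => h; apply: (is_derive_eq h).
  rewrite /GRing.scale/= -exprVn.
  case: j {h dX} => [|j]; first by rewrite !expr0/=; ring.
  by rewrite /= !exprS; ring.
(* At 0 the difference quotient of [flat j] is [flat j.+1], itself bounded by a multiple of |h|. *)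
- have -> : flat j.+2 0 - j%:R * flat j.+1 0 = 0 by rewrite /flat ltxx mulr0 subr0.
  apply/is_deriveE.
  apply/cvgrPdist_le => e e0; near=> h.
  have h0 : h != 0 by near: h; exact: nbhs_dnbhs_neq.
  rewrite {2}/flat ltxx subr0 sub0r normrN addr0.
  have -> : h^-1 * flat j (h *: (1:R)) = flat j.+1 h.
    rewrite /GRing.scale/= mulr1 /flat; case: ifP; rewrite ?mulr0// => _.
    by rewrite exprS mulrA.
  rewrite ger0_norm ?flat_ge0//; apply: (le_trans (flat_le _ _)).
  rewrite mulrC -ler_pdivlMr ?ltr0n ?fact_gt0//; near: h; apply: dnbhs0_le.
  by rewrite divr_gt0// ltr0n fact_gt0.
Unshelve. all: by end_near.
Qed.

Lemma smooth_flat (al be : R) i :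
  smooth (fun x : 'rV[R]_n => flat 0 (al * x ord0 i + be)).
Proof.
move=> k.
suff h j : of_class_C k (fun x : 'rV[R]_n => flat j (al * x ord0 i + be)) by exact: h.
elim: k j => [|k IH] j.
  move=> x; apply: (@continuous_comp _ _ _ _ (fun t => flat j (al * t + be))).
    exact: continuous_coord.
  apply: (@continuous_comp _ _ _ (fun t => al * t + be)).
    apply: (@continuousD _ _ _ (fun t => al * t) (fun=> be)); last exact: cst_continuous.
    exact: mulrl_continuous.
  apply/differentiable_continuous/derivable1_diffP.
  by case: (is_derive_flat j (al * (x ord0 i) + be)).
apply: (@of_class_comp_coord k (fun t => flat j (al * t + be))
   (fun t => al * (flat j.+2 (al * t + be) - j%:R * flat j.+1 (al * t + be)))) => //.
  move=> t.
  have dL : is_derive t (1:R) (fun t : R => al * t + be) al.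
    have := is_deriveD (is_deriveZ al (is_derive_id t (1:R))) (is_derive_cst be t (1:R)).
    by move=> h; apply: (is_derive_eq h); rewrite addr0 /GRing.scale/= mulr1.
  have h := @is_derive1_comp _ (flat j) (fun t => al * t + be) t _ _
    (is_derive_flat j (al * t + be)) dL.
  by apply: (is_derive_eq h); rewrite mulrC.
apply: of_classM; first exact: of_class_cst.
apply: of_classD; first exact: IH.
under eq_fun do rewrite -mulNr.
by apply: of_classM; [exact: of_class_cst | exact: IH].
Qed.

End of_class.
End smooth_calculus.

(** * Test functions *)

Section test_functions.
Context {R : realType} {n : nat}.
Local Notation mu := (@lebesgue_rV R n).
Local Notation e_ i := (delta_mx ord0 i : 'rV[R]_n).

Lemma compact_cbox (a b : 'I_n -> R) : compact (cbox a b).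
Proof.
apply: (@rV_compact _ _ (fun i => `[a i, b i]%classic)) => i.
exact: segment_compact.
Qed.

Lemma compact_rV_closed (K : set 'rV[R]_n) : compact K -> closed K.
Proof. by apply: compact_closed; exact: norm_hausdorff. Qed.

Lemma closed_measurable_rV (K : set 'rV[R]_n) : closed K -> measurable K.
Proof.
by move=> /closed_openC /open_measurable_rV /measurableC; rewrite setCK.
Qed.

Lemma compact_measurable_rV (K : set 'rV[R]_n) : compact K -> measurable K.
Proof. by move=> /compact_rV_closed /closed_measurable_rV. Qed.

Lemma coord_le_norm (x : 'rV[R]_n) i : `|x ord0 i| <= `|x|.
Proof.
have /mapP[j Hj ->] : `|x ord0 i| \in [seq `|x x0.1 x0.2| | x0 : 'I_1 * 'I_n].
  by apply/mapP; exists (ord0, i) => //=; rewrite mem_enum.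
by rewrite [leRHS]/Num.Def.normr /= mx_normrE; apply/bigmax_geP; right => /=; exists j.
Qed.

Lemma compact_sub_cbox (K : set 'rV[R]_n) : compact K ->
  exists M : R, 0 <= M /\ K `<=` cbox (fun=> - M) (fun=> M).
Proof.
move=> /compact_bounded [M [Mreal hM]].
exists (`|M| + 1); split; first by rewrite addr_ge0.
move=> x Kx i /=; rewrite in_itv/= -ler_norml (le_trans (coord_le_norm _ _))//.
by apply: hM => //; rewrite (le_lt_trans (ler_norm _))// ltrDl.
Qed.

Lemma compact_lebesgue_rV_fin (K : set 'rV[R]_n) : compact K -> (mu K < +oo)%E.
Proof.
move=> cK; have [M [_ KM]] := compact_sub_cbox cK.
apply: le_lt_trans (lebesgue_rV_box_fin n M).
apply: le_measure; rewrite ?inE//; first exact: compact_measurable_rV.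
exact: (@measurable_cbox _ _ (fun=> - M) (fun=> M)).
Qed.

Lemma continuous_bounded_on (f : 'rV[R]_n -> R) (K : set 'rV[R]_n) :
  compact K -> continuous f -> [bounded f x | x in K].
Proof.
move=> cK cf.
have /compact_bounded [M [Mr hM]] : compact (f @` K).
  by apply: continuous_compact => //; exact: continuous_subspaceT.
exists M; split => // N MN x Kx; apply: hM => //; exists x => //.
Qed.

Lemma integral_mpreserving d (T : measurableType d)
    (m : {measure set T -> \bar R}) f D (F : T -> \bar R) :
  mpreserving m f -> measurable D -> measurable_fun D F ->
  (\int[m]_(x in f @^-1` D) F (f x) = \int[m]_(x in D) F x)%E.
Proof.
move=> hf mD mF; rewrite integralE [RHS]integralE.
congr (_ - _)%E.
  rewrite -(ge0_integral_mpreserving hf mD (measurable_funepos mF) (fun x _ => funepos_ge0 _ _)).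
  by apply: eq_integral => x _; rewrite !funeposE.
rewrite - (ge0_integral_mpreserving hf mD (measurable_funeneg mF) (fun x _ => funeneg_ge0 _ _)).
by apply: eq_integral => x _; rewrite !funenegE.
Qed.

Lemma integrable_mpreserving d (T : measurableType d)
    (m : {measure set T -> \bar R}) f D (F : T -> \bar R) :
  mpreserving m f -> measurable D -> m.-integrable D F ->
  m.-integrable (f @^-1` D) (F \o f).
Proof.
move=> hf mD /integrableP[mF iF]; apply/integrableP; split.
  apply: (measurable_comp mD) => //; first by move=> _ [x Dx <-].
  by apply: (measurable_funS measurableT) => //; exact: hf.1.
rewrite (ge0_integral_mpreserving hf mD (F := fun x => `|F x|%E))//.
exact: measurableT_comp.
Qed.

Section vanishing_outside.
Variables (K : set 'rV[R]_n) (f : 'rV[R]_n -> R).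
Hypothesis f0 : forall x, ~ K x -> f x = 0.

Lemma patch_vanishing D : K `<=` D -> f \_ D = f.
Proof.
move=> KD; apply/funext => x; rewrite patchE; case: ifPn => // /negP xD.
by rewrite f0// => Kx; apply: xD; rewrite inE; exact: KD.
Qed.

Lemma integral_vanishing D : K `<=` D ->
  (\int[mu]_(x in D) (f x)%:E = \int[mu]_x (f x)%:E)%E.
Proof.
move=> KD; rewrite integral_mkcond; apply: eq_integral => x _.
by rewrite -[in RHS](patch_vanishing KD) restrict_EFin.
Qed.

Lemma integrable_vanishing D E : measurable D -> measurable E ->
  K `<=` D -> K `<=` E ->
  mu.-integrable D (EFin \o f) -> mu.-integrable E (EFin \o f).
Proof.
move=> mD mE KD KE /(integrable_mkcond _ mD) h; apply/(integrable_mkcond _ mE).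
move: h; rewrite !restrict_EFin; rewrite (patch_vanishing KD).
by rewrite (patch_vanishing KE).
Qed.

Lemma integrable_continuous_compact D : compact K -> continuous f ->
  measurable D -> K `<=` D -> mu.-integrable D (EFin \o f).
Proof.
move=> cK cf mD KD; have mK := compact_measurable_rV cK.
apply: (@integrable_vanishing K) => //.
apply: measurable_bounded_integrable => //.
- exact: compact_lebesgue_rV_fin.
- exact: continuous_measurable_rV.
- exact: continuous_bounded_on.
Qed.

End vanishing_outside.

Lemma near_vanishing (K : set 'rV[R]_n) (f : 'rV[R]_n -> R) x : closed K ->
  (forall x, ~ K x -> f x = 0) -> ~ K x -> \near x, 0 = f x.
Proof.
move=> cK f0 Kx; have : nbhs x (~` K).
  by apply: open_nbhs_nbhs; split => //; exact: closed_openC.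
by apply: filterS => y Ky; rewrite f0.
Qed.

Lemma pderiv_vanishing (K : set 'rV[R]_n) (f : 'rV[R]_n -> R) i x : closed K ->
  (forall x, ~ K x -> f x = 0) -> ~ K x -> pderiv i f x = 0.
Proof.
move=> cK f0 Kx; have h := near_vanishing cK f0 Kx.
by rewrite /pderiv -(near_eq_derive _ h) derive_cst.
Qed.

Lemma test_fun_pderiv Omega (phi : 'rV[R]_n -> R) i : test_fun Omega phi ->
  test_fun Omega (pderiv i phi).
Proof.
move=> [sphi [K [cK KO phi0]]]; split; first exact: smooth_pderiv.
exists K; split => // x Kx; apply: pderiv_vanishing Kx => //.
exact: compact_rV_closed.
Qed.

(* By translation invariance the difference quotients have integral zero. *)
Lemma integral_pderiv (f : 'rV[R]_n -> R) K i : of_class_C 1 f -> compact K ->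
  (forall x, ~ K x -> f x = 0) -> (\int[mu]_x (pderiv i f x)%:E = 0)%E.
Proof.
move=> hf cK f0; have clK := compact_rV_closed cK.
have cf : continuous f := hf.1.
have hd y : is_derive y (e_ i) f (pderiv i f y) by exact: of_class_is_derive hf.
have [C [C0 hC]] : exists C : R, 0 <= C /\ forall x, `|pderiv i f x| <= C.
  have [M [Mr hM]] := continuous_bounded_on cK (hf.2 i).2.
  exists (`|M| + 1); split; first by rewrite addr_ge0.
  move=> x; have [Kx|Kx] := pselect (K x).
    by apply: hM => //; rewrite (le_lt_trans (ler_norm _))// ltrDl.
  by rewrite (pderiv_vanishing _ clK f0 Kx) normr0 addr_ge0.
have [M [M0 KM]] := compact_sub_cbox cK.
(* The steps [h k] are at most 1, so the box enlarged by 1 contains the support of f and of all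
   translates used below. *)
pose B : set 'rV[R]_n := cbox (fun=> - (M + 1)) (fun=> M + 1).
have mB : measurable B by exact: measurable_cbox.
pose h k : R := k.+1%:R^-1.
have h0 k : h k != 0 by rewrite invr_neq0.
have h1 k : `|h k| <= 1.
  by rewrite ger0_norm ?invr_ge0// invf_le1// ler1n.
pose D k x := (h k)^-1 * (f (x + h k *: e_ i) - f x).
have iF k : (\int[mu]_x (D k x)%:E = 0)%E.
  have intf : mu.-integrable setT (EFin \o f) by exact: (integrable_continuous_compact f0).
  have mpk := lebesgue_rV_shift (h k *: e_ i).
  have intfh : mu.-integrable setT (EFin \o (fun x => f (x + h k *: e_ i))).
    have := integrable_mpreserving mpk measurableT intf.
    by rewrite preimage_setT.
  rewrite /D; under eq_integral do rewrite EFinM.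
  rewrite integralZl//; last exact: (integrableB measurableT intfh intf).
  rewrite integralB_EFin//.
  have := integral_mpreserving mpk measurableT (measurable_int _ intf).
  rewrite preimage_setT => /= ->; rewrite subee ?mule0//.
  exact: integrable_fin_num intf.
have mf : measurable_fun setT f by exact: continuous_measurable_rV.
have mD k : measurable_fun setT (D k).
  apply: measurable_funM => //; apply: measurable_funB => //.
  exact: (measurableT_comp mf (lebesgue_rV_shift _).1).
(* The mean value theorem bounds every quotient by the supremum of the partial derivative, which
   provides the dominating function. *)
have DB k x : `|D k x| <= C * \1_B x.
  rewrite /D normrM normrV ?unitfE// mulrC ler_pdivrMr ?normr_gt0//.
  have [Bx|Bx] := pselect (B x).
    rewrite indicE mem_set// mulr1.
    have [t _ ->] := mvt_line x (h k) hd.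
    by rewrite normrM mulrC ler_wpM2r.
  rewrite indicE memNset// mulr0 mul0r !f0 ?subrr ?normr0//.
    move=> /KM Kx; apply: Bx => j; have := Kx j; rewrite /= !in_itv/= -!ler_norml => h2.
    by rewrite (le_trans h2)// lerDl.
  move=> /KM Kx; apply: Bx => j; have := Kx j; rewrite /= !in_itv/= -!ler_norml => h2.
  rewrite -(addrK ((h k *: e_ i) ord0 j) (x ord0 j)) (le_trans (ler_normB _ _))//.
  apply: lerD; first by rewrite mxE in h2.
  rewrite !mxE eqxx/= normrM; case: eqP => _; rewrite ?normr1 ?normr0 ?mulr1 ?mulr0//.
have iB : mu.-integrable setT (EFin \o (fun x => C * \1_B x)).
  apply: (@integrable_vanishing B _ _ B) => //.
    by move=> x Bx; rewrite indicE memNset// mulr0.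
  apply: measurable_bounded_integrable => //.
  - by apply: compact_lebesgue_rV_fin; exact: compact_cbox.
  - by apply: measurable_funM => //; exact: measurable_indic.
  - exists C; split; first exact: num_real.
    move=> N CN x Bx /=; rewrite indicE mem_set// mulr1 ger0_norm//; exact: ltW.
have cD x : (fun k => D k x) @ \oo --> pderiv i f x.
  have /is_deriveE h2 := hd x.
  have /cvgr_dnbhsP/(_ h) h3 := h2.
  have -> : (fun k => D k x) =
      (fun k => (h k)^-1 * (f (h k *: e_ i + x) - f x)).
    by apply/funext => k; rewrite /D [x + _]addrC.
  by apply: h3; split => //; exact: cvg_harmonic.
have Dcv : (fun k => \int[mu]_x (D k x)%:E)%E @ \oo --> (\int[mu]_x (pderiv i f x)%:E)%E.
  apply: (dominated_cvg (g := fun x => (C * \1_B x)%:E) measurableT) => //.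
  - by move=> k; apply/measurable_EFinP.
  - by move=> x _; apply: cvg_EFin; [exact: nearW | exact: cD].
  - by move=> k x _; rewrite /= lee_fin.
move: Dcv; rewrite (_ : (fun _ => _) = fun=> 0%E); last by apply/funext => k.
by move=> /cvg_lim <- //; rewrite lim_cst.
Unshelve. all: by end_near.
Qed.

End test_functions.

(** * Weak derivatives *)

Section weak_derivatives.
Context {R : realType} {n : nat}.
Local Notation mu := (@lebesgue_rV R n).
Local Notation e_ i := (delta_mx ord0 i : 'rV[R]_n).
Implicit Types (Omega K : set 'rV[R]_n) (u v f g phi : 'rV[R]_n -> R).

Lemma L1loc_integrable_mul Omega K u g : measurable Omega -> L1loc Omega u ->
  compact K -> K `<=` Omega -> continuous g -> (forall x, ~ K x -> g x = 0) ->
  mu.-integrable Omega (EFin \o (fun x => u x * g x)).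
Proof.
move=> mO [mu_ iu] cK KO cg g0; have mK := compact_measurable_rV cK.
apply: (@integrable_vanishing _ _ K _ _ K) => //.
  by move=> x Kx; rewrite g0// mulr0.
apply: (integrableMl mK (iu K cK KO)).
  exact: continuous_measurable_rV.
exact: continuous_bounded_on.
Qed.

Lemma L1loc_integrable_test Omega u phi : measurable Omega -> L1loc Omega u ->
  test_fun Omega phi -> mu.-integrable Omega (EFin \o (fun x => u x * phi x)).
Proof.
move=> mO lu [sphi [K [cK KO phi0]]].
apply: L1loc_integrable_mul lu cK KO _ phi0 => //; exact: smooth_continuous.
Qed.

Lemma L1loc_integrable_test_pderiv Omega u phi i : measurable Omega ->
  L1loc Omega u -> test_fun Omega phi ->
  mu.-integrable Omega (EFin \o (fun x => u x * pderiv i phi x)).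
Proof. by move=> mO lu tphi; apply: L1loc_integrable_test => //; exact: test_fun_pderiv. Qed.

Lemma integral_test_pderiv Omega phi i : test_fun Omega phi ->
  (\int[mu]_(x in Omega) (pderiv i phi x)%:E = 0)%E.
Proof.
move=> [sphi [K [cK KO phi0]]].
rewrite (@integral_vanishing _ _ K)//; first exact: (integral_pderiv _ (sphi 1%N) cK phi0).
by move=> x Kx; rewrite (pderiv_vanishing _ (compact_rV_closed cK) phi0).
Qed.

(** * Bump functions on boxes and the fundamental lemma of the calculus of variations *)

Definition bump (a b : 'I_n -> R) (k : nat) (x : 'rV[R]_n) : R :=
  \prod_i (flat 0 (k.+1%:R * (x ord0 i - a i)) * flat 0 (k.+1%:R * (b i - x ord0 i))).

Lemma flat0_le1 (t : R) : 0 <= flat 0 t <= 1.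
Proof.
rewrite flat_ge0/= /flat; case: ltP => // t0.
by rewrite expr0 mul1r -expR0 ler_expR oppr_le0 invr_ge0 ltW.
Qed.

Lemma bump_itv a b k x : 0 <= bump a b k x <= 1.
Proof.
rewrite /bump; elim/big_ind : _ => [|y z /andP[y0 y1] /andP[z0 z1]|i _].
- by rewrite ler01 lexx.
- by rewrite mulr_ge0// mulr_ile1.
- by have /andP[? ?] := flat0_le1 (k.+1%:R * (x ord0 i - a i));
    have /andP[? ?] := flat0_le1 (k.+1%:R * (b i - x ord0 i));
    rewrite mulr_ge0// mulr_ile1.
Qed.

Lemma bump_out a b k x : ~ obox a b x -> bump a b k x = 0.
Proof.
move=> h; apply/eqP; rewrite prodf_seq_eq0; apply/hasP.
have [i hi] : exists i, ~ (a i < x ord0 i < b i).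
  apply/existsNP => h2; apply: h => i /=; rewrite in_itv/=; exact: h2.
exists i; first exact: mem_index_enum.
rewrite /= mulf_eq0 /flat; apply/orP; move/negP : hi; rewrite negb_and -!leNgt.
by case/orP => h1; [left|right]; rewrite ltNge pmulr_rle0// subr_le0 h1.
Qed.

Lemma test_fun_bump a b k Omega : cbox a b `<=` Omega -> test_fun Omega (bump a b k).
Proof.
move=> abO; split.
  move=> l; apply: of_class_prod => i; apply: of_classM.
    have := @smooth_flat R n k.+1%:R (- k.+1%:R * a i) i l.
    by under eq_fun do rewrite mulNr -mulrBr.
  have := @smooth_flat R n (- k.+1%:R) (k.+1%:R * b i) i l.
  by under eq_fun do rewrite mulNr addrC -mulrBr.
exists (cbox a b); split => //; first exact: compact_cbox.
move=> x ncb; apply: bump_out => ob; apply: ncb => i.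
by have := ob i; rewrite /= !in_itv/= => /andP[h1 h2]; rewrite !ltW.
Qed.

Lemma cvg_flat (t : R) : 0 < t -> (fun k : nat => flat 0 (k.+1%:R * t)) @ \oo --> (1 : R).
Proof.
move=> t0; rewrite -[X in _ --> X]expR0.
have -> : (fun k : nat => flat 0 (k.+1%:R * t)) = (fun k => expR (- (t^-1 * harmonic k))).
  by apply/funext => k; rewrite /flat mulr_gt0// expr0 mul1r invfM mulrC.
apply: continuous_cvg; first exact: continuous_expR.
rewrite -[X in _ --> X]oppr0 -[X in _ --> - X](mulr0 t^-1).
by apply: cvgN; apply: cvgM; [exact: cvg_cst | exact: cvg_harmonic].
Qed.

Lemma cvg_bump a b x : obox a b x -> (fun k => bump a b k x) @ \oo --> (1 : R).
Proof.
move=> ob; rewrite /bump.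
suff : (fun k => \prod_i (flat 0 (k.+1%:R * (x ord0 i - a i)) *
    flat 0 (k.+1%:R * (b i - x ord0 i)))) @ \oo --> (\prod_(i < n) (1 * 1) : R).
  by rewrite big1// => i _; rewrite mulr1.
apply: cvg_big => //; first exact: mul_continuous.
move=> i _; apply: cvgM; apply: cvg_flat; have := ob i;
  by rewrite /= in_itv/= subr_gt0 => /andP[].
Qed.

Lemma setI_obox (a b c d : 'I_n -> R) : obox a b `&` obox c d =
  obox (fun i => Num.max (a i) (c i)) (fun i => Num.min (b i) (d i)).
Proof.
apply/seteqP; split => x /=.
  move=> [h1 h2] i; have := h1 i; have := h2 i; rewrite /= !in_itv/=.
  by rewrite gt_max lt_min => /andP[-> ->] /andP[-> ->].
move=> h; split => i; have := h i; rewrite /= !in_itv/= gt_max lt_min;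
  by move=> /andP[/andP[h1 h2] /andP[h3 h4]]; apply/andP.
Qed.

(** Open boxes form a generating family stable under intersection, which is what the Dynkin argument
    in [flcv] requires. *)
Lemma measurable_rVE : @measurable _ 'rV[R]_n =
  <<s [set B | exists a b, B = obox a b] >>.
Proof.
apply/seteqP; split; last first.
  apply: smallest_sub; first exact: sigma_algebra_measurable.
  by move=> _ [a [b ->]]; exact: measurable_obox.
pose G := [set B : set 'rV[R]_n | exists a b, B = obox a b].
have sG : sigma_algebra setT (<<s G >>) by exact: smallest_sigma_algebra.
apply: smallest_sub => //; rewrite -bigcup_seq => B [i _] [C mC <-] /=; rewrite setTI.
have {mC} : (@RGenOInfty.G R).-sigma.-measurable C.
  by rewrite -RGenOInfty.measurableE.
move: C; apply: smallest_sub.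
  split => /=.
  - by rewrite preimage_set0; case: sG.
  - by move=> C hC; rewrite setTD preimage_setC -setTD; case: sG => _ h _; exact: h.
  - by move=> F hF; rewrite preimage_bigcup; case: sG => _ _; exact.
move=> _ [c ->] /=.
(* A half-space is the union of boxes whose only fixed side is x_i > c, all other sides being at
   distance k. *)
pose a (k : nat) (j : 'I_n) : R := if j == i then c else - k%:R.
have -> : (fun x : 'rV[R]_n => x ord0 i) @^-1` `]c, +oo[ =
    \bigcup_k obox (a k) (fun=> k%:R).
  apply/seteqP; split => x /=.
    rewrite in_itv/= andbT => cx.
    exists (Num.truncn (\sum_j `|x ord0 j|)).+1 => // j /=.
    have xj : `|x ord0 j| < (Num.truncn (\sum_j `|x ord0 j|)).+1%:R.
      apply: le_lt_trans (truncnS_gt _).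
      by rewrite (bigD1 j)//= lerDl; exact: sumr_ge0.
    move: xj; rewrite ltr_norml in_itv/= /a => /andP[h1 ->]; rewrite andbT.
    by case: eqP => [->|].
  move=> [k _ /(_ i)]; rewrite /a/= eqxx !in_itv/= andbT.
  by move=> /andP[].
case: sG => _ _; apply => k; apply: sub_gen_smallest; by exists (a k), (fun=> k%:R).
Qed.

(** The bumps tend to the indicator of the open box and lie between 0 and 1, so dominated
    convergence applies with |f| as the dominating function. *)
Lemma flcv_obox Omega f : L1loc Omega f -> measurable Omega ->
  (forall phi, test_fun Omega phi -> (\int[mu]_(x in Omega) (f x * phi x)%:E = 0)%E) ->
  forall a b, cbox a b `<=` Omega -> (\int[mu]_(x in obox a b) (f x)%:E = 0)%E.
Proof.
move=> lf mO hf a b abO; have mo := @measurable_obox R n a b.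
have oc : obox a b `<=` cbox a b.
  by move=> x ox i; have := ox i; rewrite /= !in_itv/= => /andP[h1 h2]; rewrite !ltW.
have oO : obox a b `<=` Omega by apply: subset_trans oc abO.
have iu : mu.-integrable (obox a b) (EFin \o f).
  apply: (integrableS (@measurable_cbox R n a b)) => //.
  by apply: lf.2 => //; exact: compact_cbox.
have mf : measurable_fun (obox a b) f by apply/measurable_EFinP; exact: measurable_int iu.
have ik k : (\int[mu]_(x in obox a b) (f x * bump a b k x)%:E = 0)%E.
  rewrite -[RHS](hf _ (test_fun_bump k abO)).
  have f0 x : ~ obox a b x -> f x * bump a b k x = 0.
    by move=> ox; rewrite (bump_out _ ox) mulr0.
  by rewrite [RHS](integral_vanishing f0 oO) [LHS](integral_vanishing f0).
have mb k : measurable_fun (obox a b) (bump a b k).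
  apply: continuous_measurable_rV => //; apply: smooth_continuous.
  by have [] := test_fun_bump k abO.
have : (fun k => \int[mu]_(x in obox a b) (f x * bump a b k x)%:E)%E @ \oo -->
    (\int[mu]_(x in obox a b) (f x)%:E)%E.
  apply: (dominated_cvg (g := fun x => `|f x|%:E) mo) => //.
  - by move=> k; apply/measurable_EFinP; exact: measurable_funM.
  - move=> x ox; apply: cvg_EFin; first exact: nearW.
    rewrite -[X in _ --> X](mulr1 (f x)); apply: cvgM; first exact: cvg_cst.
    exact: cvg_bump.
  - exact: integrable_norm.
  - move=> k x _; rewrite /= lee_fin normrM ler_piMr//.
    by have /andP[b0 b1] := bump_itv a b k x; rewrite ger0_norm.
rewrite (_ : (fun _ => _) = fun=> 0%E); last by apply/funext => k.
by move=> /cvg_lim <- //; rewrite lim_cst.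
Qed.

(** In a box whose closure lies in [Omega], the integral of f vanishes over sub-boxes, hence over
    all measurable subsets by Dynkin, so f = 0 almost everywhere there. Countably many such boxes
    cover [Omega]. *)
Lemma flcv Omega f : L1loc Omega f -> open Omega ->
  (forall phi, test_fun Omega phi -> (\int[mu]_(x in Omega) (f x * phi x)%:E = 0)%E) ->
  ae_in Omega (fun x => f x = 0).
Proof.
move=> lf oO hf; have mO := open_measurable_rV oO.
have key a b : cbox a b `<=` Omega -> mu.-negligible [set x | obox a b x /\ f x <> 0].
  move=> abO; have mo := @measurable_obox R n a b.
  have oc : obox a b `<=` cbox a b.
    by move=> x ox i; have := ox i; rewrite /= !in_itv/= => /andP[h1 h2]; rewrite !ltW.
  have iu : mu.-integrable (obox a b) (EFin \o f).
    apply: (integrableS (@measurable_cbox R n a b)) => //.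
    by apply: lf.2 => //; exact: compact_cbox.
  suff h E : measurable E -> (\int[mu]_(x in obox a b `&` E) (f x)%:E = 0)%E.
    have : ae_eq mu (obox a b) (EFin \o f) (cst 0%E).
      apply: integral_ae_eq => //= E Eo mE.
      by have := h E mE; rewrite (setIidr Eo) => ->; rewrite integral0_eq.
    apply: negligibleS => x /= [ox fx] h2; apply: fx.
    by have := h2 ox => -[].
  move=> mE; have {mE} : <<s [set B : set 'rV[R]_n | exists a b, B = obox a b] >> E.
    by rewrite -measurable_rVE.
  move: E; apply: (dynkin_induction measurable_rVE).
  - move=> _ _ [a1 [b1 ->]] [a2 [b2 ->]]; rewrite setI_obox; by eexists; eexists.
  - by rewrite setIT; exact: (flcv_obox lf).
  - move=> _ [a1 [b1 ->]]; rewrite setI_obox; apply: (flcv_obox lf) => // x hx.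
    apply: abO => i; have := hx i; rewrite /= !in_itv/= ge_max le_min.
    by move=> /andP[/andP[-> _] /andP[-> _]].
  - move=> E mE h; rewrite -setDE.
    have := flcv_obox lf mO hf abO.
    rewrite -{1}(setUIDK (obox a b) E) integral_setU//.
    + by rewrite h add0e.
    + exact: measurableI.
    + exact: measurableD.
    + by rewrite setUIDK; exact: measurable_int iu.
    + by apply/disj_setPS => x [[_ ?] [_]].
  - move=> F mF tF h; rewrite setI_bigcupr integral_bigcup//.
    + by rewrite eseries0.
    + exact: trivIset_setIl.
    + by move=> k; exact: measurableI.
    + rewrite -setI_bigcupr; apply: integrableS iu => //.
      by apply: measurableI => //; exact: bigcup_measurable.
pose B q := obox (@rat_lo R n q) (rat_hi q).
(* Boxes that leave [Omega] contribute the empty set, so that the union can run over all rational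
   boxes. *)
pose N q := if pselect (cbox (@rat_lo R n q) (rat_hi q) `<=` Omega)
  then [set x | B q x /\ f x <> 0] else set0.
have N0 q : mu.-negligible (N q).
  by rewrite /N; case: pselect => // h; [exact: key | exact: negligible_set0].
pose M k := if unpickle k is Some q then N q else set0.
have M0 k : mu.-negligible (M k).
  by rewrite /M; case: unpickle => [q|]; [exact: N0 | exact: negligible_set0].
apply: negligibleS (negligible_bigcup M0) => x /= /not_implyP[Ox fx].
have [q [Bx qO]] := open_rV_rat_box oO Ox.
exists (pickle q) => //; rewrite /M pickleK /N; case: pselect => //.
Qed.

End weak_derivatives.

Section weak_gradient.
Context {R : realType} {n : nat}.
Local Notation mu := (@lebesgue_rV R n).
Local Notation e_ i := (delta_mx ord0 i : 'rV[R]_n).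
Implicit Types (Omega K : set 'rV[R]_n) (u v f g phi b : 'rV[R]_n -> R).

Lemma ae_inS Omega (P Q : 'rV[R]_n -> Prop) :
  (forall x, Omega x -> P x -> Q x) -> ae_in Omega P -> ae_in Omega Q.
Proof.
by move=> PQ; rewrite /ae_in; apply: filterS => x h Ox; exact/(PQ _ Ox)/h.
Qed.

Lemma ae_inS2 Omega (P Q S : 'rV[R]_n -> Prop) :
  (forall x, Omega x -> P x -> Q x -> S x) ->
  ae_in Omega P -> ae_in Omega Q -> ae_in Omega S.
Proof.
move=> PQ; rewrite /ae_in; apply: filterS2 => x hp hq Ox.
by apply: PQ => //; [exact: hp | exact: hq].
Qed.

Lemma ae_in_forall Omega (I : finType) (P : I -> 'rV[R]_n -> Prop) :
  (forall i, ae_in Omega (P i)) -> ae_in Omega (fun x => forall i, P i x).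
Proof.
move=> h; rewrite /ae_in.
have : {ae mu, forall x, forall i, Omega x -> P i x} by apply: filter_forall => i; exact: h.
by apply: filterS => x hx Ox i; exact: hx.
Qed.

Lemma integralE_Rintegral d (T : measurableType d) (m : {measure set T -> \bar R})
    D (f : T -> R) : measurable D -> m.-integrable D (EFin \o f) ->
  (\int[m]_(x in D) (f x)%:E = (\int[m]_(x in D) f x)%:E)%E.
Proof. by move=> mD hf; rewrite fineK//; exact: integrable_fin_num. Qed.

(** For locally integrable functions both integrals are finite, so the defining identity can be
    handled by real arithmetic. *)
Lemma weak_pderivP Omega i u v : measurable Omega -> L1loc Omega u -> L1loc Omega v ->
  weak_pderiv Omega i u v <->
  forall phi, test_fun Omega phi -> \int[mu]_(x in Omega) (u x * pderiv i phi x) =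
     - \int[mu]_(x in Omega) (v x * phi x).
Proof.
move=> mO lu lv; split=> [[_ _ h] phi tphi|h].
  have i1 := L1loc_integrable_test_pderiv i mO lu tphi.
  have i2 := L1loc_integrable_test mO lv tphi.
  have := h _ tphi; rewrite !integralE_Rintegral// -EFinN.
  by move=> [].
split=> // phi tphi.
have i1 := L1loc_integrable_test_pderiv i mO lu tphi.
have i2 := L1loc_integrable_test mO lv tphi.
by rewrite !integralE_Rintegral// h// EFinN.
Qed.

Lemma L1locD Omega u v : L1loc Omega u -> L1loc Omega v ->
  L1loc Omega (fun x => u x + v x).
Proof.
move=> [mu_ iu] [mv iv]; split; first exact: measurable_funD.
move=> K cK KO; have mK := compact_measurable_rV cK.
exact: (integrableD mK (iu _ cK KO) (iv _ cK KO)).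
Qed.

Lemma L1loc_bmul Omega b u : measurable Omega -> measurable_fun Omega b ->
  (exists C, forall x, Omega x -> `|b x| <= C) ->
  L1loc Omega u -> L1loc Omega (fun x => b x * u x).
Proof.
move=> mO mb [C hC] [mu_ iu]; split; first exact: measurable_funM.
move=> K cK KO; have mK := compact_measurable_rV cK.
apply: (integrableMr mK _ _ (iu _ cK KO)); first exact: measurable_funS mb.
exists C; split; first exact: num_real.
by move=> N CN x Kx; apply: le_trans (hC _ (KO _ Kx)) _; exact: ltW.
Qed.

Lemma L1loc_continuous Omega f : measurable Omega -> continuous f -> L1loc Omega f.
Proof.
move=> mO cf; split; first exact: continuous_measurable_rV.
move=> K cK KO; have mK := compact_measurable_rV cK.
apply: measurable_bounded_integrable => //.
- exact: compact_lebesgue_rV_fin.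
- exact: continuous_measurable_rV.
- exact: continuous_bounded_on.
Qed.

(** Makes the arbitrary choice in [wgrad] harmless. *)
Lemma weak_pderiv_unique Omega i u v1 v2 : open Omega ->
  weak_pderiv Omega i u v1 -> weak_pderiv Omega i u v2 ->
  ae_in Omega (fun x => v1 x = v2 x).
Proof.
move=> oO h1 h2; have mO := open_measurable_rV oO.
have [lu l1 _] := h1; have [_ l2 _] := h2.
have l21 : L1loc Omega (fun x => -1 * v2 x).
  by apply: L1loc_bmul => //; exists 1 => x _; rewrite normrN normr1.
have : ae_in Omega (fun x => v1 x + -1 * v2 x = 0).
  apply: flcv => //; first exact: L1locD.
  move=> phi tphi.
  have i1 := L1loc_integrable_test mO l1 tphi.
  have i2 := L1loc_integrable_test mO l2 tphi.
  have i3 : mu.-integrable Omega (EFin \o (fun x => v1 x * phi x - v2 x * phi x)).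
    exact: (integrableB mO i1 i2).
  under eq_integral do rewrite mulN1r mulrBl.
  rewrite integralE_Rintegral// RintegralB//.
  move/(weak_pderivP i mO lu l1)/(_ _ tphi) : h1 => e1.
  move/(weak_pderivP i mO lu l2)/(_ _ tphi) : h2 => e2.
  by apply: congr1; apply/eqP; rewrite subr_eq0 -eqr_opp -e1 -e2.
apply: ae_inS => x Ox; rewrite mulN1r => /eqP.
by rewrite subr_eq0 => /eqP.
Qed.

Lemma weak_pderivD Omega i u1 v1 u2 v2 : measurable Omega ->
  weak_pderiv Omega i u1 v1 -> weak_pderiv Omega i u2 v2 ->
  weak_pderiv Omega i (fun x => u1 x + u2 x) (fun x => v1 x + v2 x).
Proof.
move=> mO h1 h2; have [lu1 l1 _] := h1; have [lu2 l2 _] := h2.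
apply/weak_pderivP => //; try exact: L1locD.
move=> phi tphi.
under eq_Rintegral do rewrite mulrDl.
under [in RHS]eq_Rintegral do rewrite mulrDl.
rewrite !RintegralD ?opprD//; try exact: L1loc_integrable_test;
  try exact: L1loc_integrable_test_pderiv.
by congr (_ + _); [move: h1|move: h2] => /weak_pderivP; apply.
Qed.

Lemma test_pderiv_mul Omega f phi i x : is_derive x (e_ i) f (pderiv i f x) ->
  test_fun Omega phi ->
  pderiv i (fun y => f y * phi y) x = f x * pderiv i phi x + pderiv i f x * phi x.
Proof.
move=> hf [sphi _].
have := is_derive_mul hf (smooth_is_derive i x sphi) => /pderivE ->.
by rewrite [phi x * _]mulrC.
Qed.

(** The product of two test functions is a test function, and its derivative has integral zero. *)
Lemma weak_pderiv_test Omega i phi : measurable Omega -> test_fun Omega phi ->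
  weak_pderiv Omega i phi (pderiv i phi).
Proof.
move=> mO tphi; have [sphi [K [cK KO phi0]]] := tphi.
have l1 : L1loc Omega phi by apply: L1loc_continuous => //; exact: smooth_continuous.
have l2 : L1loc Omega (pderiv i phi).
  by apply: L1loc_continuous => //; apply: smooth_continuous; exact: smooth_pderiv.
apply/weak_pderivP => // psi tpsi; have [spsi _] := tpsi.
apply/eqP; rewrite -addr_eq0 -RintegralD//; last 2 first.
- exact: L1loc_integrable_test_pderiv.
- exact: L1loc_integrable_test.
have tpp : test_fun Omega (fun x => phi x * psi x).
  split; first exact: smoothM.
  by exists K; split => // x Kx; rewrite phi0// mul0r.
apply/eqP.
under eq_Rintegral.
  move=> x _; rewrite -(test_pderiv_mul (smooth_is_derive i x sphi) tpsi).
  over.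
by rewrite /Rintegral integral_test_pderiv.
Qed.

(** What a factor must satisfy for multiplication by it to preserve H^1_0. Stability of test
    functions replaces smoothness, and derivatives are prescribed on [Omega] only, because the
    factors used later are singular at the origin, outside the exterior domain. *)
Record multiplier Omega (b : 'rV[R]_n -> R) (db : 'I_n -> 'rV[R]_n -> R) : Prop :=
  Multiplier {
    mult_test : forall phi, test_fun Omega phi -> test_fun Omega (fun x => b x * phi x);
    mult_derive : forall i x, Omega x -> is_derive x (e_ i) b (db i x);
    mult_meas : measurable_fun Omega b;
    mult_dmeas : forall i, measurable_fun Omega (db i);
    mult_bound : exists2 C, 0 <= C & forall x, Omega x -> `|b x| <= C;
    mult_dbound : exists2 C, 0 <= C & forall i x, Omega x -> `|db i x| <= C }.

Lemma multiplier_pderiv Omega b db phi i x : multiplier Omega b db ->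
  test_fun Omega phi -> Omega x ->
  pderiv i (fun y => b y * phi y) x = b x * pderiv i phi x + db i x * phi x.
Proof.
move=> hb tphi Ox; have hd := mult_derive hb i Ox.
have hd' : is_derive x (e_ i) b (pderiv i b x) by rewrite (pderivE hd).
by rewrite (test_pderiv_mul hd' tphi) (pderivE hd).
Qed.

(** The weak derivative of [u] is tested against b phi, and the term with the derivative of [b] is
    moved to the other side. *)
Lemma weak_pderiv_mul Omega i u v b db : measurable Omega -> multiplier Omega b db ->
  weak_pderiv Omega i u v ->
  weak_pderiv Omega i (fun x => b x * u x) (fun x => b x * v x + db i x * u x).
Proof.
move=> mO hb h; have [lu lv _] := h.
have [C C0 hC] := mult_bound hb; have [C' C'0 hC'] := mult_dbound hb.
have lbu : L1loc Omega (fun x => b x * u x).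
  by apply: L1loc_bmul (lu) => //; [exact: mult_meas hb | exists C].
have lbv : L1loc Omega (fun x => b x * v x).
  by apply: L1loc_bmul (lv) => //; [exact: mult_meas hb | exists C].
have ldu : L1loc Omega (fun x => db i x * u x).
  by apply: L1loc_bmul (lu) => //; [exact: mult_dmeas hb i | exists C'; exact: hC'].
apply/weak_pderivP => //; first exact: L1locD.
move=> phi tphi; have tbphi := mult_test hb tphi.
move/weak_pderivP : h => /(_ mO lu lv) /(_ _ tbphi) e1.
have j1 := L1loc_integrable_test_pderiv i mO lu tbphi.
have j2 := L1loc_integrable_test mO ldu tphi.
have j3 := L1loc_integrable_test mO lbv tphi.
transitivity (\int[mu]_(x in Omega) (u x * pderiv i (fun y => b y * phi y) x -
    db i x * u x * phi x)).
  apply: eq_Rintegral => x /set_mem Ox; rewrite (multiplier_pderiv i hb tphi Ox); ring.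
rewrite RintegralB// e1.
under [in RHS]eq_Rintegral do rewrite mulrDl.
rewrite RintegralD// opprD; congr (- _ - _).
by apply: eq_Rintegral => x _; ring.
Qed.

Lemma multiplier_ext Omega b db b' db' : (forall x, b x = b' x) ->
  (forall i x, Omega x -> db i x = db' i x) -> measurable Omega ->
  multiplier Omega b db -> multiplier Omega b' db'.
Proof.
move=> /funext <- e mO [h1 h2 h3 h4 h5 [C C0 h6]]; split => //.
- by move=> i x Ox; rewrite -e//; exact: h2.
- by move=> i; apply: eq_measurable_fun (h4 i) => x /set_mem Ox; exact: e.
- by exists C => // i x Ox; rewrite -e//; exact: h6.
Qed.

Lemma multiplier_cst Omega c : measurable Omega ->
  multiplier Omega (fun=> c) (fun _ _ => 0).
Proof.
move=> mO; split => //.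
- move=> phi [sphi [K [cK KO phi0]]]; split.
    by apply: smoothM => // k; exact: of_class_cst.
  by exists K; split => // x Kx; rewrite phi0// mulr0.
- by move=> i x _; exact: is_derive_cst.
- by exists `|c|.
- by exists 0 => // i x _; rewrite normr0.
Qed.

Lemma multiplierD Omega b db b' db' :
  multiplier Omega b db -> multiplier Omega b' db' ->
  multiplier Omega (fun x => b x + b' x) (fun i x => db i x + db' i x).
Proof.
move=> [h1 h2 h3 h4 [C C0 h5] [D D0 h6]] [h1' h2' h3' h4' [C' C0' h5'] [D' D0' h6']].
split.
- move=> phi tphi; have [s1 [K [cK KO p0]]] := h1 _ tphi.
  have [s2 [K' [cK' KO' p0']]] := h1' _ tphi.
  have [sphi [L [cL LO phi0]]] := tphi.
  split; first by move=> k; under eq_fun do rewrite mulrDl; exact: of_classD.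
  by exists L; split => // x Lx; rewrite phi0// mulr0.
- by move=> i x Ox; apply: is_derive_add; [exact: h2 | exact: h2'].
- exact: measurable_funD.
- by move=> i; exact: measurable_funD.
- exists (C + C'); first exact: addr_ge0.
  by move=> x Ox; rewrite (le_trans (ler_normD _ _))// lerD ?h5 ?h5'.
- exists (D + D'); first exact: addr_ge0.
  by move=> i x Ox; rewrite (le_trans (ler_normD _ _))// lerD ?h6 ?h6'.
Qed.

Lemma multiplierM Omega b db b' db' :
  multiplier Omega b db -> multiplier Omega b' db' ->
  multiplier Omega (fun x => b x * b' x) (fun i x => b x * db' i x + b' x * db i x).
Proof.
move=> [h1 h2 h3 h4 [C C0 h5] [D D0 h6]] [h1' h2' h3' h4' [C' C0' h5'] [D' D0' h6']].
split.
- by move=> phi tphi; have := h1 _ (h1' _ tphi); under eq_fun do rewrite mulrA.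
- by move=> i x Ox; apply: is_derive_mul; [exact: h2 | exact: h2'].
- exact: measurable_funM.
- by move=> i; apply: measurable_funD; apply: measurable_funM.
- exists (C * C'); first exact: mulr_ge0.
  by move=> x Ox; rewrite normrM ler_pM ?h5 ?h5'.
- exists (C * D' + C' * D); first by rewrite addr_ge0 ?mulr_ge0.
  move=> i x Ox; rewrite (le_trans (ler_normD _ _))// !normrM.
  by rewrite lerD// ler_pM ?h5 ?h6 ?h5' ?h6'.
Qed.

Lemma multiplier_sum Omega (I : Type) (s : seq I) (b : I -> 'rV[R]_n -> R)
    (db : I -> 'I_n -> 'rV[R]_n -> R) : measurable Omega ->
  (forall i, multiplier Omega (b i) (db i)) ->
  multiplier Omega (fun x => \sum_(i <- s) b i x) (fun j x => \sum_(i <- s) db i j x).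
Proof.
move=> mO hb; elim: s => [|i s IH].
  apply: (multiplier_ext _ _ mO (multiplier_cst 0 mO)) => [x|i x _];
  by rewrite big_nil.
by apply: (multiplier_ext _ _ mO (multiplierD (hb i) IH)) => [x|j x _]; rewrite big_cons.
Qed.

End weak_gradient.

(** * Sobolev spaces *)

Section sobolev_calculus.
Context {R : realType} {n : nat}.
Local Notation mu := (@lebesgue_rV R n).
Local Notation e_ i := (delta_mx ord0 i : 'rV[R]_n).
Variable Omega : set 'rV[R]_n.
Hypothesis oO : open Omega.
Let mO : measurable Omega := open_measurable_rV oO.
Implicit Types (K : set 'rV[R]_n) (u v f g phi b d : 'rV[R]_n -> R).
Local Notation intO f := (mu.-integrable Omega (EFin \o f)).

Definition L2 f := measurable_fun Omega f /\ intO (fun x => f x ^+ 2).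

Lemma Lp2P f : Lp Omega 2%:E f <-> L2 f.
Proof.
suff E : measurable_fun Omega f -> finite_norm mu 2%:E (f \_ Omega) <->
    (\int[mu]_(x in Omega) (f x ^+ 2)%:E < +oo)%E.
  split=> -[mf h]; split => //.
    apply/integrableP; split; first exact/measurable_EFinP/measurable_funX.
    under eq_integral do rewrite /= ger0_norm ?sqr_ge0//.
    exact/E.
  apply/E => //; move/integrableP : h => [_].
  by under eq_integral do rewrite /= ger0_norm ?sqr_ge0//.
move=> mf; rewrite /finite_norm.
have -> : (\int[mu]_(x in Omega) (f x ^+ 2)%:E =
    'N[mu]_(2%:E)[EFin \o f \_ Omega] `^ 2)%E.
  rewrite poweR_Lnorm// [LHS]integral_mkcond; apply: eq_integral => x _.
  rewrite /= !patchE; case: ifP => _ /=.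
    by rewrite powR_mulrn// real_normK// num_real.
  by rewrite normr0 powR_mulrn// expr0n.
split=> h; first by rewrite poweR_lty.
by rewrite ltNge leye_eq; apply/eqP => e; move: h; rewrite e poweRyr.
Qed.

Lemma L2_bmul b f : measurable_fun Omega b ->
  (exists2 C, 0 <= C & forall x, Omega x -> `|b x| <= C) -> L2 f ->
  L2 (fun x => b x * f x).
Proof.
move=> mb [C C0 hC] [mf hf]; split; first exact: measurable_funM.
apply: (@le_integrable _ _ _ mu _ mO _ (fun x => (C ^+ 2)%:E * (f x ^+ 2)%:E)%E).
- by apply/measurable_EFinP; apply: measurable_funX; exact: measurable_funM.
- move=> x Ox; rewrite /= lee_fin -exprMn !normrX ler_pXn2r ?nnegrE//.
  by rewrite !normrM ler_wpM2r// [leRHS]ger0_norm// hC.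
- exact: integrableZl.
Qed.

Lemma integrable_L2M f g : L2 f -> L2 g -> intO (fun x => f x * g x).
Proof.
move=> [mf hf] [mg hg].
apply: (@le_integrable _ _ _ mu _ mO _ (fun x => (f x ^+ 2)%:E + (g x ^+ 2)%:E)%E).
- by apply/measurable_EFinP; exact: measurable_funM.
- move=> x _; rewrite /= lee_fin [leRHS]ger0_norm ?addr_ge0 ?sqr_ge0//.
  rewrite ler_norml; apply/andP; split.
    have := sqr_ge0 (f x + g x); have := sqr_ge0 (f x); have := sqr_ge0 (g x); nra.
  have := sqr_ge0 (f x - g x); have := sqr_ge0 (f x); have := sqr_ge0 (g x); nra.
- exact: integrableD.
Qed.

Lemma L2D f g : L2 f -> L2 g -> L2 (fun x => f x + g x).
Proof.
move=> hf hg; have h := integrable_L2M hf hg.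
move: hf hg => [mf hf] [mg hg]; split; first exact: measurable_funD.
have -> : EFin \o (fun x => (f x + g x) ^+ 2) =
    (fun x => (f x ^+ 2)%:E + ((g x ^+ 2)%:E + 2%:E * (f x * g x)%:E))%E.
  by apply/funext => x /=; rewrite -EFinM -!EFinD; congr EFin; ring.
apply: (integrableD mO hf); apply: (integrableD mO hg); exact: integrableZl.
Qed.

Lemma intO_bmul b f : measurable_fun Omega b ->
  (exists2 C, 0 <= C & forall x, Omega x -> `|b x| <= C) -> intO f ->
  intO (fun x => b x * f x).
Proof.
move=> mb [C C0 hC] hf; have mf : measurable_fun Omega f.
  by apply/measurable_EFinP; exact: measurable_int hf.
apply: (@le_integrable _ _ _ mu _ mO _ (fun x => C%:E * (f x)%:E)%E).
- by apply/measurable_EFinP; exact: measurable_funM.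
- move=> x Ox; rewrite /= lee_fin !normrM ler_wpM2r//.
  by rewrite [leRHS]ger0_norm// hC.
- exact: integrableZl.
Qed.

Lemma intOD f g : intO f -> intO g -> intO (fun x => f x + g x).
Proof. by move=> hf hg; exact: (integrableD mO hf hg). Qed.

Lemma intOZ c f : intO f -> intO (fun x => c * f x).
Proof. by move=> hf; exact: (integrableZl mO c hf). Qed.

Lemma intO_sum (I : Type) (s : seq I) (f : I -> 'rV[R]_n -> R) :
  (forall i, intO (f i)) -> intO (fun x => \sum_(i <- s) f i x).
Proof.
move=> hf; elim: s => [|i s IH].
  under eq_fun do rewrite big_nil; exact: integrable0.
under eq_fun do rewrite big_cons; exact: intOD.
Qed.

Lemma L2_test phi : test_fun Omega phi -> L2 phi.
Proof.
move=> [sphi [K [cK KO phi0]]]; have cphi := smooth_continuous sphi; split.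
  exact: continuous_measurable_rV.
apply: (integrable_continuous_compact (K := K)) => //.
  by move=> x Kx; rewrite phi0// expr0n.
by apply: smooth_continuous; under eq_fun do rewrite expr2; exact: smoothM.
Qed.

Lemma enorm_sqr (x : 'rV[R]_n) : enorm x ^+ 2 = \sum_i x ord0 i ^+ 2.
Proof. by rewrite /enorm sqr_sqrtr// sumr_ge0// => i _; exact: sqr_ge0. Qed.

Lemma wgradP u : W11loc Omega u -> has_wgrad Omega u (wgrad Omega u).
Proof. by move=> [_ [g hg]]; rewrite /wgrad; case: xgetP => // h; case: (h g). Qed.

Lemma has_wgrad_ae u (g : 'I_n -> 'rV[R]_n -> R) :
  (forall i, weak_pderiv Omega i u (g i)) -> L1loc Omega u ->
  ae_in Omega (fun x => forall i, wgrad Omega u x ord0 i = g i x).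
Proof.
move=> hg lu; apply: ae_in_forall => i; apply: (weak_pderiv_unique oO) (hg i).
apply: wgradP; split => //; exists (fun x => \row_j g j x) => j.
by under eq_fun do rewrite mxE; exact: hg.
Qed.

(** The norm may be computed with any weak gradient, since it agrees almost everywhere with the
    chosen one. *)
Lemma H1norm2E u (g : 'I_n -> 'rV[R]_n -> R) :
  (forall i, weak_pderiv Omega i u (g i)) -> L1loc Omega u ->
  H1norm2 Omega u = (\int[mu]_(x in Omega) (\sum_i g i x ^+ 2 + u x ^+ 2)%:E)%E.
Proof.
move=> hg lu; rewrite /H1norm2.
have mu_ : measurable_fun Omega u by case: lu.
have mg i : measurable_fun Omega (g i) by case: (hg i) => _ [].
have mw i : measurable_fun Omega (fun x => wgrad Omega u x ord0 i).
  suff : weak_pderiv Omega i u (fun x => wgrad Omega u x ord0 i) by case=> _ [].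
  apply: wgradP; split => //; exists (fun x => \row_j g j x) => j.
  by under eq_fun do rewrite mxE; exact: hg.
apply: ae_eq_integral => //.
- apply/measurable_EFinP; apply: measurable_funD; last exact: measurable_funX.
  under eq_fun do rewrite enorm_sqr.
  by apply: measurable_sum => i; exact: measurable_funX.
- apply/measurable_EFinP; apply: measurable_funD; last exact: measurable_funX.
  by apply: measurable_sum => i; exact: measurable_funX.
- apply: ae_inS (has_wgrad_ae hg lu) => x Ox h.
  by rewrite enorm_sqr; congr (_ + _)%:E; apply: eq_bigr => i _; rewrite h.
Qed.

Lemma H1_L2 u : H1 Omega u -> L2 u /\ forall i, L2 (fun x => wgrad Omega u x ord0 i).
Proof. by move=> [_ /Lp2P h1 h2]; split => // i; apply/Lp2P; exact: h2. Qed.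

Lemma H1_intro u (g : 'I_n -> 'rV[R]_n -> R) :
  (forall i, weak_pderiv Omega i u (g i)) -> L1loc Omega u -> L2 u ->
  (forall i, L2 (g i)) -> H1 Omega u.
Proof.
move=> hg lu h2 hg2.
have W : W11loc Omega u.
  split => //; exists (fun x => \row_j g j x) => j.
  by under eq_fun do rewrite mxE; exact: hg.
split => //; first exact/Lp2P.
move=> i; apply/Lp2P.
have mw : measurable_fun Omega (fun x => wgrad Omega u x ord0 i).
  by have [_ []] := wgradP W i.
split => //; have [mg /integrableP[_ ig]] := hg2 i; apply/integrableP; split.
  exact/measurable_EFinP/measurable_funX.
rewrite (ae_eq_integral (fun x => `|(g i x ^+ 2)%:E|%E))//.
- by apply: measurableT_comp => //; exact/measurable_EFinP/measurable_funX.
- by apply: measurableT_comp => //; exact/measurable_EFinP/measurable_funX.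
- by apply: ae_inS (has_wgrad_ae hg lu) => x Ox h /=; rewrite h.
Qed.

Lemma weak_pderiv_sub_test u i v phi : test_fun Omega phi -> weak_pderiv Omega i u v ->
  weak_pderiv Omega i (u \- phi) (fun x => v x - pderiv i phi x).
Proof.
move=> tphi h; have hN : test_fun Omega (fun x => -1 * phi x).
  exact: (mult_test (multiplier_cst (-1) mO)).
have -> : u \- phi = (fun x => u x + -1 * phi x).
  by apply/funext => x /=; rewrite mulN1r.
have -> : (fun x => v x - pderiv i phi x) =
    (fun x => v x + pderiv i (fun x => -1 * phi x) x).
  apply/funext => x; have [sphi _] := tphi.
  have := is_derive_mul (is_derive_cst (-1:R) x (e_ i)) (smooth_is_derive i x sphi).
  by move=> /pderivE ->; rewrite mulr0 addr0 mulN1r.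
by apply: (weak_pderivD mO h); exact: weak_pderiv_test.
Qed.

Lemma H10_approx u : H10 Omega u -> forall e : R, 0 < e ->
  exists2 phi, test_fun Omega phi &
    (\int[mu]_(x in Omega) (\sum_i (wgrad Omega u x ord0 i - pderiv i phi x) ^+ 2 +
      (u x - phi x) ^+ 2)%:E < e%:E)%E.
Proof.
move=> [[W _ _] h] e e0; have [phi tphi] := h e e0.
rewrite (H1norm2E (g := fun i x => wgrad Omega u x ord0 i - pderiv i phi x)).
- by exists phi.
- by move=> i; apply: weak_pderiv_sub_test => //; exact: wgradP.
- have -> : u \- phi = (fun x => u x + -1 * phi x).
    by apply/funext => x /=; rewrite mulN1r.
  apply: L1locD; first by case: W.
  have [sphi _] : test_fun Omega (fun x => -1 * phi x).
    exact: (mult_test (multiplier_cst (-1) mO)).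
  by apply: L1loc_continuous => //; exact: smooth_continuous.
Qed.

End sobolev_calculus.

Section H10_calculus.
Context {R : realType} {n : nat}.
Local Notation mu := (@lebesgue_rV R n).
Local Notation e_ i := (delta_mx ord0 i : 'rV[R]_n).
Variable Omega : set 'rV[R]_n.
Hypothesis oO : open Omega.
Let mO : measurable Omega := open_measurable_rV oO.
Implicit Types (K : set 'rV[R]_n) (u v f g phi b d : 'rV[R]_n -> R).
Local Notation intO f := (mu.-integrable Omega (EFin \o f)).
Local Notation "'I[' f ]" := (Rintegral mu Omega f) (format "'I[' f ]").
Local Notation D u i := (fun x => wgrad Omega u x ord0 i).

Lemma small_eq0 (X M : R) : 0 <= M -> (forall e, 0 < e -> `|X| <= e * M) -> X = 0.
Proof.
move=> M0 h; apply/eqP; rewrite -normr_eq0 eq_le normr_ge0 andbT leNgt.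
apply/negP => X0; have M1 : 0 < M + 1 by rewrite ltr_wpDl.
have := h (`|X| / (M + 1)) (divr_gt0 X0 M1); apply/negP; rewrite -ltNge.
by rewrite -mulrA gtr_pMr// mulrC ltr_pdivrMr// mul1r ltrDl.
Qed.

(* Formally d_i (b u^2), with d standing for d_i b and ui for d_i u. *)
Definition quad_form b d u ui : 'rV[R]_n -> R :=
  fun x => 2 * (b x * (u x * ui x)) + d x * u x ^+ 2.

Lemma intO_quad_form b d u ui : measurable_fun Omega b -> measurable_fun Omega d ->
  (exists2 C, 0 <= C & forall x, Omega x -> `|b x| <= C) ->
  (exists2 C, 0 <= C & forall x, Omega x -> `|d x| <= C) ->
  L2 Omega u -> L2 Omega ui -> intO (quad_form b d u ui).
Proof.
move=> mb md hb hd lu lui; apply: intOD => //.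
  by apply: intOZ => //; apply: intO_bmul => //; exact: integrable_L2M.
by apply: intO_bmul => //; exact: lu.2.
Qed.

(** The integrand is the classical i-th derivative of b phi^2, a test function. *)
Lemma quad_form_test b db phi i : multiplier Omega b db -> test_fun Omega phi ->
  I[quad_form b (db i) phi (pderiv i phi)] = 0.
Proof.
move=> hb tphi; have tb := mult_test hb tphi.
have [sphi [K [cK KO phi0]]] := tphi.
have tpp : test_fun Omega (fun x => phi x * (b x * phi x)).
  split; first by apply: smoothM => //; case: tb.
  by exists K; split => // x Kx; rewrite phi0// mul0r.
rewrite /Rintegral -[RHS]/(fine 0%E) -(integral_test_pderiv i tpp).
congr fine; apply: eq_integral => x /set_mem Ox; congr EFin.
rewrite (test_pderiv_mul (smooth_is_derive i x sphi) tb) (multiplier_pderiv i hb tphi Ox).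
by rewrite /quad_form; ring.
Qed.

(** Young's inequality with weight [e] trades a small multiple of the size of u for a large multiple
    of its distance to v, which approximation can afterwards make small. *)
Lemma quad_form_diff (b d u ui v vi C e : R) : 0 < e -> `|b| <= C -> `|d| <= C ->
  `|(2 * (b * (u * ui)) + d * u ^+ 2) - (2 * (b * (v * vi)) + d * v ^+ 2)| <=
  C * (4 * e * (u ^+ 2 + ui ^+ 2) + (4 / e + 4) * ((u - v) ^+ 2 + (ui - vi) ^+ 2)).
Proof.
move=> e0 hb hd; set z := u - v; set zi := ui - vi.
have C0 : 0 <= C by apply: le_trans hb.
have young a c : `|a * c| <= e * a ^+ 2 + c ^+ 2 / e.
  pose k := c / e; have ck : c = e * k by rewrite /k mulrC divfK// gt_eqF.
  have -> : e * a ^+ 2 + c ^+ 2 / e = e * (a ^+ 2 + k ^+ 2).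
    by rewrite ck; field; rewrite gt_eqF.
  rewrite ck mulrCA normrM gtr0_norm// ler_pM2l// ler_norml; apply/andP.
  by split; have := sqr_ge0 (a + k); have := sqr_ge0 (a - k);
    have := sqr_ge0 a; have := sqr_ge0 k; nra.
(* The difference is expanded around u rather than v, so the size of the approximating v never
   enters the bound. *)
have -> : (2 * (b * (u * ui)) + d * u ^+ 2) - (2 * (b * (v * vi)) + d * v ^+ 2) =
    b * (2 * (u * zi + ui * z - z * zi)) + d * (2 * (u * z) - z ^+ 2).
  by rewrite /z /zi; ring.
have e1 : 0 < e^-1 by rewrite invr_gt0.
have z2 := sqr_ge0 z; have zi2 := sqr_ge0 zi.
have n3 : `|z * zi| <= z ^+ 2 + zi ^+ 2.
  rewrite ler_norml; apply/andP; split; have := sqr_ge0 (z + zi);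
    have := sqr_ge0 (z - zi); nra.
have h1 : `|2 * (u * zi + ui * z - z * zi)| <=
    2 * (e * u ^+ 2 + zi ^+ 2 / e + (e * ui ^+ 2 + z ^+ 2 / e) + (z ^+ 2 + zi ^+ 2)).
  rewrite normrM ger0_norm// ler_pM2l//.
  apply: le_trans (ler_normB _ _) _; apply: lerD n3.
  apply: le_trans (ler_normD _ _) _; apply: lerD; exact: young.
have h2 : `|2 * (u * z) - z ^+ 2| <= 2 * (e * u ^+ 2 + z ^+ 2 / e) + z ^+ 2.
  apply: le_trans (ler_normB _ _) _; rewrite [`|z ^+ 2|]ger0_norm// lerD2r.
  by rewrite normrM ger0_norm// ler_pM2l.
apply: le_trans (ler_normD _ _) _; rewrite !normrM.
apply: (@le_trans _ _ (C * (2 * (e * u ^+ 2 + zi ^+ 2 / e + (e * ui ^+ 2 + z ^+ 2 / e) +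
    (z ^+ 2 + zi ^+ 2))) + C * (2 * (e * u ^+ 2 + z ^+ 2 / e) + z ^+ 2))).
  apply: lerD; apply: ler_pM => //; first by rewrite -normrM.
rewrite -mulrDr ler_wpM2l// -subr_ge0.
have -> : 4 * e * (u ^+ 2 + ui ^+ 2) + (4 / e + 4) * (z ^+ 2 + zi ^+ 2) -
  (2 * (e * u ^+ 2 + zi ^+ 2 / e + (e * ui ^+ 2 + z ^+ 2 / e) + (z ^+ 2 + zi ^+ 2)) +
   (2 * (e * u ^+ 2 + z ^+ 2 / e) + z ^+ 2)) =
  2 * (e * ui ^+ 2) + (z ^+ 2 + 2 * (e^-1 * zi ^+ 2) + 2 * zi ^+ 2) by ring.
by rewrite !addr_ge0// mulr_ge0// mulr_ge0// ?sqr_ge0// ltW.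
Qed.

(* Approximate u by test functions, for which the integrand is a divergence. *)
Lemma quad_form_H10 b db u i : multiplier Omega b db -> H10 Omega u ->
  I[quad_form b (db i) u (D u i)] = 0.
Proof.
move=> hb hu; have [lu lui] := H1_L2 hu.1.
have [C1 C10 hC1] := mult_bound hb; have [C2 C20 hC2] := mult_dbound hb.
pose C := C1 + C2; have C0 : 0 <= C by exact: addr_ge0.
have hC x : Omega x -> `|b x| <= C /\ `|db i x| <= C.
  move=> Ox; rewrite /C; split; first by rewrite (le_trans (hC1 _ Ox))// lerDl.
  by rewrite (le_trans (hC2 _ _ Ox))// lerDr.
pose N2 x := u x ^+ 2 + D u i x ^+ 2.
have iN2 : intO N2 by apply: intOD => //; [exact: lu.2 | exact: (lui i).2].
pose E := I[N2].
have E0 : 0 <= E by apply: Rintegral_ge0 => x _; rewrite addr_ge0 ?sqr_ge0.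
apply: (@small_eq0 _ (C * (4 * E + 1))); first by rewrite mulr_ge0// addr_ge0// mulr_ge0.
move=> e e0.
have c0 : 0 < 4 / e + 4 by rewrite addr_gt0// divr_gt0.
(* This tolerance cancels the large Young factor 4 / e + 4 and leaves a total of order e. *)
have [phi tphi happ] := H10_approx oO hu (divr_gt0 e0 c0).
have [sphi _] := tphi.
pose z x := u x - phi x; pose zi x := D u i x - pderiv i phi x.
pose Z x := z x ^+ 2 + zi x ^+ 2.
have lphi : L2 Omega phi by exact: L2_test.
have lphii : L2 Omega (pderiv i phi) by apply: L2_test => //; exact: test_fun_pderiv.
have L2N f : L2 Omega f -> L2 Omega (fun x => - f x).
  move=> [mf hf]; split; first exact: measurableT_comp.
  by under eq_fun do rewrite sqrrN.
have lz : L2 Omega z by apply: L2D => //; exact: L2N.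
have lzi : L2 Omega zi by apply: L2D => //; exact: L2N.
have iZ : intO Z by apply: intOD => //; [exact: lz.2 | exact: lzi.2].
have IZ : I[Z] <= e / (4 / e + 4).
  rewrite -lee_fin -integralE_Rintegral//; apply: le_trans (ltW happ).
  apply: ge0_le_integral => //.
  - by move=> x _; rewrite lee_fin addr_ge0 ?sqr_ge0.
  - exact: measurable_int iZ.
  - apply/measurable_EFinP; apply: measurable_funD; last exact: measurable_funX lz.1.
    apply: measurable_sum => j; apply: measurable_funX; apply: measurable_funB.
      exact: (lui j).1.
    apply: continuous_measurable_rV => //; apply: smooth_continuous.
    exact: smooth_pderiv.
  - move=> x _; rewrite lee_fin /Z addrC lerD2r (bigD1 i)//= lerDl.
    by apply: sumr_ge0 => j _; exact: sqr_ge0.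
have iqu : intO (quad_form b (db i) u (D u i)).
  apply: intO_quad_form => //;
    [exact: mult_meas hb | exact: (mult_dmeas hb)| exact: mult_bound hb|].
  by exists C2 => // x Ox; exact: hC2.
have iqp : intO (quad_form b (db i) phi (pderiv i phi)).
  apply: intO_quad_form => //;
    [exact: mult_meas hb | exact: (mult_dmeas hb)| exact: mult_bound hb|].
  by exists C2 => // x Ox; exact: hC2.
have iB : intO (fun x => C * (4 * e * N2 x + (4 / e + 4) * Z x)).
  by apply: intOZ => //; apply: intOD => //; exact: intOZ.
rewrite -[X in `|X|]subr0 -(quad_form_test i hb tphi) -RintegralB//.
apply: le_trans (le_normr_Rintegral mO _) _; first exact: (integrableB mO iqu iqp).
apply: (@le_trans _ _ (I[fun x => C * (4 * e * N2 x + (4 / e + 4) * Z x)])).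
  apply: le_Rintegral => //; first exact: (integrable_norm (integrableB mO iqu iqp)).
  by move=> x Ox; have [h1 h2] := hC x Ox; exact: quad_form_diff.
rewrite RintegralZl//; last by apply: intOD => //; exact: intOZ.
rewrite RintegralD//; try exact: intOZ.
rewrite !RintegralZl// -/E mulrCA ler_wpM2l// mulrDr mulr1 mulrA [e * 4]mulrC lerD2l.
by rewrite mulrC -ler_pdivlMr.
Qed.

Section multiplier_H10.
Variables (b : 'rV[R]_n -> R) (db : 'I_n -> 'rV[R]_n -> R).
Hypothesis hb : multiplier Omega b db.

Lemma L2_mul_grad u g i : L2 Omega u -> L2 Omega g ->
  L2 Omega (fun x => b x * g x + db i x * u x).
Proof.
move=> lu lg; apply: L2D => //; apply: L2_bmul => //.
- exact: mult_meas hb.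
- exact: mult_bound hb.
- exact: mult_dmeas hb i.
- by have [C C0 hC] := mult_dbound hb; exists C => // x Ox; exact: hC.
Qed.

Lemma L1loc_mul u : L1loc Omega u -> L1loc Omega (fun x => b x * u x).
Proof.
move=> lu; apply: L1loc_bmul => //; first exact: mult_meas hb.
by have [C _ hC] := mult_bound hb; exists C.
Qed.

Lemma weak_pderiv_mul_wgrad u i : W11loc Omega u ->
  weak_pderiv Omega i (fun x => b x * u x) (fun x => b x * D u i x + db i x * u x).
Proof. by move=> W; apply: weak_pderiv_mul => //; exact: wgradP. Qed.

Lemma H1_mul u : H1 Omega u -> H1 Omega (fun x => b x * u x).
Proof.
move=> hu; have [W _ _] := hu; have [lu lui] := H1_L2 hu.
apply: (H1_intro oO (fun i => weak_pderiv_mul_wgrad i W)).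
- by apply: L1loc_mul; case: W.
- by apply: L2_bmul => //; [exact: mult_meas hb | exact: mult_bound hb].
- by move=> i; exact: L2_mul_grad.
Qed.

Lemma H1norm2_mul u : W11loc Omega u ->
  H1norm2 Omega (fun x => b x * u x) = (\int[mu]_(x in Omega)
    (\sum_i (b x * D u i x + db i x * u x) ^+ 2 + (b x * u x) ^+ 2)%:E)%E.
Proof.
move=> W; apply: H1norm2E => //; first by move=> i; exact: weak_pderiv_mul_wgrad.
by apply: L1loc_mul; case: W.
Qed.

(** If test functions phi approach u, then the test functions b phi approach b u, since the bounds
    on b and its derivatives control the norm of b (u - phi). *)
Lemma H10_mul u : H10 Omega u -> H10 Omega (fun x => b x * u x).
Proof.
move=> hu; split; first exact: H1_mul hu.1.
move=> e e0; have [W _ _] := hu.1; have [lu lui] := H1_L2 hu.1.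
have [C1 C10 hC1] := mult_bound hb; have [C2 C20 hC2] := mult_dbound hb.
(* From (x + y)^2 <= 2 x^2 + 2 y^2 in each of the n components, plus the zero-order term; the final
   1 keeps [C] positive. *)
pose C : R := 2 * C1 ^+ 2 + 2 * n%:R * C2 ^+ 2 + C1 ^+ 2 + 1.
have C0 : 0 < C by rewrite ltr_wpDl// !addr_ge0 ?mulr_ge0 ?sqr_ge0.
have [phi tphi happ] := H10_approx oO hu (divr_gt0 e0 C0).
have [sphi _] := tphi.
exists (fun x => b x * phi x); first exact: mult_test hb _ tphi.
have -> : (fun x => b x * u x) \- (fun x => b x * phi x) = (fun x => b x * (u \- phi) x).
  by apply/funext => x /=; rewrite mulrBr.
pose z := u \- phi; pose zi i x := D u i x - pderiv i phi x.
have wz i : weak_pderiv Omega i z (zi i).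
  by apply: weak_pderiv_sub_test => //; exact: wgradP.
have lz : L1loc Omega z.
  have -> : z = (fun x => u x + -1 * phi x).
    by apply/funext => x /=; rewrite mulN1r.
  apply: L1locD; first by case: W.
  have [s' _] : test_fun Omega (fun x => -1 * phi x).
    exact: (mult_test (multiplier_cst (-1) mO)).
  by apply: L1loc_continuous => //; exact: smooth_continuous.
rewrite (H1norm2E oO (g := fun i x => b x * zi i x + db i x * z x)); last 2 first.
- by move=> i; exact: weak_pderiv_mul.
- exact: L1loc_mul.
have mz : measurable_fun Omega z by case: lz.
have mzi i : measurable_fun Omega (zi i) by case: (wz i) => _ [].
have mb := mult_meas hb; have mdb := mult_dmeas hb.
apply: (@le_lt_trans _ _ (C%:E * \int[mu]_(x in Omega) (\sum_i zi i x ^+ 2 + z x ^+ 2)%:E)%E).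
  rewrite -ge0_integralZl//; last 3 first.
  - apply/measurable_EFinP; apply: measurable_funD; last exact: measurable_funX.
    by apply: measurable_sum => i; exact: measurable_funX.
  - by move=> x _; rewrite lee_fin addr_ge0 ?sqr_ge0// sumr_ge0// => i _; exact: sqr_ge0.
  - by rewrite lee_fin ltW.
  apply: ge0_le_integral => //.
  - by move=> x _; rewrite lee_fin addr_ge0 ?sqr_ge0// sumr_ge0// => i _; exact: sqr_ge0.
  - apply/measurable_EFinP; apply: measurable_funD; last first.
      by apply: measurable_funX; exact: measurable_funM.
    apply: measurable_sum => i; apply: measurable_funX.
    by apply: measurable_funD; exact: measurable_funM.
  - apply/measurable_EFinP; apply: measurable_funM => //.
    apply: measurable_funD; last exact: measurable_funX.
    by apply: measurable_sum => i; exact: measurable_funX.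
  - move=> x Ox; rewrite -EFinM lee_fin.
    have b2 : b x ^+ 2 <= C1 ^+ 2.
      by rewrite -real_normK ?num_real// ler_pXn2r ?nnegrE// hC1.
    have d2 i : db i x ^+ 2 <= C2 ^+ 2.
      by rewrite -real_normK ?num_real// ler_pXn2r ?nnegrE// hC2.
    have z2 := sqr_ge0 (z x).
    apply: (@le_trans _ _ (\sum_i (2 * C1 ^+ 2 * zi i x ^+ 2 + 2 * C2 ^+ 2 * z x ^+ 2) +
        C1 ^+ 2 * z x ^+ 2)).
      apply: lerD; last by rewrite exprMn ler_wpM2r.
      apply: ler_sum => i _.
      apply: (@le_trans _ _ (2 * (b x ^+ 2 * zi i x ^+ 2) + 2 * (db i x ^+ 2 * z x ^+ 2))).
        rewrite -!exprMn; have := sqr_ge0 (b x * zi i x - db i x * z x).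
        by set s := b x * _; set t := db i x * _; nra.
      by apply: lerD; rewrite -[leRHS]mulrA ler_pM2l// ler_wpM2r// sqr_ge0.
    rewrite big_split/= -mulr_sumr sumr_const card_ord -[_ *+ n]mulr_natl -subr_ge0.
    have s0 : 0 <= \sum_i zi i x ^+ 2 by apply: sumr_ge0 => i _; exact: sqr_ge0.
    set S := \sum_i _ in s0 *.
    have -> : C * (S + z x ^+ 2) - (2 * C1 ^+ 2 * S + n%:R * (2 * C2 ^+ 2 * z x ^+ 2) +
        C1 ^+ 2 * z x ^+ 2) =
      (2 * (n%:R * C2 ^+ 2) + C1 ^+ 2 + 1) * S + (2 * C1 ^+ 2 + 1) * z x ^+ 2.
      by rewrite /C; ring.
    by rewrite addr_ge0// mulr_ge0// !addr_ge0// ?mulr_ge0// ?sqr_ge0.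
by rewrite -lte_pdivlMl// -EFinM [X in (_ < X%:E)%E]mulrC.
Qed.

End multiplier_H10.
End H10_calculus.

(** * The degree-2 angular function on the exterior domain *)

Section exterior_multipliers.
Context {R : realType} {n : nat}.
Variable r0 : R.
Hypothesis r0_gt0 : 0 < r0.
Local Notation e_ i := (delta_mx ord0 i : 'rV[R]_n).
Local Notation A := (ext_domain r0 : set 'rV[R]_n).

Definition sqn (x : 'rV[R]_n) : R := \sum_i x ord0 i ^+ 2.
Definition rho (x : 'rV[R]_n) : R := (sqn x)^-1.
(** Components of the gradient of log |x|, the vector field behind Hardy's inequality. *)
Definition zc (i : 'I_n) (x : 'rV[R]_n) : R := x ord0 i * rho x.
(** Squared direction cosines; they serve as weights that sum to 1 off the origin. *)
Definition pc (i : 'I_n) (x : 'rV[R]_n) : R := x ord0 i * zc i x.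

Lemma sqnE x : sqn x = enorm x ^+ 2.
Proof. by rewrite enorm_sqr. Qed.

Lemma sqn_gt x : A x -> r0 ^+ 2 < sqn x.
Proof.
move=> Ax; rewrite sqnE ltr_pXn2r// nnegrE; first exact: ltW.
exact: sqrtr_ge0.
Qed.

Lemma sqn_gt0 x : A x -> 0 < sqn x.
Proof. by move=> /sqn_gt; apply: lt_trans; rewrite exprn_gt0. Qed.

Lemma sqn_neq0 x : A x -> sqn x != 0.
Proof. by move=> /sqn_gt0; rewrite lt0r => /andP[]. Qed.

Lemma smooth_sqn : smooth sqn.
Proof.
move=> k; apply: of_class_sum => i; under eq_fun do rewrite expr2.
apply: of_classM; exact: of_class_coord.
Qed.

Lemma open_ext_domain : open A.
Proof.
suff -> : A = sqn @^-1` [set t | r0 ^+ 2 < t].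
  apply: open_comp; last exact: open_gt.
  by move=> x _; exact: smooth_continuous smooth_sqn x.
apply/seteqP; split=> x; first exact: sqn_gt.
move=> /= h; rewrite /ext_domain/=; move: h; rewrite sqnE ltr_pXn2r// nnegrE.
  exact: ltW.
exact: sqrtr_ge0.
Qed.

Let mA : measurable A := open_measurable_rV open_ext_domain.

Lemma is_derive_sqn i x : is_derive x (e_ i) sqn (2 * x ord0 i).
Proof.
have h j : is_derive x (e_ i) (fun y => y ord0 j ^+ 2) ((j == i)%:R * (2 * x ord0 j)).
  apply: (@is_derive_coord _ _ j i (fun t => t ^+ 2)).
  have := is_deriveX 2 (is_derive_id (x ord0 j) (1 : R)).
  by rewrite exprfctE => hX; apply: (is_derive_eq hX); rewrite /GRing.scale/= expr1 mulr1.
have -> : 2 * x ord0 i = \sum_j (j == i)%:R * (2 * x ord0 j).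
  rewrite (bigD1 i)//= eqxx mul1r big1 ?addr0// => j ji.
  by rewrite (negbTE ji) mul0r.
rewrite /sqn; elim: (index_enum _) => [|j s IH].
  rewrite big_nil; have -> : (fun x0 : 'rV[R]_n => \sum_(i0 <- [::]) x0 ord0 i0 ^+ 2) = fun=> 0.
    by apply/funext => y; rewrite big_nil.
  exact: is_derive_cst.
rewrite big_cons; under eq_fun do rewrite big_cons; exact: is_derive_add.
Qed.

Lemma is_derive_rho i x : sqn x != 0 -> is_derive x (e_ i) rho (- 2 * zc i x * rho x).
Proof.
move=> x0; have [d1 d2] := is_derive_sqn i x.
split; first exact: derivableV.
rewrite (deriveV x0 d1) d2 /GRing.scale/= /zc /rho.
by rewrite expr2 invfM; ring.
Qed.

Section rho_test.
Variable K : set 'rV[R]_n.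
Hypotheses (clK : closed K) (K0 : forall x, K x -> sqn x != 0).

(** The singularity of [rho] is off the closed set [K], so f vanishes near it. Elsewhere d_i (rho f)
    = rho d_i f - 2 x_i rho (rho f), where both terms are again [rho] times a function vanishing off
    [K], so the induction closes. *)
Lemma of_class_rho k f : of_class_C k f -> (forall x, ~ K x -> f x = 0) ->
  of_class_C k (fun x => rho x * f x).
Proof.
elim: k f => [|k IH] f hf f0.
  move=> x; have [x0|x0] := eqVneq (sqn x) 0.
    have Kx : ~ K x by move=> /K0; rewrite x0 eqxx.
    have hK y : ~ K y -> rho y * f y = 0 by move=> Ky; rewrite f0// mulr0.
    rewrite /continuous_at hK//.
    have : (fun _ : 'rV[R]_n => 0 : R) @ x --> (0 : R) by exact: (@cst_continuous _ _ (0 : R) x).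
    apply: cvg_trans; apply: near_eq_cvg; first exact: (@nbhs_filter _ x).
    by apply: filterS (near_vanishing clK hK Kx) => y.
  apply: (continuousM (s := rho) (t := f)); last exact: hf.
  by apply: cvgV => //; first exact: (@nbhs_filter _ x); exact: smooth_continuous smooth_sqn x.
have hrf : of_class_C k (fun x => rho x * f x) by apply: IH => //; exact: of_classW.
apply: (of_classS (d := fun i x => rho x * pderiv i f x +
   rho x * ((- 2 * x ord0 i) * (rho x * f x)))).
- move=> i x; have [x0|x0] := eqVneq (sqn x) 0.
    have Kx : ~ K x by move=> /K0; rewrite x0 eqxx.
    rewrite (pderiv_vanishing _ clK f0 Kx) f0// !mulr0 addr0.
    apply: (near_eq_is_derive (f := fun _ => 0 : R)).
    by apply: near_vanishing clK _ Kx => y Ky; rewrite f0// mulr0.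
  have := is_derive_mul (is_derive_rho i x0) (of_class_is_derive i x hf).
  by move=> h; apply: (is_derive_eq h); rewrite /zc; ring.
- exact: of_class_continuous hrf.
- move=> i; apply: of_classD; apply: IH.
  + exact: of_class_pderiv.
  + by move=> x Kx; rewrite (pderiv_vanishing _ clK f0 Kx).
  + apply: of_classM => //; apply: of_classM; first exact: of_class_cst.
    exact: of_class_coord.
  + by move=> x Kx; rewrite f0// !mulr0.
Qed.

End rho_test.

Lemma test_fun_rho phi : test_fun A phi -> test_fun A (fun x => rho x * phi x).
Proof.
move=> [sphi [K [cK KA phi0]]]; split.
  move=> k; apply: (@of_class_rho K) => //; first exact: compact_rV_closed.
  by move=> x /KA; exact: sqn_neq0.
by exists K; split => // x Kx; rewrite phi0// mulr0.
Qed.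

Lemma measurable_sqn (D : set 'rV[R]_n) : measurable D -> measurable_fun D sqn.
Proof.
by move=> mD; apply: continuous_measurable_rV => //; exact: smooth_continuous smooth_sqn.
Qed.

Lemma measurable_rho (D : set 'rV[R]_n) : measurable D -> measurable_fun D rho.
Proof.
(* Real powers are measurable on the whole line, so the singularity needs no separate treatment. *)
move=> mD; have -> : rho = (fun x => sqn x `^ (-1)).
  by apply/funext => x; rewrite powR_inv1// sumr_ge0// => i _; exact: sqr_ge0.
apply: (@measurableT_comp _ _ _ _ _ _ (fun t : R => t `^ (-1))); first exact: measurable_powR.
exact: measurable_sqn.
Qed.

Lemma measurable_zc i (D : set 'rV[R]_n) : measurable D -> measurable_fun D (zc i).
Proof.
by move=> mD; apply: measurable_funM; [exact: measurable_rV_coord | exact: measurable_rho].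
Qed.

Lemma measurable_pc i (D : set 'rV[R]_n) : measurable D -> measurable_fun D (pc i).
Proof.
by move=> mD; apply: measurable_funM; [exact: measurable_rV_coord | exact: measurable_zc].
Qed.

Lemma rho_ge0 x : 0 <= rho x.
Proof. by rewrite invr_ge0 sumr_ge0// => i _; exact: sqr_ge0. Qed.

Lemma rho_le x : A x -> rho x <= r0 ^- 2.
Proof. by move=> Ax; rewrite lef_pV2 ?posrE ?exprn_gt0 ?sqn_gt0// ltW// sqn_gt. Qed.

Lemma rho_lt x : A x -> rho x < r0 ^- 2.
Proof. by move=> Ax; rewrite ltf_pV2 ?posrE ?exprn_gt0 ?sqn_gt0// sqn_gt. Qed.

Lemma pc_sum x : A x -> \sum_i pc i x = 1.
Proof.
move=> Ax; under eq_bigr do rewrite /pc /zc mulrA -expr2.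
by rewrite -mulr_suml divff// sqn_neq0.
Qed.

Lemma pc_ge0 i x : 0 <= pc i x.
Proof. by rewrite /pc /zc mulrA -expr2 mulr_ge0 ?sqr_ge0 ?rho_ge0. Qed.

Lemma pc_le1 i x : A x -> pc i x <= 1.
Proof.
move=> Ax; rewrite -(pc_sum Ax) (bigD1 i)//= lerDl sumr_ge0// => j _; exact: pc_ge0.
Qed.

Lemma zc_sqr i x : zc i x ^+ 2 = pc i x * rho x.
Proof. by rewrite /pc /zc; ring. Qed.

Lemma zc_le i x : A x -> `|zc i x| <= r0^-1.
Proof.
move=> Ax; rewrite -(@ler_pXn2r _ 2)// ?nnegrE ?invr_ge0 ?(ltW r0_gt0)//.
rewrite real_normK ?num_real// zc_sqr exprVn (le_trans _ (rho_le Ax))//.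
by rewrite ler_piMl ?rho_ge0 ?pc_le1.
Qed.

Lemma multiplier_rho : multiplier A rho (fun i x => - 2 * zc i x * rho x).
Proof.
have i2 : 0 <= r0 ^- 2 by rewrite invr_ge0 exprn_ge0// ltW.
split.
- exact: test_fun_rho.
- by move=> i x Ax; apply: is_derive_rho; exact: sqn_neq0.
- exact: measurable_rho.
- move=> i; apply: measurable_funM; last exact: measurable_rho.
  by apply: measurable_funM => //; exact: measurable_zc.
- by exists (r0 ^- 2) => // x Ax; rewrite ger0_norm ?rho_ge0 ?rho_le.
- exists (2 * r0^-1 * r0 ^- 2); first by rewrite !mulr_ge0// invr_ge0 ltW.
  move=> i x Ax.
  rewrite normrM (normrM (- 2)) normrN (@ger0_norm _ 2)// (ger0_norm (rho_ge0 _)).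
  by apply: ler_pM; rewrite ?mulr_ge0 ?rho_ge0 ?rho_le ?ler_wpM2l ?zc_le.
Qed.

(** [multiplierM] does not apply to the two factors of [zc i], because the coordinate is unbounded
    on [A]. The bounds are taken on the product, from zc_i^2 = pc_i rho; the same holds for
    [multiplier_pc]. *)
Lemma multiplier_zc i :
  multiplier A (zc i) (fun j x => (i == j)%:R * rho x - 2 * (zc i x * zc j x)).
Proof.
have i2 : 0 <= r0 ^- 2 by rewrite invr_ge0 exprn_ge0// ltW.
have i1 : 0 <= r0^-1 by rewrite invr_ge0 ltW.
split.
- move=> phi /test_fun_rho [s1 [K [cK KA phi0]]]; split.
    have -> : (fun x => zc i x * phi x) = (fun x => x ord0 i * (rho x * phi x)).
      by apply/funext => x; rewrite /zc mulrA.
    by apply: smoothM => // k; exact: of_class_coord.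
  by exists K; split => // x Kx; rewrite /zc -mulrA phi0// mulr0.
- move=> j x Ax.
  have := is_derive_mul (is_derive_coord j (is_derive_id (x ord0 i) (1:R)))
    (is_derive_rho j (sqn_neq0 Ax)).
  by move=> h; apply: (is_derive_eq h); rewrite /zc; ring.
- exact: measurable_zc.
- move=> j; apply: measurable_funB; first by apply: measurable_funM => //; exact: measurable_rho.
  by apply: measurable_funM => //; apply: measurable_funM; exact: measurable_zc.
- by exists r0^-1 => // x Ax; exact: zc_le.
- exists (r0 ^- 2 + 2 * (r0^-1 * r0^-1)); first by rewrite addr_ge0// !mulr_ge0.
  move=> j x Ax; apply: le_trans (ler_normB _ _) _; apply: lerD.
    by case: eqP => _; rewrite ?mul1r ?mul0r ?normr0// (ger0_norm (rho_ge0 _)) rho_le.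
  by rewrite (normrM 2) (normrM (zc i x)) (@ger0_norm _ 2)// ler_pM2l// ler_pM ?zc_le.
Qed.

Lemma multiplier_pc i :
  multiplier A (pc i) (fun j x => 2 * ((i == j)%:R * zc i x) - 2 * (pc i x * zc j x)).
Proof.
have i1 : 0 <= r0^-1 by rewrite invr_ge0 ltW.
have [t _ _ _ _ _] := multiplier_zc i.
split.
- move=> phi /t [s1 [K [cK KA phi0]]]; split.
    have -> : (fun x => pc i x * phi x) = (fun x => x ord0 i * (zc i x * phi x)).
      by apply/funext => x; rewrite /pc mulrA.
    by apply: smoothM => // k; exact: of_class_coord.
  by exists K; split => // x Kx; rewrite /pc -mulrA phi0// mulr0.
- move=> j x Ax.
  have := is_derive_mul (is_derive_coord j (is_derive_id (x ord0 i) (1:R)))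
    (mult_derive (multiplier_zc i) j Ax).
  by move=> h; apply: (is_derive_eq h); rewrite /pc /zc; ring.
- exact: measurable_pc.
- move=> j; apply: measurable_funB; apply: measurable_funM => //.
    by apply: measurable_funM => //; exact: measurable_zc.
  by apply: measurable_funM; [exact: measurable_pc | exact: measurable_zc].
- by exists 1 => // x Ax; rewrite ger0_norm ?pc_ge0 ?pc_le1.
- exists (2 * r0^-1 + 2 * r0^-1); first by rewrite addr_ge0// mulr_ge0.
  move=> j x Ax; apply: le_trans (ler_normB _ _) _; apply: lerD;
    rewrite (normrM 2) (@ger0_norm _ 2)// ler_pM2l//.
    by case: eqP => _; rewrite ?mul1r ?zc_le// mul0r normr0.
  by rewrite (normrM (pc i x)) -[leRHS]mul1r ler_pM ?zc_le// ger0_norm ?pc_ge0 ?pc_le1.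
Qed.

Section angular_function.
Variable c : 'I_n -> R.

Definition ang (x : 'rV[R]_n) : R := \sum_i c i * pc i x.

Lemma multiplier_ang : multiplier A ang (fun j x => 2 * zc j x * (c j - ang x)).
Proof.
have := multiplier_sum (index_enum 'I_n) mA
  (fun i => multiplierM (multiplier_cst (c i) mA) (multiplier_pc i)).
apply: multiplier_ext => // j x Ax.
under eq_bigr do rewrite mulr0 addr0 mulrBr.
rewrite sumrB /ang mulrBr; congr (_ - _).
  rewrite (bigD1 j)//= eqxx mul1r big1 ?addr0; first by ring.
  by move=> i /negbTE ->; rewrite mul0r !mulr0.
by rewrite mulr_sumr; apply: eq_bigr => i _; ring.
Qed.

Variables (al be : R).

(** Two parameters, to cover both the perturbation t (1 + s phi), with al = t and be = t s, and the
    unperturbed case al = 1, be = 0. *)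
Definition Phi x := al + be * ang x.

Definition dPhi i x := be * (2 * zc i x * (c i - ang x)).

Lemma multiplier_Phi : multiplier A Phi dPhi.
Proof.
have := multiplierD (multiplier_cst al mA) (multiplierM (multiplier_cst be mA) multiplier_ang).
by apply: multiplier_ext => // i x Ax; rewrite mulr0 addr0 add0r.
Qed.

(** Only the diagonal second derivative is made explicit, since only the sum of these, the Laplacian
    of [Phi], enters the norm. *)
Lemma multiplier_dPhi i : exists2 d, multiplier A (dPhi i) d &
  forall x, A x -> d i x = be * (2 * ((c i - ang x) * (rho x - 4 * zc i x ^+ 2))).
Proof.
have m1 := multiplierD (multiplier_cst (c i) mA)
  (multiplierM (multiplier_cst (-1) mA) multiplier_ang).
have m2 := multiplierM (multiplier_cst 2 mA) (multiplier_zc i).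
have m3 := multiplierM (multiplier_cst be mA) (multiplierM m2 m1).
eexists; first by apply: (multiplier_ext _ _ mA m3) => [x|j x _];
  [rewrite /dPhi mulN1r | reflexivity].
by move=> x Ax; rewrite /= eqxx (_ : true%:R = 1 :> R)//; ring.
Qed.

End angular_function.

End exterior_multipliers.

(** * Rotations and moments *)

Section rotation_invariance.
Context {R : realType} {n : nat}.
Variable r0 : R.
Hypothesis r0_gt0 : 0 < r0.
Local Notation mu := (@lebesgue_rV R n).
Local Notation e_ i := (delta_mx ord0 i : 'rV[R]_n).
Local Notation A := (ext_domain r0 : set 'rV[R]_n).
Let oA : open A := open_ext_domain r0_gt0.
Let mA : measurable A := open_measurable_rV oA.
Local Notation "'I[' f ]" := (Rintegral mu A f) (format "'I[' f ]").
Local Notation intA f := (mu.-integrable A (EFin \o f)).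
Implicit Types (u f F G : 'rV[R]_n -> R).

Lemma Rintegral_sum (I : Type) (r : seq I) (f : I -> 'rV[R]_n -> R) :
  (forall i, intA (f i)) -> I[fun x => \sum_(i <- r) f i x] = \sum_(i <- r) I[f i].
Proof.
move=> hf; elim: r => [|i r IH].
  rewrite big_nil; under eq_Rintegral do rewrite big_nil.
  by rewrite Rintegral_cst// mul0r.
rewrite big_cons -IH -RintegralD//; last exact: intO_sum.
by apply: eq_Rintegral => x _; rewrite big_cons.
Qed.

Lemma dotp_delta k (v : 'rV[R]_n) : dotp (e_ k) v = v ord0 k.
Proof.
rewrite /dotp (bigD1 k)//= big1 => [|l lk]; first by rewrite mxE !eqxx mul1r addr0.
by rewrite mxE eqxx (negbTE lk) mul0r.
Qed.

(** * Effect of a plane rotation on integrals and weak gradients *)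

Section rotation.
Variables (i j : 'I_n) (c s : R).
Hypotheses (ij : i != j) (s0 : s != 0) (cs : c ^+ 2 + s ^+ 2 = 1).
Local Notation T := (rV_rot i j c s).
Local Notation S := (rV_rot i j c (- s)).

Let mpT : mpreserving mu T.
Proof. exact: lebesgue_rV_rot. Qed.

Let TK : cancel T S.
Proof. exact: rV_rotK. Qed.

Let SK : cancel S T.
Proof.
by move=> x; have := @rV_rotK R n i j c (- s) ij; rewrite sqrrN opprK; apply.
Qed.

Lemma rV_linear_rot (c' s' : R) : rV_linear (rV_rot i j c' s').
Proof.
split.
  move=> h y x; apply: rV_eq => k; rewrite !mxE.
  by case: eqP => _; [ring | case: eqP => _ //; ring].
apply: continuous_rV => k; under eq_fun do rewrite mxE.
have sk l (a : R) : smooth (fun x : 'rV[R]_n => a * x ord0 l).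
  by move=> m; apply: of_classM; [exact: of_class_cst | exact: of_class_coord].
case: (k == i); last case: (k == j); last exact: continuous_coord.
  by apply: smooth_continuous => m; under eq_fun do rewrite -mulNr; apply: of_classD; exact: sk.
by apply: smooth_continuous => m; apply: of_classD; exact: sk.
Qed.

Lemma dotp_rot x y : dotp (T x) y = dotp x (S y).
Proof.
rewrite /dotp (bigD1 i)// (bigD1 j) 1?eq_sym//= [RHS](bigD1 i)// [in RHS](bigD1 j) 1?eq_sym//=.
rewrite !addrA; congr (_ + _); last first.
  by apply: eq_bigr => k /andP[ki kj]; rewrite !mxE (negbTE ki) (negbTE kj).
by rewrite !mxE eqxx (eq_sym j) (negbTE ij) eqxx; ring.
Qed.

Lemma enorm_rot x : enorm (T x) = enorm x.
Proof. exact: enorm_rV_rot. Qed.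

Lemma enorm_rotN x : enorm (S x) = enorm x.
Proof. by rewrite enorm_rV_rot// sqrrN. Qed.

Lemma preimage_rot_A : T @^-1` A = A.
Proof. by apply/seteqP; split => x; rewrite /ext_domain/= enorm_rot. Qed.

Lemma rot_A x : A (T x) <-> A x.
Proof. by rewrite /ext_domain/= enorm_rot. Qed.

Lemma ae_in_rot (P : 'rV[R]_n -> Prop) : ae_in A P -> ae_in A (P \o T).
Proof.
move=> [N [mN N0 PN]]; exists (T @^-1` N); split.
- by rewrite -[X in measurable X]setTI; apply: mpT.1.
- by rewrite -N0; exact: mpT.2.
- by move=> x /= h; apply: PN => /= h2; apply: h => Ax; apply: h2; exact/rot_A.
Qed.

Lemma integral_rot (F : 'rV[R]_n -> \bar R) : measurable_fun A F ->
  (\int[mu]_(x in A) F (T x) = \int[mu]_(x in A) F x)%E.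
Proof. by move=> mF; rewrite -[RHS](integral_mpreserving mpT)// preimage_rot_A. Qed.

Lemma measurable_rot f : measurable_fun A f -> measurable_fun A (f \o T).
Proof.
move=> mf; apply: (measurable_comp mA) => //; first by move=> _ [x Ax <-]; exact/rot_A.
by apply: (measurable_funS measurableT) => //; exact: mpT.1.
Qed.

Lemma L1loc_rot f : L1loc A f -> L1loc A (f \o T).
Proof.
move=> [mf hf]; split; first exact: measurable_rot.
move=> K cK KA; pose TK' := T @` K.
have cTK : compact TK'.
  by apply: continuous_compact => //; apply: continuous_subspaceT; exact: (rV_linear_rot _ _).2.
have TKA : TK' `<=` A by move=> _ [x Kx <-]; apply/rot_A; exact: KA.
have := integrable_mpreserving mpT (compact_measurable_rV cTK) (hf _ cTK TKA).
suff -> : T @^-1` TK' = K by [].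
apply/seteqP; split => [x [y Ky /(can_inj TK) <-//]|x Kx]; by exists x.
Qed.

Lemma radial_rot u : radial A u -> ae_in A (fun x => u (T x) = u x).
Proof.
move=> [g hg]; apply: ae_inS2 hg (ae_in_rot hg) => x Ax -> /= ->.
by rewrite enorm_rot.
Qed.

Lemma test_fun_rot phi : test_fun A phi -> test_fun A (phi \o S).
Proof.
move=> [sphi [K [cK KA phi0]]]; split.
  by move=> k; apply: of_class_comp_linear; [exact: rV_linear_rot | exact: sphi].
exists (T @` K); split.
- by apply: continuous_compact => //; apply: continuous_subspaceT; exact: (rV_linear_rot _ _).2.
- by move=> _ [x Kx <-]; apply/rot_A; exact: KA.
- by move=> x h /=; apply: phi0 => Kx; apply: h; exists (S x).
Qed.

(** [S] sends T e_k back to e_k, so the left side is the derivative of phi o S along T e_k, which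
    expands in partial derivatives by [is_derive_C1]. *)
Lemma pderiv_rot phi k y : smooth phi ->
  pderiv k phi (S y) = \sum_l T (e_ k) ord0 l * pderiv l (phi \o S) y.
Proof.
move=> sphi.
have h1 : is_derive y (T (e_ k)) (phi \o S) (pderiv k phi (S y)).
  apply: is_derive_comp_linear; first exact: rV_linear_rot.
  by rewrite TK; exact: smooth_is_derive.
have h2 : is_derive y (T (e_ k)) (phi \o S) (\sum_l T (e_ k) ord0 l * pderiv l (phi \o S) y).
  apply: is_derive_C1; apply: of_class_comp_linear; [exact: rV_linear_rot | exact: sphi].
by case: h1 => _ <-; case: h2 => _ <-.
Qed.

(** Invariance of u and of the measure moves the rotation onto the test function; the gradient read
    at T x and rotated back is then again a weak gradient of u. *)
Lemma weak_pderiv_rot u g k : (forall l, weak_pderiv A l u (g l)) -> L1loc A u ->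
  ae_in A (fun x => u (T x) = u x) ->
  weak_pderiv A k u (fun x => \sum_l T (e_ k) ord0 l * g l (T x)).
Proof.
move=> hg lu uT.
have lg l : L1loc A (g l) by case: (hg l).
have L1Z a f : L1loc A f -> L1loc A (fun x => a * f x).
  by move=> lf; apply: L1loc_bmul => //; exists `|a|.
have lG : L1loc A (fun x => \sum_l T (e_ k) ord0 l * g l x).
  elim: (index_enum _) => [|l r IH].
    under eq_fun do rewrite big_nil; apply: L1loc_continuous => // x.
    exact: cst_continuous.
  by under eq_fun do rewrite big_cons; apply: L1locD => //; exact: L1Z.
apply/weak_pderivP => //; first exact: (L1loc_rot lG).
move=> phi tphi; have [sphi [K [cK KA phi0]]] := tphi.
have tpS := test_fun_rot tphi; have [spS _] := tpS.
have ipd l := L1loc_integrable_test_pderiv l mA lu tpS.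
have ig l := L1loc_integrable_test mA (lg l) tpS.
have rotR f : measurable_fun A f -> I[f \o T] = I[f].
  by move=> mf; rewrite /Rintegral -(integral_rot (F := EFin \o f))//; exact/measurable_EFinP.
have mpd : measurable_fun A (pderiv k phi).
  by apply: continuous_measurable_rV => //; apply: smooth_continuous; exact: smooth_pderiv.
have mpdS : measurable_fun A (pderiv k phi \o S).
  apply: continuous_measurable_rV => // x; apply: continuous_comp.
    exact: (rV_linear_rot _ _).2.
  by apply: smooth_continuous; exact: smooth_pderiv.
have mu_ : measurable_fun A u by case: lu.
transitivity (I[(fun y => u y * pderiv k phi (S y)) \o T]).
  rewrite /Rintegral; congr fine; apply: ae_eq_integral => //.
  - by apply/measurable_EFinP; exact: measurable_funM.
  - apply/measurable_EFinP; apply: (@measurable_rot (fun y => u y * pderiv k phi (S y))).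
    exact: measurable_funM.
  - by apply: ae_inS uT => x Ax /= ->; rewrite TK.
rewrite rotR; last exact: measurable_funM.
transitivity (\sum_l T (e_ k) ord0 l * I[fun y => u y * pderiv l (phi \o S) y]).
  under [RHS]eq_bigr do rewrite -RintegralZl//.
  rewrite -Rintegral_sum; last by move=> l; exact: intOZ.
  apply: eq_Rintegral => y _; rewrite pderiv_rot// mulr_sumr.
  by apply: eq_bigr => l _; rewrite mulrCA.
transitivity (- I[(fun y => (\sum_l T (e_ k) ord0 l * g l y) * phi (S y))]).
  transitivity (- \sum_l T (e_ k) ord0 l * I[fun y => g l y * (phi \o S) y]).
    rewrite -sumrN; apply: eq_bigr => l _; rewrite -mulrN; congr (_ * _).
    by have /weak_pderivP := hg l; apply.
  congr (- _); under eq_bigr do rewrite -RintegralZl//.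
  rewrite -Rintegral_sum; last by move=> l; exact: intOZ.
  apply: eq_Rintegral => y _; rewrite mulr_suml.
  by apply: eq_bigr => l _; rewrite mulrA.
congr (- _); rewrite -rotR; last first.
  apply: measurable_funM; first by case: lG.
  by apply: continuous_measurable_rV => //; exact: smooth_continuous.
by apply: eq_Rintegral => x _ /=; rewrite TK.
Qed.

(** The rotated gradient and the chosen one are weak gradients of the same function, hence equal
    almost everywhere, and rotations preserve the Euclidean norm. *)
Lemma wgrad_rot u : W11loc A u -> ae_in A (fun x => u (T x) = u x) ->
  ae_in A (fun x => enorm (wgrad A u (T x)) = enorm (wgrad A u x)).
Proof.
move=> W uT; have lu : L1loc A u by case: W.
have := has_wgrad_ae oA (fun k => weak_pderiv_rot k (wgradP W) lu uT) lu.
apply: ae_inS => x Ax h; rewrite -[LHS]enorm_rotN; congr enorm.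
apply: rV_eq => k; rewrite h.
by rewrite -dotp_delta -dotp_rot.
Qed.

End rotation.

(** The exceptional null set may depend on the rotation. The condition s != 0 comes from the shear
    decomposition and admits the angles pi / 2 and pi / 4 on which the moments rely. *)
Definition rot_invariant F := forall (i j : 'I_n) (c s : R), i != j -> s != 0 ->
  c ^+ 2 + s ^+ 2 = 1 -> ae_in A (fun x => F (rV_rot i j c s x) = F x).

(** * Moments of the squared direction cosines *)

Section moments.
Variable F : 'rV[R]_n -> R.
Hypotheses (iF : intA F) (rF : rot_invariant F).

Let mF : measurable_fun A F.
Proof. by apply/measurable_EFinP; exact: measurable_int iF. Qed.

Lemma rot_moment (G : 'rV[R]_n -> R) (i j : 'I_n) (c s : R) : measurable_fun A G ->
  i != j -> s != 0 -> c ^+ 2 + s ^+ 2 = 1 ->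
  I[fun x => F x * G (rV_rot i j c s x)] = I[fun x => F x * G x].
Proof.
move=> mG ij s0 cs; rewrite /Rintegral; congr fine.
rewrite -[RHS](integral_rot ij s0 cs)/=; last first.
  by apply/measurable_EFinP; exact: measurable_funM.
have mGT := measurable_rot ij s0 cs mG; have mFT := measurable_rot ij s0 cs mF.
apply: ae_eq_integral => //.
- by apply/measurable_EFinP; exact: measurable_funM.
- by apply/measurable_EFinP; exact: measurable_funM.
- by apply: ae_inS (rF ij s0 cs) => x Ax /= ->.
Qed.

Lemma sqn_rot (i j : 'I_n) (c s : R) x : i != j -> c ^+ 2 + s ^+ 2 = 1 ->
  sqn (rV_rot i j c s x) = sqn x.
Proof. by move=> ij cs; rewrite !sqnE enorm_rV_rot. Qed.

Lemma intA_bmul G : measurable_fun A G ->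
  (exists2 C, 0 <= C & forall x, A x -> `|G x| <= C) -> intA (fun x => F x * G x).
Proof.
move=> mG bG; under eq_fun do rewrite mulrC; exact: intO_bmul.
Qed.

Let bpc i : exists2 C : R, 0 <= C & forall x, A x -> `|pc i x| <= C.
Proof. exact: mult_bound (multiplier_pc r0_gt0 i). Qed.

Let mpc i : measurable_fun A (pc i).
Proof. exact: measurable_pc. Qed.

Let c11 : (0 : R) ^+ 2 + 1 ^+ 2 = 1.
Proof. by rewrite expr0n expr1n add0r. Qed.

(** A quarter turn in the plane of the axes i and j exchanges x_i^2 with x_j^2 and keeps |x|. *)
Lemma first_moment i j : I[fun x => F x * pc i x] = I[fun x => F x * pc j x].
Proof.
have [->//|ij] := eqVneq i j.
rewrite -(rot_moment (mpc j) ij (oner_neq0 _) c11).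
apply: eq_Rintegral => x _; congr (_ * _).
rewrite /pc /zc /rho sqn_rot// !mxE eqxx eq_sym (negbTE ij).
by rewrite mul0r addr0 mul1r.
Qed.

(* Rotation by pi / 2 in the plane of the axes i and j. *)
Lemma second_moment i j :
  I[fun x => F x * (pc i x * pc i x)] = I[fun x => F x * (pc j x * pc j x)].
Proof.
have [->//|ij] := eqVneq i j.
rewrite -[RHS](rot_moment _ ij (oner_neq0 _) c11); last exact: measurable_funM.
apply: eq_Rintegral => x _; congr (_ * _).
rewrite /pc /zc /rho sqn_rot// !mxE eqxx eq_sym (negbTE ij).
by rewrite mul0r addr0 mul1r.
Qed.

Let intpp i j : intA (fun x => F x * (pc i x * pc j x)).
Proof.
apply: intA_bmul; first exact: measurable_funM.
by exists 1 => // x Ax; rewrite normrM !ger0_norm ?pc_ge0// mulr_ile1 ?pc_ge0 ?(pc_le1 r0_gt0).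
Qed.

(* Rotation by pi / 4 turns pc i * pc j into (pc i - pc j)^2 / 4. *)
Lemma mixed_moment i j : i != j ->
  3 * I[fun x => F x * (pc i x * pc j x)] = I[fun x => F x * (pc i x * pc i x)].
Proof.
move=> ij; pose c : R := (Num.sqrt 2)^-1.
have c2 : c ^+ 2 = 2^-1 by rewrite exprVn sqr_sqrtr.
have c0 : c != 0 by rewrite invr_neq0// sqrtr_eq0 -ltNge.
have cc : c ^+ 2 + c ^+ 2 = 1 by rewrite c2 -[X in X + _]mul1r -[X in _ + X]mul1r -splitr.
have e1 := rot_moment (measurable_funM (mpc i) (mpc j)) ij c0 cc.
have e2 : I[fun x => F x * (pc i (rV_rot i j c c x) * pc j (rV_rot i j c c x))] =
    I[fun x => 4^-1 * (F x * (pc i x * pc i x) + F x * (pc j x * pc j x) -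
               2 * (F x * (pc i x * pc j x)))].
  apply: eq_Rintegral => x _.
  rewrite /pc /zc /rho sqn_rot// !mxE eqxx [j == i]eq_sym (negbTE ij) eqxx.
  set r := (sqn x)^-1; set a := x ord0 i; set b := x ord0 j.
  transitivity (F x * ((c ^+ 2) ^+ 2 * (a ^+ 2 - b ^+ 2) ^+ 2 * r ^+ 2)); first by ring.
  by rewrite c2; field.
have h1 := intOD oA (intpp i i) (intpp j j).
have h2 := intOZ oA 2 (intpp i j).
have h3 := integrableB mA h1 h2.
rewrite e2 (RintegralZl _ mA h3) (RintegralB mA h1 h2) in e1.
rewrite (RintegralD mA (intpp i i) (intpp j j)) in e1.
rewrite (RintegralZl _ mA (intpp i j)) in e1.
(* With M_ij the moment of pc_i pc_j, this reads 4 M_ij = M_ii + M_jj - 2 M_ij, where M_ii =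
   M_jj. *)
move: e1; rewrite -(second_moment i j); lra.
Qed.

Variable cf : 'I_n -> R.
Hypothesis cf0 : \sum_i cf i = 0.

Lemma integral_ang : I[fun x => F x * ang cf x] = 0.
Proof.
have ip i : intA (fun x => F x * pc i x) by exact: intA_bmul.
transitivity (\sum_i cf i * I[fun x => F x * pc i x]).
  under [RHS]eq_bigr do rewrite -RintegralZl//.
  rewrite -Rintegral_sum; last by move=> i; exact: intOZ.
  apply: eq_Rintegral => x _; rewrite /ang mulr_sumr.
  by apply: eq_bigr => i _; rewrite mulrCA.
case: (pickP 'I_n) => [i0 _|n0]; last by rewrite big1// => i; have := n0 i.
under eq_bigr do rewrite (first_moment _ i0).
by rewrite -mulr_suml cf0 mul0r.
Qed.

(* The mean of [ang cf ^+ 2] on the sphere when the coefficients sum to 0. *)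
Definition kappa : R := 2 * (\sum_i cf i ^+ 2) / (n%:R * (n%:R + 2)).

(** Diagonal second moments all equal M and off-diagonal ones M / 3, so only the trace and the full
    sum of [d] matter. *)
Lemma integral_double_sum (d : 'I_n -> 'I_n -> R) (M : R) (i0 : 'I_n) :
  M = I[fun x => F x * (pc i0 x * pc i0 x)] ->
  I[fun x => F x * \sum_i \sum_j d i j * (pc i x * pc j x)] =
  M / 3 * (2 * (\sum_i d i i) + \sum_i \sum_j d i j).
Proof.
move=> ->; set M0 := I[fun x => F x * (pc i0 x * pc i0 x)].
transitivity (\sum_i \sum_j d i j * I[fun x => F x * (pc i x * pc j x)]).
  under [RHS]eq_bigr do under eq_bigr do rewrite -RintegralZl//.
  under [RHS]eq_bigr => i _.
    rewrite -Rintegral_sum; last by move=> j; exact: intOZ.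
    over.
  rewrite -Rintegral_sum; last by move=> i; apply: intO_sum => // j; exact: intOZ.
  apply: eq_Rintegral => x _; rewrite mulr_sumr; apply: eq_bigr => i _.
  by rewrite mulr_sumr; apply: eq_bigr => j _; rewrite mulrCA.
rewrite mulrDr mulrA mulr_sumr [X in _ + X]mulr_sumr -big_split/=.
apply: eq_bigr => i _; rewrite mulr_sumr (bigD1 i)//= [in RHS](bigD1 i)//=.
have -> : I[fun x => F x * (pc i x * pc i x)] = M0 by exact: second_moment.
rewrite addrA; congr (_ + _); first by field.
apply: eq_bigr => j ji; rewrite mulrC; congr (_ * _).
rewrite eq_sym in ji; have := mixed_moment ji.
rewrite (second_moment i i0) -/M0 => <-; by field.
Qed.

Lemma integral_ang_sqr : I[fun x => F x * ang cf x ^+ 2] = kappa * I[F].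
Proof.
case: (pickP 'I_n) => [i0 _|n0]; last first.
  rewrite /kappa big_pred0// mulr0 !mul0r; under eq_Rintegral.
    by move=> x _; rewrite /ang big_pred0// expr0n mulr0; over.
  by rewrite Rintegral_cst// mul0r.
set M := I[fun x => F x * (pc i0 x * pc i0 x)].
have n1 : (0 < n)%N by rewrite (leq_ltn_trans _ (ltn_ord i0)).
(* Taking all d_ij = 1 recovers the integral of F, as the squared direction cosines sum to 1; this
   ties the unknown moment M to that integral. *)
have -> : I[F] = M / 3 * (n%:R * (n%:R + 2)).
  transitivity (I[fun x => F x * \sum_i \sum_j 1 * (pc i x * pc j x)]).
    apply: eq_Rintegral => x /set_mem Ax.
    under eq_bigr do under eq_bigr do rewrite mul1r.
    under eq_bigr do rewrite -mulr_sumr (pc_sum r0_gt0 Ax) mulr1.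
    by rewrite (pc_sum r0_gt0 Ax) mulr1.
  rewrite (@integral_double_sum _ M i0 erefl)//; congr (_ * _).
  by under [in X in _ + X]eq_bigr do rewrite sumr_const card_ord;
    rewrite !sumr_const card_ord -mulr_natr; ring.
transitivity (I[fun x => F x * \sum_i \sum_j (cf i * cf j) * (pc i x * pc j x)]).
  apply: eq_Rintegral => x _; congr (_ * _); rewrite expr2 /ang mulr_suml.
  by apply: eq_bigr => i _; rewrite mulr_sumr; apply: eq_bigr => j _; ring.
rewrite (@integral_double_sum _ M i0 erefl) -/M.
have -> : \sum_i \sum_j cf i * cf j = 0.
  by under eq_bigr do rewrite -mulr_sumr cf0 mulr0; rewrite big1.
have n0 : n%:R != 0 :> R by rewrite pnatr_eq0 -lt0n.
have n2 : n%:R + 2 != 0 :> R by rewrite -natrD pnatr_eq0 addn2.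
rewrite /kappa addr0; under eq_bigr do rewrite -expr2.
by field; rewrite n0 n2.
Qed.

End moments.
End rotation_invariance.

(** * Hardy's inequality and the norm of the perturbation *)

Section angular_perturbation.
Context {R : realType} {n : nat}.
Variable r0 : R.
Hypothesis r0_gt0 : 0 < r0.
Local Notation mu := (@lebesgue_rV R n).
Local Notation A := (ext_domain r0 : set 'rV[R]_n).
Let oA : open A := open_ext_domain r0_gt0.
Let mA : measurable A := open_measurable_rV oA.
Local Notation "'I[' f ]" := (Rintegral mu A f) (format "'I[' f ]").
Local Notation intA f := (mu.-integrable A (EFin \o f)).
Local Notation D u i := (fun x => wgrad A u x ord0 i).

Variable u : 'rV[R]_n -> R.
Hypothesis hu : H10 A u.

Definition grad2 (x : 'rV[R]_n) : R := \sum_i D u i x ^+ 2.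
Definition h1dens (x : 'rV[R]_n) : R := grad2 x + u x ^+ 2.
Definition hardy_dens (x : 'rV[R]_n) : R := rho x * u x ^+ 2.

Let lu : L2 A u.
Proof. by case: (H1_L2 hu.1). Qed.

Let lD i : L2 A (D u i).
Proof. by case: (H1_L2 hu.1). Qed.

Lemma intA_u2 : intA (fun x => u x ^+ 2).
Proof. exact: lu.2. Qed.

Lemma intA_grad2 : intA grad2.
Proof. by apply: intO_sum => // i; exact: (lD i).2. Qed.

Lemma intA_h1dens : intA h1dens.
Proof. by apply: intOD => //; [exact: intA_grad2 | exact: intA_u2]. Qed.

Lemma intA_hardy_dens : intA hardy_dens.
Proof.
apply: intO_bmul => //; [exact: measurable_rho | | exact: intA_u2].
exact: mult_bound (multiplier_rho r0_gt0).
Qed.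

(** The divergence term d_i (zc_i u^2) consumed by Hardy's inequality. *)
Lemma quad_zc i : I[fun x => 2 * (zc i x * (u x * D u i x)) +
   (rho x - 2 * zc i x ^+ 2) * u x ^+ 2] = 0.
Proof.
rewrite -[RHS](quad_form_H10 oA i (multiplier_zc r0_gt0 i) hu).
apply: eq_Rintegral => x _; rewrite /quad_form eqxx.
by rewrite (_ : true%:R = 1 :> R)//; ring.
Qed.

Let intq i : intA (fun x => 2 * (zc i x * (u x * D u i x)) +
   (rho x - 2 * zc i x ^+ 2) * u x ^+ 2).
Proof.
have := intO_quad_form oA (mult_meas (multiplier_zc r0_gt0 i))
  (mult_dmeas (multiplier_zc r0_gt0 i) i) (mult_bound (multiplier_zc r0_gt0 i)) _ lu (lD i).
set f1 := quad_form _ _ _ _; set f2 := (fun x => _ + _).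
have -> : f1 = f2.
  apply/funext => x; rewrite /f1 /f2 /quad_form eqxx.
  by rewrite (_ : true%:R = 1 :> R)//; ring.
apply; have [C C0 hC] := mult_dbound (multiplier_zc r0_gt0 i); exists C => // x Ax.
exact: hC.
Qed.

(* Expand |grad u + g u x / |x|^2|^2 >= 0 with g = (n - 2) / 2; the remainder is a divergence. *)
Lemma hardy : ((n%:R - 2) / 2) ^+ 2 * I[hardy_dens] <= I[grad2].
Proof.
pose g : R := (n%:R - 2) / 2.
have sz x : A x -> \sum_i zc i x ^+ 2 = rho x.
  move=> Ax; under eq_bigr do rewrite zc_sqr.
  by rewrite -mulr_suml (pc_sum r0_gt0 Ax) mul1r.
have i1 := intO_sum oA (index_enum 'I_n) intq.
have i2 := intOZ oA g i1.
have i3 := intOD oA intA_grad2 i2.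
have i4 := intOZ oA (- g ^+ 2) intA_hardy_dens.
have : 0 <= I[fun x => grad2 x + g * (\sum_i (2 * (zc i x * (u x * D u i x)) +
   (rho x - 2 * zc i x ^+ 2) * u x ^+ 2)) + (- g ^+ 2) * hardy_dens x].
  apply: Rintegral_ge0 => x Ax.
  suff -> : grad2 x + g * (\sum_i (2 * (zc i x * (u x * D u i x)) +
     (rho x - 2 * zc i x ^+ 2) * u x ^+ 2)) + (- g ^+ 2) * hardy_dens x =
    \sum_i (D u i x + g * (zc i x * u x)) ^+ 2.
    by apply: sumr_ge0 => i _; exact: sqr_ge0.
  (* The coefficients rho - 2 zc_i^2 sum to (n - 2) rho = 2 g rho, so the zero-order terms add up to
     2 g^2 - g^2 = g^2 and complete the square. *)
  transitivity (\sum_i (D u i x ^+ 2 + 2 * g * (zc i x * (u x * D u i x))) +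
     g ^+ 2 * u x ^+ 2 * \sum_i zc i x ^+ 2).
    rewrite sz// /grad2 !big_split/= -mulr_suml sumrB -!mulr_sumr sz// sumr_const card_ord.
    by rewrite -[rho x *+ n]mulr_natr /hardy_dens /g; field.
  rewrite mulr_sumr -big_split/=; apply: eq_bigr => i _; ring.
rewrite (RintegralD mA i3 i4) (RintegralD mA intA_grad2 i2).
rewrite !(RintegralZl _ mA)//; last exact: intA_hardy_dens.
rewrite (Rintegral_sum r0_gt0)// big1 ?mulr0 ?addr0; last by move=> i _; exact: quad_zc.
by rewrite mulNr subr_ge0.
Qed.

(** Since rho < r0^-2 at every point of [A], equality of the integrals would force u = 0 almost
    everywhere. This strictness is what allows equality in the assumption on p. *)
Lemma hardy_dens_lt : ~ ae_in A (fun x => u x = 0) ->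
  r0 ^+ 2 * I[hardy_dens] < I[fun x => u x ^+ 2].
Proof.
move=> un0.
have r20 : 0 < r0 ^+ 2 by rewrite exprn_gt0.
have i1 := intOZ oA (- r0 ^+ 2) intA_hardy_dens.
have i2 := intOD oA intA_u2 i1.
have f0 x : A x -> 0 <= u x ^+ 2 + - r0 ^+ 2 * hardy_dens x.
  move=> Ax; rewrite /hardy_dens mulNr mulrA subr_ge0 ler_piMl ?sqr_ge0//.
  by rewrite mulrC -ler_pdivlMr// mul1r rho_le.
rewrite -subr_gt0 lt0r; apply/andP; split; last first.
  rewrite -mulNr -RintegralZl//; last exact: intA_hardy_dens.
  by rewrite -RintegralD//; [exact: Rintegral_ge0 | exact: intA_u2].
apply/negP => /eqP h; apply: un0.
have {}h : (\int[mu]_(x in A) `|(u x ^+ 2 + - r0 ^+ 2 * hardy_dens x)%:E| = 0)%E.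
  transitivity (\int[mu]_(x in A) (u x ^+ 2 + - r0 ^+ 2 * hardy_dens x)%:E)%E.
    by apply: eq_integral => x /set_mem Ax; rewrite gee0_abs// lee_fin f0.
  rewrite (integralE_Rintegral mA i2) RintegralD//; last exact: intA_u2.
  by rewrite RintegralZl ?mulNr ?h//; exact: intA_hardy_dens.
have {}h : ae_in A (fun x => (u x ^+ 2 + - r0 ^+ 2 * hardy_dens x)%:E = 0%E).
  exact/(ae_eq_integral_abs _ mA (measurable_int _ i2)).
apply: ae_inS h => x Ax [] h; apply/eqP; rewrite -sqrf_eq0; apply/eqP.
move: h; rewrite /hardy_dens mulNr mulrA -{1}[u x ^+ 2]mul1r -mulrBl => /eqP.
rewrite mulf_eq0 => /orP[|/eqP//].
by rewrite subr_eq0 eq_sym lt_eqF// mulrC -ltr_pdivlMr// mul1r rho_lt.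
Qed.

Hypothesis ru : radial A u.

Lemma rot_invariant_hardy_dens : rot_invariant r0 hardy_dens.
Proof.
move=> i j c s ij s0 cs; apply: ae_inS (radial_rot ij s0 cs ru) => x _ e.
by rewrite /hardy_dens e /rho sqn_rot.
Qed.

Lemma rot_invariant_h1dens : rot_invariant r0 h1dens.
Proof.
move=> i j c s ij s0 cs; have W : W11loc A u by case: hu.1.
have uT := radial_rot ij s0 cs ru.
apply: ae_inS2 (wgrad_rot r0_gt0 ij s0 cs W uT) uT => x _ e1 e2.
by rewrite /h1dens /grad2 -!enorm_sqr e1 e2.
Qed.

Variable cf : 'I_n -> R.
Hypothesis cf0 : \sum_i cf i = 0.
Variables al be : R.
Local Notation F := (Phi cf al be).
Local Notation dF := (dPhi cf be).
Local Notation k := (kappa cf).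

(** The cross term is a multiple of the integral of f against [ang cf], hence zero. *)
Lemma integral_Phi_sqr f : intA f -> rot_invariant r0 f ->
  I[fun x => f x * F x ^+ 2] = (al ^+ 2 + be ^+ 2 * k) * I[f].
Proof.
move=> hf rf.
have mang := mult_meas (multiplier_ang r0_gt0 cf).
have bang := mult_bound (multiplier_ang r0_gt0 cf).
have mang2 := mult_meas (multiplierM (multiplier_ang r0_gt0 cf) (multiplier_ang r0_gt0 cf)).
have bang2 := mult_bound (multiplierM (multiplier_ang r0_gt0 cf) (multiplier_ang r0_gt0 cf)).
have j1 := intA_bmul r0_gt0 hf mang bang.
have j2 := intA_bmul r0_gt0 hf mang2 bang2.
transitivity (I[fun x => al ^+ 2 * f x + (2 * al * be) * (f x * ang cf x) +
   be ^+ 2 * (f x * (ang cf x * ang cf x))]).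
  by apply: eq_Rintegral => x _; rewrite /Phi; ring.
have k0 := intOZ oA (al ^+ 2) hf.
have k1 := intOZ oA (2 * al * be) j1.
have k2 := intOZ oA (be ^+ 2) j2.
rewrite (RintegralD mA (intOD oA k0 k1) k2) (RintegralD mA k0 k1) !(RintegralZl _ mA)//.
rewrite (integral_ang r0_gt0 hf rf cf0) mulr0 addr0.
have := integral_ang_sqr r0_gt0 hf rf cf0.
by under eq_Rintegral do rewrite expr2; move=> ->; ring.
Qed.

(* [ang cf] is a degree-2 spherical harmonic: - Delta (ang cf) = 2 n (ang cf) / |x|^2. *)
Lemma H1norm2_Phi : H1norm2 A (fun x => F x * u x) =
  ((al ^+ 2 + be ^+ 2 * k) * I[h1dens] + 2 * n%:R * be ^+ 2 * k * I[hardy_dens])%:E.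
Proof.
have W : W11loc A u by case: hu.1.
have mP := multiplier_Phi r0_gt0 cf al be.
rewrite (H1norm2_mul oA mP W).
have [d hd] : exists d : 'I_n -> 'I_n -> 'rV[R]_n -> R, forall i,
    multiplier A (dF i) (d i) /\ forall x, A x ->
      d i i x = be * (2 * ((cf i - ang cf x) * (rho x - 4 * zc i x ^+ 2))).
  have h i := multiplier_dPhi r0_gt0 cf be i.
  by exists (fun i => s2val (cid2 (h i))) => i; case: cid2.
(* Formally [q i] is d_i (F d_i F u^2), of integral zero; it replaces |grad (F u)|^2 by F^2 |grad
   u|^2 - F (Laplacian of F) u^2. *)
pose q i := quad_form (fun x => F x * dF i x) (fun x => F x * d i i x + dF i x * dF i x) u (D u i).
have mq i := multiplierM mP (hd i).1.
have iq i : intA (q i).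
  apply: (intO_quad_form oA (mult_meas (mq i)) (mult_dmeas (mq i) i)
    (mult_bound (mq i)) _ lu (lD i)).
  have [C C0 hC] := mult_dbound (mq i); exists C => // x Ax; exact: hC.
have Iq i : I[q i] = 0 by exact: (quad_form_H10 oA i (mq i) hu).
have i1 : intA (fun x => h1dens x * F x ^+ 2).
  have mPP := multiplierM mP mP.
  have := intA_bmul r0_gt0 intA_h1dens (mult_meas mPP) (mult_bound mPP).
  by under eq_fun do rewrite -expr2.
have i2 := intO_sum oA (index_enum 'I_n) iq.
have mPa := multiplierM mP (multiplier_ang r0_gt0 cf).
have i3 : intA (fun x => hardy_dens x * (F x * ang cf x)).
  exact: (intA_bmul r0_gt0 intA_hardy_dens (mult_meas mPa) (mult_bound mPa)).
have i4 := intOZ oA (2 * n%:R * be) i3.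
transitivity (\int[mu]_(x in A) (h1dens x * F x ^+ 2 + \sum_i q i x +
    (2 * n%:R * be) * (hardy_dens x * (F x * ang cf x)))%:E)%E.
  apply: eq_integral => x /set_mem Ax; congr EFin.
  (* The Laplacian of F. As the c_i sum to 0 and the pc_i to 1, the two terms with factor 8
     cancel. *)
  have ed : \sum_i d i i x = - (2 * n%:R * be) * (rho x * ang cf x).
    transitivity (\sum_i (2 * be * rho x * cf i - 2 * be * rho x * ang cf x -
      8 * be * rho x * (cf i * pc i x) + 8 * be * rho x * ang cf x * pc i x)).
      apply: eq_bigr => i _; rewrite (hd i).2// zc_sqr; ring.
    rewrite big_split sumrB sumrB/= -!mulr_sumr cf0 (pc_sum r0_gt0 Ax).
    by rewrite sumr_const card_ord -[_ *+ n]mulr_natr -/(ang cf x); ring.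
  transitivity (\sum_i (F x ^+ 2 * D u i x ^+ 2 + q i x - F x * u x ^+ 2 * d i i x) +
     (F x * u x) ^+ 2).
    by congr (_ + _); apply: eq_bigr => i _; rewrite /q /quad_form; ring.
  rewrite sumrB -mulr_sumr ed big_split/= -mulr_sumr /h1dens /grad2 /hardy_dens; ring.
have i12 := intOD oA i1 i2.
rewrite (integralE_Rintegral mA (intOD oA i12 i4)); congr EFin.
rewrite (RintegralD mA i12 i4) (RintegralD mA i1 i2) (RintegralZl _ mA i3).
rewrite (Rintegral_sum r0_gt0)// big1// addr0.
rewrite (integral_Phi_sqr intA_h1dens rot_invariant_h1dens); congr (_ + _).
transitivity (2 * n%:R * be * I[fun x => al * (hardy_dens x * ang cf x) +
    be * (hardy_dens x * ang cf x ^+ 2)]).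
  by congr (_ * _); apply: eq_Rintegral => x _; rewrite /Phi; ring.
have ma := multiplier_ang r0_gt0 cf; have maa := multiplierM ma ma.
have j1 : intA (fun x => hardy_dens x * ang cf x).
  exact: (intA_bmul r0_gt0 intA_hardy_dens (mult_meas ma) (mult_bound ma)).
have j2 : intA (fun x => hardy_dens x * ang cf x ^+ 2).
  have := intA_bmul r0_gt0 intA_hardy_dens (mult_meas maa) (mult_bound maa).
  by under eq_fun do rewrite -expr2.
rewrite (RintegralD mA (intOZ oA al j1) (intOZ oA be j2)).
rewrite (RintegralZl _ mA j1) (RintegralZl _ mA j2).
rewrite (integral_ang r0_gt0 intA_hardy_dens rot_invariant_hardy_dens cf0).
rewrite (integral_ang_sqr r0_gt0 intA_hardy_dens rot_invariant_hardy_dens cf0); ring.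
Qed.

End angular_perturbation.

(** * Inequalities for powers *)

Section power_inequalities.
Context {R : realType}.
Implicit Types (p q x y : R).

Lemma powR1D_le_expR q x : 0 <= q -> -1 < x -> (1 + x) `^ q <= expR (q * x).
Proof.
move=> q0 x1; have x10 : 0 < 1 + x by rewrite -ltrBlDl sub0r.
rewrite /powR gt_eqF// ler_expR ler_wpM2l// -ler_expR lnK ?posrE//.
exact: expR_ge1Dx.
Qed.

(** From (1 - y)^q <= exp (- q y) <= 1 / (1 + q y), which is at most 1 - c y as soon as y <= (q - c)
    / (q c). The cap 1 / 2 keeps 1 - y positive. *)
Lemma powR1B_le q c : 0 < c -> c < q ->
  exists2 d, 0 < d <= 1 / 2 & forall y, 0 <= y <= d -> (1 - y) `^ q <= 1 - c * y.
Proof.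
move=> c0 cq; have q0 : 0 < q by apply: lt_trans cq.
pose d0 := (q - c) / (q * c).
have d00 : 0 < d0 by rewrite divr_gt0 ?subr_gt0 ?mulr_gt0.
exists (Num.min d0 (1 / 2)); first by rewrite lt_min ge_min d00 lexx orbT divr_gt0.
move=> y /andP[y0]; rewrite le_min => /andP[yd y2].
have q1 : 0 < 1 + q * y by rewrite ltr_pwDl// mulr_ge0// ltW.
apply: le_trans (powR1D_le_expR (ltW q0) _) _; first lra.
rewrite mulrN expRN; apply: (@le_trans _ _ (1 + q * y)^-1).
  by rewrite lef_pV2 ?posrE ?expR_gt0// expR_ge1Dx.
rewrite -[leLHS]mul1r ler_pdivrMr//.
have h : q * c * y <= q - c by rewrite mulrC -ler_pdivlMr ?mulr_gt0.
have := ler_wpM2r y0 h; nra.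
Qed.

(** From exp (q y) <= 1 / (1 - q y): the product (1 + c y) (1 - q y) exceeds 1 for 0 < y < (c - q) /
    (q c), and half of that bound is taken. *)
Lemma powR1D_lt q c : 0 < q -> q < c ->
  exists2 d, 0 < d & forall y, 0 < y <= d -> expR (q * y) < 1 + c * y.
Proof.
move=> q0 qc; have c0 : 0 < c by apply: lt_trans qc.
exists ((c - q) / (2 * (q * c))); first by rewrite divr_gt0 ?subr_gt0 ?mulr_gt0.
move=> y /andP[y0]; rewrite ler_pdivlMr ?mulr_gt0// => yd.
have qy1 : 0 < 1 - q * y.
  rewrite subr_gt0 -(ltr_pM2l c0) mulr1; nra.
rewrite -[q * y]opprK expRN; apply: (@le_lt_trans _ _ (1 - q * y)^-1).
  by rewrite lef_pV2 ?posrE ?expR_gt0// expR_ge1Dx.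
rewrite -[ltLHS]mul1r ltr_pdivrMr//.
have : 0 < y * (c - q) by rewrite mulr_gt0// subr_gt0.
have : 0 < c * q * y by rewrite !mulr_gt0.
nra.
Qed.

Lemma is_derive_powR1D p x : -1 < x ->
  is_derive x (1 : R) (fun t => (1 + t) `^ p) (p * (1 + x) `^ (p - 1)).
Proof.
move=> x1; have x10 : 0 < 1 + x by rewrite -ltrBlDl sub0r.
have dL : is_derive x (1:R) (fun t : R => 1 + t) 1.
  have := is_deriveD (is_derive_cst (1 : R) x (1:R)) (is_derive_id x (1:R)).
  by move=> h; apply: (is_derive_eq h); rewrite add0r.
have dP : is_derive (1 + x) (1:R) (fun t : R => t `^ p) (p * (1 + x) `^ (p - 1)).
  exact: is_derive1_powR.
have h := @is_derive1_comp _ (fun t : R => t `^ p) (fun t : R => 1 + t) x _ _ dP dL.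
by apply: (is_derive_eq h); rewrite mulr1.
Qed.

(** The derivative q (1 + t)^(q - 1) is at least q for t >= 0. *)
Lemma bernoulli_powR q x : 1 <= q -> 0 <= x -> 1 + q * x <= (1 + x) `^ q.
Proof.
move=> q1 x0.
have hd t : t \in `]0, x[ -> is_derive t (1:R) (fun t => (1 + t) `^ q) (q * (1 + t) `^ (q - 1)).
  rewrite in_itv/= => /andP[t0 _]; apply: is_derive_powR1D; lra.
have hc : {within `[0, x], continuous (fun t => (1 + t) `^ q)}.
  apply: derivable_within_continuous => t; rewrite in_itv/= => /andP[t0 _].
  have t1 : -1 < t by lra.
  by case: (is_derive_powR1D q t1).
have [t] := MVT_segment x0 hd hc.
rewrite in_itv/= => /andP[t0 _]; rewrite addr0 powR1 subr0 => e.
rewrite -lerBrDl e ler_wpM2r// ler_peMr ?(le_trans ler01)//.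
apply: (@le_trans _ _ ((1 + t) `^ 0)); first by rewrite powRr0.
by apply: ler_powR; rewrite ?lerDl ?subr_ge0.
Qed.

(** The difference h of the two sides vanishes at 0 and its derivative has the sign of its argument:
    on the right by Bernoulli, on the left by [powR1B_le], both with exponent p - 1 and slope 2 c /
    p, which the bound on c makes smaller than p - 1. *)
Lemma taylor_powR p c : 2 < p -> 0 < c -> c < p * (p - 1) / 2 ->
  exists2 d, 0 < d <= 1 / 2 &
    forall x, `|x| <= d -> 1 + p * x + c * x ^+ 2 <= (1 + x) `^ p.
Proof.
move=> p2 c0 cp; have p0 : 0 < p by lra.
have c1 : 2 * c / p < p - 1 by rewrite ltr_pdivrMr//; lra.
have c10 : 0 < 2 * c / p by rewrite divr_gt0// mulr_gt0.
have [d /andP[d0 d2] hd] := powR1B_le c10 c1.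
exists d; first by rewrite d0.
pose h t := (1 + t) `^ p - (1 + p * t + c * t ^+ 2).
pose dh t := p * (1 + t) `^ (p - 1) - (p + 2 * c * t).
have h0 : h 0 = 0 by rewrite /h addr0 powR1 expr0n !mulr0 !addr0 subrr.
have hder (t : R) : -1 < t -> is_derive t (1:R) h (dh t).
  move=> t1; have d1 := is_derive_powR1D p t1.
  have dq : is_derive t (1:R) (fun t : R => 1 + p * t + c * t ^+ 2) (p + 2 * c * t).
    have e1 := is_derive_cst (1 : R) t (1:R).
    have e2 := is_deriveZ p (is_derive_id t (1:R)).
    have e3 := is_deriveZ c (is_deriveX 2 (is_derive_id t (1:R))).
    rewrite exprfctE in e3.
    have e := is_deriveD (is_deriveD e1 e2) e3.
    by apply: (is_derive_eq e); rewrite /GRing.scale/= expr1; ring.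
  exact: (is_deriveB d1 dq).
have hcont (a b : R) : -1 < a -> {within `[a, b], continuous h}.
  move=> a1; apply: derivable_within_continuous => t; rewrite in_itv/= => /andP[t0 _].
  by case: (hder t (lt_le_trans a1 t0)).
have pe t : p + 2 * c * t = p * (1 + 2 * c / p * t) by field; rewrite gt_eqF.
move=> x xd; rewrite -subr_ge0 -/(h x).
have [x0|x0] := leP 0 x.
  have hx t : t \in `]0, x[ -> is_derive t (1:R) h (dh t).
    by rewrite in_itv/= => /andP[t0 _]; apply: hder; lra.
  have [t] := MVT_segment x0 hx (hcont 0 x ltac:(lra)).
  rewrite in_itv/= => /andP[t0 _]; rewrite h0 !subr0 => ->; rewrite mulr_ge0//.
  rewrite /dh subr_ge0 pe ler_pM2l//.
  apply: le_trans (bernoulli_powR _ t0); last lra.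
  by rewrite lerD2l ler_wpM2r// ltW.
have xd' : - x <= d by rewrite -ltr0_norm.
have hx t : t \in `]x, 0[ -> is_derive t (1:R) h (dh t).
  by rewrite in_itv/= => /andP[t0 _]; apply: hder; lra.
have [t] := MVT_segment (ltW x0) hx (hcont x 0 ltac:(lra)).
rewrite in_itv/= => /andP[t0 t1]; rewrite h0 !sub0r => /(congr1 -%R); rewrite opprK => ->.
rewrite mulrN opprK mulr_le0 ?(ltW x0)//.
rewrite /dh subr_le0 pe ler_pM2l//.
have := hd (- t); rewrite opprK mulrN opprK; apply.
by rewrite oppr_ge0 t1/=; lra.
Qed.

End power_inequalities.

(** * The perturbation stays in the cone *)

Section cone.
Context {R : realType} {N m : nat}.
Variable r0 : R.
Hypotheses (r0_gt0 : 0 < r0) (m_gt0 : (0 < m)%N) (m_lt : (m < N)%N).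
Local Notation A := (ext_domain r0 : set 'rV[R]_N).
Local Notation B := (polar_domain r0 : set 'rV[R]_2).

(* With these coefficients [ang cf] depends on theta only and is decreasing in theta. *)
Definition cf (i : 'I_N) : R := if (i < m)%N then m%:R^-1 else - (N - m)%:R^-1.

Lemma sum_cf : \sum_i cf i = 0.
Proof.
rewrite (bigID (fun i : 'I_N => (i < m)%N))/=.
have -> : \sum_(i < N | (i < m)%N) cf i = \sum_(i < m) (m%:R^-1 : R).
  rewrite (big_ord_widen_cond N predT (fun=> m%:R^-1))/=; last exact: ltnW.
  by apply: eq_bigr => i im; rewrite /cf im.
have e : \sum_(i < N) (1 : R) = \sum_(i < N | (i < m)%N) 1 + \sum_(i < N | ~~ (i < m)%N) 1.
  by rewrite (bigID (fun i : 'I_N => (i < m)%N)).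
have e1 : \sum_(i < N | (i < m)%N) (1 : R) = m%:R.
  by rewrite -(big_ord_widen_cond N predT (fun=> 1))/= ?sumr_const ?card_ord// ltnW.
have e2 : \sum_(i < N | ~~ (i < m)%N) (1 : R) = (N - m)%:R.
  by move: e; rewrite e1 sumr_const card_ord natrB ?(ltnW m_lt)// => ->; ring.
have -> : \sum_(i < N | ~~ (i < m)%N) cf i = - (N - m)%:R^-1 * \sum_(i < N | ~~ (i < m)%N) 1.
  by rewrite mulr_sumr; apply: eq_bigr => i im; rewrite /cf (negbTE im) mulr1.
rewrite e2 sumr_const card_ord -[_ *+ m]mulr_natr mulNr !mulVf ?subrr// pnatr_eq0 -lt0n//.
by rewrite subn_gt0.
Qed.

Lemma sum_cf2_gt0 : 0 < \sum_i cf i ^+ 2.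
Proof.
rewrite (bigD1 (Ordinal (ltn_trans m_gt0 m_lt)))//= ltr_wpDr//.
  by apply: sumr_ge0 => i _; exact: sqr_ge0.
by rewrite /cf/= m_gt0 exprn_gt0// invr_gt0 ltr0n.
Qed.

Lemma norm_cf_le1 i : `|cf i| <= 1.
Proof.
rewrite /cf; case: ifP => _; rewrite ?normrN normfV normr_nat invf_le1 ?ltr0n ?ler1n//.
by rewrite subn_gt0. by rewrite subn_gt0.
Qed.

(** [ang cf] is an average, with weights pc_i, of coefficients in [-1, 1]. *)
Lemma norm_ang_le1 x : A x -> `|ang cf x| <= 1.
Proof.
move=> Ax; apply: le_trans (ler_norm_sum _ _ _) _.
rewrite -(pc_sum r0_gt0 Ax); apply: ler_sum => i _.
by rewrite normrM [`|pc i x|]ger0_norm ?pc_ge0// ler_piMl ?pc_ge0 ?norm_cf_le1.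
Qed.

Definition slope : R := m%:R^-1 + (N - m)%:R^-1.

Lemma slope_ge0 : 0 <= slope.
Proof. by rewrite addr_ge0// invr_ge0. Qed.

(** The argument of [asin] lies in [0, 1], so the sine inverts it and the cosine is nonnegative. *)
Lemma sin_polar x : A x ->
  [/\ 0 <= sin (polar_angle m x), 0 <= cos (polar_angle m x) &
     sin (polar_angle m x) ^+ 2 = \sum_(i < N | (m <= i)%N) pc i x].
Proof.
move=> Ax; have x0 : 0 < enorm x by apply: lt_trans Ax.
rewrite /polar_angle; set S := \sum_(i < N | _) _; set t := _ * _.
have S0 : 0 <= S by apply: sumr_ge0 => i _; exact: sqr_ge0.
have t0 : 0 <= t by rewrite mulr_ge0 ?sqrtr_ge0// invr_ge0 ltW.
have t2 : t ^+ 2 = \sum_(i < N | (m <= i)%N) pc i x.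
  rewrite exprMn exprVn [Num.sqrt S ^+ 2]sqr_sqrtr// -sqnE mulrC mulr_suml; apply: eq_bigr => i _.
  by rewrite /pc /zc mulrA expr2.
have t1 : t <= 1.
  rewrite -(@ler_pXn2r _ 2)// ?nnegrE// expr1n t2 -(pc_sum r0_gt0 Ax).
  rewrite [leRHS](bigID (fun i : 'I_N => (m <= i)%N))/= lerDl.
  by apply: sumr_ge0 => i _; exact: pc_ge0.
have ht : t \in `[-1, 1] by rewrite in_itv/= t1 andbT (le_trans _ t0)// lerN10.
by rewrite asinK// cos_asin//.
Qed.

(** The coefficients take two values that differ by [slope], and the pc_i with i >= m add up to the
    squared sine of theta. *)
Lemma ang_polar x : A x -> ang cf x = m%:R^-1 - slope * sin (polar_angle m x) ^+ 2.
Proof.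
move=> Ax; have [_ _ ->] := sin_polar Ax.
have e : m%:R^-1 = \sum_i m%:R^-1 * pc i x :> R by rewrite -mulr_sumr (pc_sum r0_gt0 Ax) mulr1.
rewrite {1}e /ang mulr_sumr.
rewrite [LHS](bigID (fun i : 'I_N => (m <= i)%N))/=.
rewrite [X in _ = X - _](bigID (fun i : 'I_N => (m <= i)%N))/=.
rewrite addrAC -sumrB; congr (_ + _); apply: eq_bigr => i im.
  rewrite /cf ltnNge im /slope/=; set a := m%:R^-1; set b := (N - m)%:R^-1; ring.
by rewrite /cf ltnNge im.
Qed.

Variables al be : R.
Hypotheses (be_gt0 : 0 < be) (be_lt : be < al).

Lemma Phi_gt0 x : A x -> 0 < Phi cf al be x.
Proof.
move=> Ax; rewrite /Phi; have := norm_ang_le1 Ax; rewrite ler_norml => /andP[h _].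
have := ler_wpM2l (ltW be_gt0) h; rewrite mulrN1 => h2.
by rewrite -ltrBlDl sub0r (lt_le_trans _ h2)// ltrN2.
Qed.

(** * The perturbation factor as a function of theta *)

Definition psi (y : 'rV[R]_2) : R := al + be * (m%:R^-1 - slope * sin (y ord0 ord_max) ^+ 2).
Definition dpsi (i : 'I_2) (y : 'rV[R]_2) : R :=
  (i == ord_max)%:R * (be * (- (2 * slope) * (sin (y ord0 ord_max) * cos (y ord0 ord_max)))).

Lemma open_polar_domain : open B.
Proof.
have -> : B = [set y | r0 < y ord0 ord0] `&`
    ([set y | 0 < y ord0 ord_max] `&` [set y | y ord0 ord_max < pi / 2]).
  by apply/seteqP; split => y /=;
    [move=> [h1 /andP[h2 h3]] | move=> [h1 [h2 h3]]; split => //; apply/andP].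
have c0 (i : 'I_2) := @continuous_coord R 2 i.
have og (a : R) i : open [set y : 'rV[R]_2 | a < y ord0 i].
  rewrite (_ : [set _ | _] = (fun y : 'rV[R]_2 => y ord0 i) @^-1` [set t | a < t])//.
  by apply: open_comp => [y _|]; [exact: c0 | exact: open_gt].
have ol (a : R) i : open [set y : 'rV[R]_2 | y ord0 i < a].
  rewrite (_ : [set _ | _] = (fun y : 'rV[R]_2 => y ord0 i) @^-1` [set t | t < a])//.
  by apply: open_comp => [y _|]; [exact: c0 | exact: open_lt].
exact: (openI (og r0 ord0) (openI (og 0 ord_max) (ol (pi / 2) ord_max))).
Qed.

Let mB : measurable B := open_measurable_rV open_polar_domain.

Lemma smooth_psi : smooth psi.
Proof.
move=> k; apply: of_classD; first exact: of_class_cst.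
apply: of_classM; first exact: of_class_cst.
apply: of_classD; first exact: of_class_cst.
under eq_fun do rewrite -mulNr expr2.
apply: of_classM; first exact: of_class_cst.
by apply: of_classM; exact: smooth_sin.
Qed.

Lemma multiplier_psi : multiplier B psi dpsi.
Proof.
have ms : measurable_fun B (fun y : 'rV[R]_2 => sin (y ord0 ord_max)).
  by apply: continuous_measurable_rV => //; exact/smooth_continuous/smooth_sin.
have mc : measurable_fun B (fun y : 'rV[R]_2 => cos (y ord0 ord_max)).
  by apply: continuous_measurable_rV => //; exact/smooth_continuous/smooth_cos.
have sl0 := slope_ge0.
have hs (t : R) : `|sin t| <= 1 by rewrite ler_norml sin_geN1 sin_le1.
have hc (t : R) : `|cos t| <= 1 by rewrite ler_norml cos_geN1 cos_le1.
split.
- move=> phi [sphi [K [cK KB phi0]]]; split; first exact: smoothM smooth_psi sphi.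
  by exists K; split => // x Kx; rewrite phi0// mulr0.
- move=> i y _.
  have := @is_derive_coord R 2 ord_max i (fun t => al + be * (m%:R^-1 - slope * sin t ^+ 2))
    (be * (- (2 * slope) * (sin (y ord0 ord_max) * cos (y ord0 ord_max)))) y.
  rewrite [ord_max == i]eq_sym; apply.
  set t := y ord0 ord_max.
  have e1 := is_derive_sin t.
  have e2 := is_deriveX 2 e1; rewrite exprfctE in e2.
  have e3 := is_deriveZ slope e2.
  have e4 := is_deriveB (is_derive_cst (m%:R^-1 : R) t (1:R)) e3.
  have e5 := is_deriveD (is_derive_cst al t (1:R)) (is_deriveZ be e4).
  by apply: (is_derive_eq e5); rewrite /GRing.scale/= expr1; ring.
- by apply: continuous_measurable_rV => //; exact/smooth_continuous/smooth_psi.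
- move=> i; apply: measurable_funM => //; apply: measurable_funM => //.
  by apply: measurable_funM => //; exact: measurable_funM.
- exists (`|al| + `|be| * (`|m%:R^-1| + slope)).
    by rewrite addr_ge0// mulr_ge0// addr_ge0.
  move=> y _; apply: le_trans (ler_normD _ _) _; rewrite lerD2l normrM ler_wpM2l//.
  apply: le_trans (ler_normB _ _) _; rewrite lerD2l normrM ger0_norm// ler_piMr//.
  by rewrite normrX exprn_ile1.
- exists (`|be| * (2 * slope)); first by rewrite !mulr_ge0.
  move=> i y _; rewrite /dpsi; case: eqP => _; last by rewrite mul0r normr0 !mulr_ge0.
  rewrite mul1r normrM ler_wpM2l// mulNr normrN normrM (@ger0_norm _ (2 * slope)) ?mulr_ge0//.
  by rewrite ler_piMr ?mulr_ge0// normrM mulr_ile1.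
Qed.

(** The theta-derivative of psi U is psi U_theta + psi_theta U. The first term is nonpositive
    because psi > 0 on the image of [A], the second because psi decreases on [0, pi / 2] and U >=
    0. *)
Lemma coneK_Phi (u : 'rV[R]_N -> R) : coneK m r0 u ->
  coneK m r0 (fun x => Phi cf al be x * u x).
Proof.
move=> [W [U [Ut [uU hU hUt]]] u0 hu].
have oA := open_ext_domain r0_gt0 : open A.
have hPu : H10 A (fun x => Phi cf al be x * u x).
  by apply: (H10_mul oA (multiplier_Phi r0_gt0 cf al be)).
have polarE x : polar m x ord0 ord_max = polar_angle m x by rewrite mxE.
have PhiE x : A x -> Phi cf al be x = psi (polar m x).
  by move=> Ax; rewrite /Phi /psi polarE ang_polar.
split => //; first by case: hPu => -[].
- exists (fun y => psi y * U y), (fun y => psi y * Ut y + dpsi ord_max y * U y); split.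
  + by apply: ae_inS uU => x Ax ->; rewrite PhiE.
  + exact: weak_pderiv_mul multiplier_psi hU.
  + have uU0 : ae_in A (fun x => 0 <= U (polar m x)).
      by apply: ae_inS2 uU u0 => x _ <-.
    apply: ae_inS2 hUt uU0 => x Ax h1 h2.
    have [s0 c0 _] := sin_polar Ax.
    have p0 : 0 < psi (polar m x) by rewrite -PhiE// Phi_gt0.
    have d0 : dpsi ord_max (polar m x) <= 0.
      rewrite /dpsi eqxx mul1r polarE pmulr_rle0// mulNr oppr_le0.
      by rewrite !mulr_ge0// slope_ge0.
    rewrite -[leRHS]addr0 lerD//; first by rewrite pmulr_rle0.
    by rewrite mulr_le0_ge0.
- by apply: ae_inS u0 => x Ax h; rewrite mulr_ge0// ltW// Phi_gt0.
Qed.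

End cone.

(** * Scaling to the Nehari set *)

Section scaling.
Context {R : realType}.

(* With w = 1 + al y, t^(p-2) <= w / (1 + be y) and w^(p/2) <= exp (al p y / 2) < 1 + be y. *)
Lemma nehari_scale_lt (p al be y E B t : R) : 2 < p -> 0 <= al -> 0 < y -> 0 < E ->
  expR (al * p / 2 * y) < 1 + be * y -> E * (1 + be * y) <= B ->
  0 < t -> t `^ (p - 2) = E * (1 + al * y) / B ->
  t ^+ 2 * (E * (1 + al * y)) < E.
Proof.
move=> p2 al0 y0 E0 hexp hB t0 ht; set w := 1 + al * y.
have w1 : 1 <= w by rewrite lerDl mulr_ge0// ltW.
have w0 : 0 < w by rewrite (lt_le_trans _ w1).
have b0 : 0 < 1 + be * y by apply: lt_trans hexp; exact: expR_gt0.
have B0 : 0 < B by apply: lt_le_trans hB; exact: mulr_gt0.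
have p20 : 0 < (p - 2) / 2 by rewrite divr_gt0// subr_gt0.
rewrite mulrCA -[ltRHS]mulr1 ltr_pM2l// ltNge; apply/negP => tw.
(* The exponent (p - 2) / 2 turns t^2 into t^(p-2), whose value is prescribed; together with its
   factor w this produces w^(p/2). *)
have : 1 <= (t ^+ 2 * w) `^ ((p - 2) / 2).
  apply: (@le_trans _ _ (1 `^ ((p - 2) / 2))); first by rewrite powR1.
  apply: ge0_ler_powR => //; rewrite ?nnegrE ?(ltW p20)//.
  by rewrite (le_trans ler01).
apply/negP; rewrite -ltNge powRM ?sqr_ge0 ?(ltW w0)//.
have -> : (t ^+ 2) `^ ((p - 2) / 2) = t `^ (p - 2).
  by rewrite -powR_mulrn ?(ltW t0)// -powRrM; congr (_ `^ _); field.
rewrite ht -/w.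
have -> : w `^ ((p - 2) / 2) = w `^ (p / 2) / w.
  rewrite -[X in _ = _ / X]powRr1 ?(ltW w0)// -powRB; last by rewrite (gt_eqF w0) implybT.
  by congr (_ `^ _); field.
have h1 : w `^ (p / 2) < 1 + be * y.
  apply: le_lt_trans hexp; have := @powR1D_le_expR R (p / 2) (al * y).
  rewrite -/w (_ : p / 2 * (al * y) = al * p / 2 * y); last by ring.
  apply; first by rewrite divr_ge0// ltW// (lt_trans _ p2).
  by rewrite (lt_le_trans (ltrN10 _))// mulr_ge0// ltW.
have -> : E * w / B * (w `^ (p / 2) / w) = E * w `^ (p / 2) / B.
  by field; rewrite !gt_eqF.
rewrite ltr_pdivrMr// mul1r; apply: lt_le_trans hB.
by rewrite ltr_pM2l.
Qed.

End scaling.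

Theorem proposition3p2 (R : realType) (N m : nat) (r0 : R)
    (a : 'rV[R]_N -> R) (p : R)
    (hN : (3 <= N)%N) (hm : (2 <= m <= N - 1)%N) (hr0 : 0 < r0)
    (a_radial : radial (ext_domain r0) a)
    (a_W11loc : W11loc (ext_domain r0) a)
    (a_Loo : Lp (ext_domain r0) +oo%E a)
    (a_ge0 : ae_in (ext_domain r0) (fun x => 0 <= a x))
    (grad_a_L2 : Lp (ext_domain r0) 2%:E (fun x => enorm (wgrad (ext_domain r0) a x)))
    (a_neq0 : ~ ae_in (ext_domain r0) (fun x => a x = 0))
    (hp : 2 + (2 * N%:R) / (((N%:R - 2) / 2) ^+ 2 + r0 ^+ 2) <= p)
    (hp_crit : (p%:E < crit_exp (N - m + 1))%E)
    (u : 'rV[R]_N -> R) (hu : K_ground_state m r0 a p u) :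
  ~ radial (ext_domain r0) u.
Proof.
move=> ru; have [_ [hK un0 hden] hen _] := hu.
have [W _ u_ge0 hH] := hK.
have m0 : (0 < m)%N by case/andP: hm => h _; exact: leq_trans h.
have mN : (m < N)%N.
  by case/andP: hm => _ h; rewrite (leq_ltn_trans h)// subn1 prednK// (leq_trans _ hN).
set A : set 'rV[R]_N := ext_domain r0.
have oA : open A := open_ext_domain hr0.
have mA : measurable A := open_measurable_rV oA.
pose mu := @lebesgue_rV R N.
have N0 : 0 < N%:R :> R by rewrite ltr0n (leq_trans _ hN).
set c := @cf R N m.
have c0 : \sum_i c i = 0 by exact: sum_cf.
pose k := kappa c.
have k0 : 0 < k.
  by rewrite /k /kappa divr_gt0 ?mulr_gt0 ?addr_gt0// sum_cf2_gt0.
pose G := \int[mu]_(x in A) grad2 r0 u x.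
pose U2 := \int[mu]_(x in A) (u x ^+ 2).
pose H := \int[mu]_(x in A) hardy_dens u x.
pose E := \int[mu]_(x in A) h1dens r0 u x.
have EE : E = G + U2.
  exact: (RintegralD mA (intA_grad2 hr0 hH) (intA_u2 hH)).
have H0 : 0 <= H by apply: Rintegral_ge0 => x _; rewrite mulr_ge0 ?rho_ge0 ?sqr_ge0.
have hG := hardy hr0 hH; have hU := hardy_dens_lt hr0 hH un0.
set g := (N%:R - 2) / 2 in hG hp.
have K0 : 0 < g ^+ 2 + r0 ^+ 2 by rewrite ltr_wpDl ?sqr_ge0 ?exprn_gt0.
(* Hardy's inequality added to the strict comparison of r0^2 H with the integral of u^2. *)
have KH : (g ^+ 2 + r0 ^+ 2) * H < E by rewrite mulrDl EE ler_ltD.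
have E0 : 0 < E by apply: le_lt_trans KH; rewrite mulr_ge0// ltW.
have p2 : 2 < p.
  by apply: lt_le_trans hp; rewrite ltrDl divr_gt0// mulr_gt0.
(* Here the lower bound on p enters at full strength. *)
have NH : 2 * N%:R * H < (p - 2) * E.
  have h : 2 * N%:R <= (p - 2) * (g ^+ 2 + r0 ^+ 2).
    by rewrite -ler_pdivrMr// lerBrDl.
  apply: (@le_lt_trans _ _ ((p - 2) * ((g ^+ 2 + r0 ^+ 2) * H))).
    by rewrite mulrA ler_wpM2r.
  by rewrite ltr_pM2l// subr_gt0.
have normPhi al be := H1norm2_Phi hr0 hH ru c0 al be.
have normu : H1norm2 A u = E%:E.
  have := normPhi 1 0; rewrite expr1n expr0n /= !(mulr0, mul0r) !addr0 mul1r => <-.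
  by congr H1norm2; apply/funext => x; rewrite /Phi mul0r addr0 mul1r.
have ma : measurable_fun A a by case: a_Loo.
have mu_ : measurable_fun A u by case: W => -[].
have mpow f : measurable_fun A f -> measurable_fun A (fun x => f x `^ p).
  move=> mf; apply: (measurableT_comp (measurable_powR p) mf).
pose f0 x := `|a x| * `|u x| `^ p.
have f00 x : 0 <= f0 x by rewrite mulr_ge0// powR_ge0.
have mf0 : measurable_fun A f0.
  apply: measurable_funM; first exact: measurableT_comp.
  by apply: mpow; exact: measurableT_comp.
have nlu : nonlin_term r0 a p u = (\int[mu]_(x in A) (f0 x)%:E)%E.
  apply: ae_eq_integral => //.
  - apply/measurable_EFinP; apply: measurable_funM => //.
    by apply: mpow; exact: measurableT_comp.
  - exact/measurable_EFinP.
  - by apply: ae_inS a_ge0 => x _ h; rewrite /f0 (ger0_norm h).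
(* The Nehari identity, which also excludes an infinite integral because E is finite. *)
have If0E : (\int[mu]_(x in A) (f0 x)%:E = E%:E)%E.
  move: hden; rewrite /denergy -/A normu nlu.
  case: (\int[mu]_(x in A) _)%E => [r| |]//= => /eqP.
  by rewrite -EFinB eqe subr_eq0 => /eqP ->.
have if0 : mu.-integrable A (EFin \o f0).
  apply/integrableP; split; first exact/measurable_EFinP.
  under eq_integral do rewrite /= ger0_norm//.
  by rewrite If0E ltry.
have If0 : \int[mu]_(x in A) f0 x = E by rewrite /Rintegral If0E.
have rf0 : rot_invariant r0 f0.
  move=> i j c' s' ij s0 cs.
  apply: ae_inS2 (radial_rot ij s0 cs a_radial) (radial_rot ij s0 cs ru) => x _ e1 e2.
  by rewrite /f0 e1 e2.
(* The second-order coefficient of the norm: |(1 + s phi) u|^2 = E (1 + al s^2). *)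
pose al := k * (1 + 2 * N%:R * H / E).
have al0 : 0 <= al by rewrite mulr_ge0 ?(ltW k0)// addr_ge0// divr_ge0 ?(ltW E0)// !mulr_ge0// ltW.
(* Chosen so that al p / 2 = l k; the bound l < p (p - 1) / 2 is then [NH] rewritten. *)
pose l := p / 2 * (1 + 2 * N%:R * H / E).
have lp : l < p * (p - 1) / 2.
  rewrite /l (_ : p * (p - 1) / 2 = p / 2 * (1 + (p - 2))); last by ring.
  rewrite ltr_pM2l ?divr_gt0// ?(lt_trans _ p2)// ltrD2l ltr_pdivrMr//.
have l0 : 0 < l.
  rewrite mulr_gt0 ?divr_gt0 ?(lt_trans _ p2)// ltr_pwDl// divr_ge0 ?(ltW E0)// !mulr_ge0// ltW//.
(* A Taylor constant strictly between the two: below p (p - 1) / 2 for [taylor_powR], above l so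
   that the gain in the nonlinear term outweighs the growth of the norm. *)
pose d := (l + p * (p - 1) / 2) / 2.
have ld : l < d by rewrite /d; lra.
have dp : d < p * (p - 1) / 2 by rewrite /d; lra.
have [del /andP[del0 del1] hdel] := taylor_powR p2 (lt_trans l0 ld) dp.
have alE : al * p / 2 = l * k by rewrite /al /l; ring.
have alp : al * p / 2 < d * k by rewrite alE ltr_pM2r.
have alp0 : 0 < al * p / 2 by rewrite alE mulr_gt0.
have [y0 y00 hy] := powR1D_lt alp0 alp.
(* [del] serves the Taylor bound, as |phi| <= 1; [y0] must bound s^2, and s^2 <= s because s <= 1 /
   2. *)
pose s := Num.min del y0.
have s0 : 0 < s by rewrite lt_min del0.
have sdel : s <= del by rewrite ge_min lexx.
have s1 : s <= 1 / 2 by apply: le_trans del1.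
have s2 : 0 < s ^+ 2 <= y0.
  rewrite exprn_gt0//= (@le_trans _ _ s)//; last by rewrite ge_min lexx orbT.
  by rewrite expr2 ler_piMr ?(ltW s0)//; lra.
have {}hy := hy _ s2; have {s2} [s20 _] := andP s2.
pose b x := (1 + s * ang c x) `^ p.
have sang x : A x -> `|s * ang c x| <= s.
  by move=> Ax; rewrite normrM gtr0_norm// ler_piMr ?(ltW s0)// (norm_ang_le1 hr0).
have mang : measurable_fun A (ang c) := mult_meas (multiplier_ang hr0 c).
have bang := mult_bound (multiplier_ang hr0 c).
have mb : measurable_fun A b.
  by apply: mpow; apply: measurable_funD => //; exact: measurable_funM.
have bb : exists2 C : R, 0 <= C & forall x, A x -> `|b x| <= C.
  exists (2 `^ p); first exact: powR_ge0.
  move=> x Ax; rewrite ger0_norm ?powR_ge0//.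
  have := sang x Ax; rewrite ler_norml => /andP[h1 h2].
  by apply: ge0_ler_powR; rewrite ?nnegrE; lra.
have if0b : mu.-integrable A (EFin \o (fun x => f0 x * b x)).
  exact: (intA_bmul hr0 if0 mb bb).
pose B := \int[mu]_(x in A) (f0 x * b x).
(* The Taylor bound integrated against [f0]: the linear term averages to zero and the quadratic one
   contributes the factor k. *)
have hB : E * (1 + d * k * s ^+ 2) <= B.
  have maa := multiplierM (multiplier_ang hr0 c) (multiplier_ang hr0 c).
  have j1 := intA_bmul hr0 if0 mang bang.
  have j2 := intA_bmul hr0 if0 (mult_meas maa) (mult_bound maa).
  have k1 := intOZ oA (p * s) j1.
  have k2 := intOZ oA (d * s ^+ 2) j2.
  have k12 := intOD oA (intOD oA if0 k1) k2.
  have -> : E * (1 + d * k * s ^+ 2) = \int[mu]_(x in A) (f0 x + p * s * (f0 x * ang c x) +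
      d * s ^+ 2 * (f0 x * (ang c x * ang c x))).
    rewrite (RintegralD mA (intOD oA if0 k1) k2) (RintegralD mA if0 k1).
    rewrite (RintegralZl _ mA j1) (RintegralZl _ mA j2) If0.
    rewrite (integral_ang hr0 if0 rf0 c0).
    have := integral_ang_sqr hr0 if0 rf0 c0; rewrite If0 -/k.
    by under eq_Rintegral do rewrite expr2; move=> ->; ring.
  apply: (le_Rintegral mA k12 if0b) => x Ax.
  rewrite (_ : _ + _ + _ = f0 x * (1 + p * (s * ang c x) + d * (s * ang c x) ^+ 2)); last by ring.
  by rewrite ler_wpM2l// hdel// (le_trans (sang x Ax)).
have B0 : 0 < B.
  have d0 : 0 < d := lt_trans l0 ld.
  apply: lt_le_trans hB; rewrite pmulr_rgt0// ltr_pwDl//.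
  exact: mulr_ge0 (mulr_ge0 (ltW d0) (ltW k0)) (ltW s20).
pose w := 1 + al * s ^+ 2.
have w0 : 0 < w by rewrite ltr_pwDl// mulr_ge0// ltW.
(* The scaling with t^2 E w = t^p B, which puts the rescaled function in the Nehari set. *)
pose t := (E * w / B) `^ (p - 2)^-1.
have t0 : 0 < t by rewrite powR_gt0// divr_gt0// mulr_gt0.
have tp2 : t `^ (p - 2) = E * w / B.
  by rewrite -powRrM mulVf ?powRr1// ?gt_eqF ?subr_gt0// divr_ge0 ?(ltW B0)// mulr_ge0// ltW.
have tp : t `^ p = t ^+ 2 * (E * w / B).
  rewrite -tp2 -powR_mulrn ?(ltW t0)// -powRD; last by rewrite [t == 0]gt_eqF// implybT.
  by congr (_ `^ _); ring.
have key : t ^+ 2 * (E * w) < E := nehari_scale_lt p2 al0 s20 E0 hy hB t0 tp2.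
(* The function t (1 + s phi) u, in the form al + be phi with 0 < be < al that the cone lemmas
   require. *)
pose v x := Phi c t (t * s) x * u x.
have ts0 : 0 < t * s by rewrite mulr_gt0.
have tst : t * s < t by rewrite gtr_pMr//; lra.
have PhiE x : Phi c t (t * s) x = t * (1 + s * ang c x) by rewrite /Phi; ring.
have normv : H1norm2 A v = (t ^+ 2 * (E * w))%:E.
  rewrite normPhi -/E -/H -/k /w /al; congr EFin; field.
  by rewrite gt_eqF.
have nlv : nonlin_term r0 a p v = (t ^+ 2 * (E * w))%:E.
  transitivity (\int[mu]_(x in A) (t `^ p * (f0 x * b x))%:E)%E.
    apply: ae_eq_integral => //.
    - apply/measurable_EFinP; apply: measurable_funM => //; apply: mpow.
      apply: measurableT_comp => //; apply: measurable_funM => //.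
      exact: mult_meas (multiplier_Phi hr0 c t (t * s)).
    - by apply/measurable_EFinP; apply: measurable_funM => //; exact: measurable_funM.
    - apply: ae_inS a_ge0 => x Ax h; congr EFin; rewrite /v /f0 /b.
      have P0 := Phi_gt0 hr0 m0 mN ts0 tst Ax.
      have q0 : 0 <= 1 + s * ang c x.
        by have := sang x Ax; rewrite ler_norml => /andP[h1 h2]; lra.
      rewrite normrM powRM// (gtr0_norm P0) PhiE powRM// ?(ltW t0)// (ger0_norm h).
      by ring.
  rewrite (integralE_Rintegral mA (intOZ oA _ if0b)) (RintegralZl _ mA if0b) -/B tp.
  by congr EFin; field; rewrite gt_eqF.
have hv : nehariK m r0 a p v.
  split.
  - exact: coneK_Phi.
  - move=> hv0; apply: un0; apply: ae_inS hv0 => x Ax /eqP; rewrite mulf_eq0 => /orP[|/eqP//].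
    by rewrite gt_eqF// (Phi_gt0 hr0 m0 mN ts0 tst).
  - by rewrite /denergy -/A normv nlv -EFinB subrr.
(* By the Nehari identity both energies are (1/2 - 1/p) times the squared norm, so [key] contradicts
   minimality. *)
have : (c_I m r0 a p <= energy r0 a p v)%E by apply: ereal_inf_lbound; exists v.
rewrite -hen /energy -/A normu normv nlu nlv If0E -!EFinM -!EFinB lee_fin -!mulrBl.
apply/negP; rewrite -ltNge ltr_pM2l// subr_gt0 ltf_pV2 ?posrE//.
by rewrite (lt_trans _ p2).
Qed.
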